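(* There exists a polynomial-time algorithm that solves MFASP exactly on factor-critical graphs.
   Context: All graphs are finite, undirected and simple, with unit edge weights. A graph is factor-critical if deleting any single vertex yields a graph with a perfect matching. For edge weights $w\in\mathbb{R}^E_{\ge 0}$, a fractional $w$-vertex cover is $y\in\mathbb{R}^V_{\ge 0}$ with $y_u+y_v\ge w_{uv}$ for all $\{u,v\}\in E$; $\nu(G,w)$ is the maximum $w$-weight of a matching, $\tau_f(G,w)$ the minimum of $\sum_v y_v$ over fractional $w$-vertex covers; $(G,w)$ is stable if $\nu(G,w)=\tau_f(G,w)$. A fractional additive stabilizer is $c\in\mathbb{R}^E_{\ge0}$ with $(G,\mathbb{1}+c)$ stable; MFASP (Minimum Fractional Additive Stabilizer Problem) asks, given $G$, for a fractional additive stabilizer minimizing $\sum_e c_e$. *)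

(* Defs.v *)
(* Written in MathComp, with [realType] from MathComp-Analysis. *)
From HB Require Import structures.
From mathcomp Require Import all_boot all_order all_algebra.
From mathcomp Require Import reals.

Set Implicit Arguments.
Unset Strict Implicit.
Unset Printing Implicit Defensive.

Import Order.TTheory GRing.Theory Num.Theory.

Local Open Scope ring_scope.

Record sgraph (V : finType) := SGraph {
  adj :> rel V;
  adj_sym : symmetric adj;
  adj_irr : irreflexive adj
}.

Section Graphs.
Variable V : finType.
Implicit Types (G : sgraph V) (M : {set {set V}}).

Definition edges G : {set {set V}} :=
  [set e | [exists u, exists v, adj G u v && (e == [set u; v])]].

Definition matching G M : bool := (M \subset edges G) && trivIset M.

Definition perfect_matching G M : bool :=
  matching G M && (cover M == [set: V]).

Lemma del_vertex_sym G (x : V) :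
  symmetric (fun u v : {z : V | z != x} => adj G (val u) (val v)).
Proof. by move=> u v; rewrite adj_sym. Qed.

Lemma del_vertex_irr G (x : V) :
  irreflexive (fun u v : {z : V | z != x} => adj G (val u) (val v)).
Proof. by move=> u; rewrite adj_irr. Qed.

Definition del_vertex G (x : V) : sgraph {z : V | z != x} :=
  SGraph (@del_vertex_sym G x) (@del_vertex_irr G x).

End Graphs.

Definition factor_critical (V : finType) (G : sgraph V) : Prop :=
  forall x : V, exists M, perfect_matching (del_vertex G x) M.

(* A weight vector indexed by the edges is a function on {set V}; only its
   values on [edges G] are ever used. *)
Section Stabilizers.
Variables (R : realType) (V : finType).
Implicit Types (G : sgraph V) (w c : {set V} -> R) (y : V -> R).

(* The default value 0 is the weight of the empty matching. *)
Definition nu G w : R :=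
  \big[Num.max/0]_(M : {set {set V}} | matching G M) \sum_(e in M) w e.

Definition fractional_cover G w y : Prop :=
  (forall v, 0 <= y v) /\
  (forall u v, adj G u v -> w [set u; v] <= y u + y v).

(* The set is nonempty and bounded below by 0, and the infimum is attained,
   being the value of a linear program. *)
Definition tau_f G w : R :=
  inf (fun s => exists2 y, fractional_cover G w y & s = \sum_v y v).

Definition stable G w : Prop := nu G w = tau_f G w.

Definition frac_additive_stabilizer G c : Prop :=
  (forall e, e \in edges G -> 0 <= c e) /\ stable G (fun e => 1 + c e).

Definition min_frac_additive_stabilizer G c : Prop :=
  frac_additive_stabilizer G c /\
  forall c', frac_additive_stabilizer G c' ->
    \sum_(e in edges G) c e <= \sum_(e in edges G) c' e.

End Stabilizers.

(* Algorithms are programs of the random access machine of Cook and Reckhow: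
   registers X_0, X_1, ... holding natural numbers, an input tape read from
   left to right and an output tape.  Every instruction costs one time unit.
   There is no multiplication, so the bit length of the largest number stored
   grows by at most one per step (up to the constants of the program and the
   numbers of the input), and polynomial time on this machine is polynomial
   time on Turing machines. *)
Inductive instr : Type :=
  | IConst of nat & nat    (* IConst i k : X_i := k *)
  | IAdd of nat & nat & nat  (* IAdd i j k : X_i := X_j + X_k *)
  | ISub of nat & nat & nat  (* ISub i j k : X_i := X_j - X_k, truncated at 0 *)
  | ILoad of nat & nat     (* ILoad i j : X_i := X_(X_j) *)
  | IStore of nat & nat    (* IStore i j : X_(X_i) := X_j *)
  | IJz of nat & nat       (* IJz i l : if X_i = 0, go to instruction l *)
  | IRead of nat           (* IRead i : X_i := next input number, 0 if none *)
  | IPrint of nat.         (* IPrint i : append X_i to the output *)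

Definition program : Type := seq instr.

Record config : Type := Config {
  counter : nat;
  registers : nat -> nat;
  input : seq nat;
  output : seq nat
}.

Definition set_register (m : nat -> nat) (i v : nat) : nat -> nat :=
  fun j => if j == i then v else m j.

Definition exec_instr (a : instr) (s : config) : config :=
  let: Config l m xs os := s in
  match a with
  | IConst i k => Config l.+1 (set_register m i k) xs os
  | IAdd i j k => Config l.+1 (set_register m i (m j + m k)%N) xs os
  | ISub i j k => Config l.+1 (set_register m i (m j - m k)%N) xs os
  | ILoad i j => Config l.+1 (set_register m i (m (m j))) xs os
  | IStore i j => Config l.+1 (set_register m (m i) (m j)) xs os
  | IJz i l' => Config (if m i == 0%N then l' else l.+1) m xs os
  | IRead i => Config l.+1 (set_register m i (head 0%N xs)) (behead xs) os
  | IPrint i => Config l.+1 m xs (rcons os (m i))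
  end.

(* The machine halts when [counter] points outside the program. *)
Definition ram_step (P : program) (s : config) : config :=
  if onth P (counter s) is Some a then exec_instr a s else s.

Definition ram_init (xs : seq nat) : config := Config 0 (fun=> 0%N) xs [::].

Definition computes_within (P : program) (t : nat) (xs os : seq nat) : Prop :=
  let s := iter t (ram_step P) (ram_init xs) in
  (size P <= counter s)%N /\ output s = os.

Definition bit_size (xs : seq nat) : nat :=
  (\sum_(x <- xs) (trunc_log 2 x).+1)%N.

(* The number of vertices followed by the adjacency matrix, row by row. *)
Definition encode_graph (n : nat) (G : sgraph 'I_n) : seq nat :=
  n :: [seq nat_of_bool (adj G i j) | i <- enum 'I_n, j <- enum 'I_n].

(* Numerator and denominator, in lowest terms, of the value at each edge
   {i, j} with i < j, in lexicographic order of (i, j).  The encoding is used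
   for vectors that are nonnegative on the edges only. *)
Definition encode_weights (n : nat) (G : sgraph 'I_n)
    (c : {set 'I_n} -> rat) : seq nat :=
  flatten [seq [:: `|numq (c [set p.1; p.2])|%N; `|denq (c [set p.1; p.2])|%N]
          | p <- [seq p <- [seq (i, j) | i <- enum 'I_n, j <- enum 'I_n]
                 | adj G p.1 p.2 && (p.1 < p.2)%N]].

(* Main.v *)
(** A stabilizer c comes with a matching M and a fractional cover y of
    (G, 1 + c) of the same value.  Parity leaves a vertex x exposed by M, where
    y vanishes, so c costs at least y(V) - (n - 1) / 2.  Conversely, any cover y
    of G with y x = 0 and any perfect matching M of G - x give the stabilizer
    y u + y v - 1 on the edges uv of M and 0 elsewhere, which costs exactly
    that.  It remains to minimize y(V) over x and the covers vanishing at x: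
    for each x this is, by König's theorem in the bipartite double cover, a
    bipartite matching problem, with a half-integral solution.  The perfect
    matchings of the graphs G - x come from a variant of Edmonds' search in
    which every vertex reached stores an entire matching exposing it, so that
    blossoms need no contraction and appear only in the invariant.  Both
    searches are programs whose loops all have length n, hence polynomial. *)
Require Import Defs.
From HB Require Import structures.
From mathcomp Require Import all_boot all_order all_algebra.
From mathcomp Require Import reals.
From mathcomp Require Import zify lra.

Set Implicit Arguments.
Unset Strict Implicit.
Unset Printing Implicit Defensive.

Import Order.TTheory GRing.Theory Num.Theory.

Local Open Scope ring_scope.

(** * A language of bounded loops and its compilation to the machine *)

Local Open Scope nat_scope.

(** The blossom search has to be complete only on factor-critical graphs: a search that stops
    without reaching some z is refuted by counting against a near-perfect matching exposing z, which
    exists by hypothesis. Every blossom is odd, so that matching must leave each of them, whereas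
    the current matching leaves a blossom at most once and that of the root never; too few outer
    vertices can receive these edges. The difficulty is that, without contraction, the count needs a
    single partition into blossoms that suits all stored matchings simultaneously; the invariant is
    designed for this. Loops that cannot be left early shape both searches. Repeating until nothing
    changes becomes |V| repetitions, justified by a measure that rises strictly unless the state is
    fixed, and a successful augmentation freezes the state. Covers are kept doubled, so that the
    machine computes with natural numbers only. *)

Inductive expr : Type :=
  | Cst of nat
  | Get of nat & expr
  | Plus of expr & expr
  | Minus of expr & expr.

(* Memory is a family of named arrays, a scalar being the entry 0 of its
   array.  [For a c] runs [c] with [a] = 0, ..., n - 1, where n is the scalar
   [size_name], so that every command terminates in time polynomial in n. *)
Inductive com : Type :=
  | Skip
  | Seq of com & com
  | Store of nat & expr & expr
  | If of expr & com & com
  | For of nat & com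
  | Read of nat
  | Print of expr.

Definition memory := nat -> nat -> nat.

Record store := St { cells : memory; inp : seq nat; out : seq nat }.

Notation size_name := 29.

Definition upd (m : memory) (a i x : nat) : memory :=
  fun b j => if (b == a) && (j == i) then x else m b j.

Arguments upd : simpl never.

Definition set_mem (s : store) (a i x : nat) : store :=
  St (upd (cells s) a i x) (inp s) (out s).
Arguments set_mem s a i x /.

Fixpoint eval (m : memory) (e : expr) : nat :=
  match e with
  | Cst k => k
  | Get a e => m a (eval m e)
  | Plus e1 e2 => eval m e1 + eval m e2
  | Minus e1 e2 => eval m e1 - eval m e2
  end.

Fixpoint exec (c : com) (s : store) : store :=
  match c with
  | Skip => s
  | Seq c1 c2 => exec c2 (exec c1 s)
  | Store a e1 e2 => set_mem s a (eval (cells s) e1) (eval (cells s) e2)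
  | If e c1 c2 => if eval (cells s) e == 0 then exec c2 s else exec c1 s
  | For a c => foldl (fun s k => exec c (set_mem s a 0 k)) s
                     (iota 0 (cells s size_name 0))
  | Read a => St (upd (cells s) a 0 (head 0 (inp s))) (behead (inp s)) (out s)
  | Print e => St (cells s) (inp s) (rcons (out s) (eval (cells s) e))
  end.

Fixpoint writes (c : com) : seq nat :=
  match c with
  | Skip | Print _ => [::]
  | Seq c1 c2 | If _ c1 c2 => writes c1 ++ writes c2
  | Store a _ _ | Read a => [:: a]
  | For a c => a :: writes c
  end.

(** The frame rule of all simulations: facts about arrays outside the computable list [writes c]
    survive [c]. *)
Lemma exec_frame c s a i : a \notin writes c -> cells (exec c s) a i = cells s a i.
Proof.
elim: c s => //=.
- by move=> c1 IH1 c2 IH2 s; rewrite mem_cat negb_or => /andP[? ?];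
    rewrite IH2 // IH1.
- by move=> b e1 e2 s; rewrite inE /upd => /negbTE ->.
- move=> e c1 IH1 c2 IH2 s; rewrite mem_cat negb_or => /andP[? ?].
  by case: ifP => _; rewrite ?IH1 ?IH2.
- move=> b c IH s; rewrite inE negb_or => /andP[/negbTE nab nac].
  move: (iota _ _) => l; elim: l s => //= k l IHl s; rewrite IHl IH //= /upd.
  by rewrite nab.
- by move=> b s; rewrite inE /upd => /negbTE ->.
Qed.

Lemma for_ind (I : nat -> store -> Prop) a c s :
    I 0 s ->
    (forall i s', i < cells s size_name 0 -> I i s' ->
       I i.+1 (exec c (set_mem s' a 0 i))) ->
  I (cells s size_name 0) (exec (For a c) s).
Proof.
move=> I0 IS /=; move: (cells s _ _) IS => n IS.
elim: n IS => [|n IHn] IS //.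
rewrite -addn1 iotaD foldl_cat /= add0n addn1.
by apply: (IS) => //; apply: IHn => i s' lt_in; apply: IS; apply: ltnW.
Qed.

(** Interleaving 32 arrays lets each of them grow without bound, and a power of two makes an address
    computable by five doublings, as the machine can only add. Array 30 holds the loop counters,
    indexed by nesting depth, and array 31 is the stack on which expressions are evaluated. *)
Definition reg (a i : nat) : nat := 32 * i + a.
Notation tmp := 31.
Notation ctr := 30.

Lemma reg_eq a i b j : a < 32 -> b < 32 ->
  (reg a i == reg b j) = (a == b) && (i == j).
Proof.
rewrite /reg => lta ltb; apply/eqP/andP => [|[/eqP -> /eqP ->]] //.
by split; apply/eqP; lia.
Qed.

Fixpoint compile_expr (d : nat) (e : expr) : program :=
  let t := reg tmp d in
  let t' := reg tmp d.+1 in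
  match e with
  | Cst k => [:: IConst t k]
  | Get a e => compile_expr d e ++ nseq 5 (IAdd t t t) ++
      [:: IConst t' a; IAdd t t t'; ILoad t t]
  | Plus e1 e2 => compile_expr d e1 ++ compile_expr d.+1 e2 ++ [:: IAdd t t t']
  | Minus e1 e2 => compile_expr d e1 ++ compile_expr d.+1 e2 ++ [:: ISub t t t']
  end.

(** Needed before [compile], whose forward jumps have absolute targets. *)
Fixpoint com_size (c : com) : nat :=
  match c with
  | Skip => 0
  | Seq c1 c2 => com_size c1 + com_size c2
  | Store a e1 e2 => size (compile_expr 0 e1) + 7 + size (compile_expr 1 e2) + 1
  | If e c1 c2 => size (compile_expr 0 e) + 1 + com_size c1 + 2 + com_size c2
  | For a c => 1 + 4 + com_size c + 4
  | Read _ => 1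
  | Print e => size (compile_expr 0 e) + 1
  end.

(* [o] is the position of the code, [d] the number of enclosing loops. *)
Fixpoint compile (c : com) (o d : nat) : program :=
  let t := reg tmp 0 in
  let t' := reg tmp 1 in
  match c with
  | Skip => [::]
  | Seq c1 c2 => compile c1 o d ++ compile c2 (o + com_size c1) d
  | Store a e1 e2 =>
      (compile_expr 0 e1 ++ nseq 5 (IAdd t t t) ++ [:: IConst t' a; IAdd t t t'])
      ++ compile_expr 1 e2 ++ [:: IStore t t']
  | If e c1 c2 =>
      let o1 := o + size (compile_expr 0 e) + 1 in
      let o2 := o1 + com_size c1 + 2 in
      compile_expr 0 e ++ [:: IJz t o2] ++ compile c1 o1 d ++
      [:: IConst t 0; IJz t (o2 + com_size c2)] ++ compile c2 o2 d
  | For a c =>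
      let k := reg ctr d in
      [:: IConst k 0] ++
      [:: ISub t (reg size_name 0) k; IJz t (o + com_size (For a c));
          IConst t 0; IAdd (reg a 0) k t] ++
      compile c (o + 5) d.+1 ++
      [:: IConst t 1; IAdd k k t; IConst t 0; IJz t (o + 1)]
  | Read a => [:: IRead (reg a 0)]
  | Print e => compile_expr 0 e ++ [:: IPrint t]
  end.

Lemma size_compile c o d : size (compile c o d) = com_size c.
Proof.
elim: c o d => //= [c1 IH1 c2 IH2|a e1 e2|e c1 IH1 c2 IH2|a c IH|e] o d;
  rewrite ?size_cat /= ?size_cat /= ?IH1 ?IH2 ?IH //; lia.
Qed.

(** ** Straight-line code *)

Definition code_at (P : program) (o : nat) (code : program) : Prop :=
  exists pre post, P = pre ++ code ++ post /\ size pre = o.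

Lemma code_at_cat P o c1 c2 :
  code_at P o (c1 ++ c2) -> code_at P o c1 /\ code_at P (o + size c1) c2.
Proof.
move=> [pre [post [-> <-]]]; split.
  by exists pre, (c2 ++ post); rewrite !catA.
by exists (pre ++ c1), post; rewrite !catA size_cat.
Qed.

Lemma code_at_onth P o a code : code_at P o (a :: code) -> onth P o = Some a.
Proof.
move=> [pre [post [-> <-]]].
by rewrite onth_cat ltnn subnn.
Qed.

Definition straight (a : instr) : bool := if a is IJz _ _ then false else true.

Lemma run_straight P code s : code_at P (counter s) code -> all straight code ->
  iter (size code) (ram_step P) s = foldl (fun t a => exec_instr a t) s code.
Proof.
elim: code s => // a code IH s hcode /= /andP[sa scode].
rewrite -iterS iterSr /ram_step (code_at_onth hcode).
apply: IH => //; have [_] := @code_at_cat P _ [:: a] code hcode.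
by case: s {hcode} => o m xs os; rewrite addn1; case: a sa.
Qed.

Lemma straight_expr d e : all straight (compile_expr d e).
Proof. by elim: e d => //= *; rewrite !all_cat /= ?andbT //; apply/andP. Qed.

Local Notation run code s := (foldl (fun t a => exec_instr a t) s code).

(** Evaluation at stack depth d may spoil only the temporaries from d on; this is how a left operand
    survives the evaluation of the right one, one level higher. *)
Definition agree_below (d : nat) (m m' : nat -> nat) : Prop :=
  forall j, (forall d', d <= d' -> j != reg tmp d') -> m' j = m j.

Lemma agree_reg d m m' a i :
  agree_below d m m' -> a < tmp -> m' (reg a i) = m (reg a i).
Proof. by move=> agr lta; apply: agr => d' _; rewrite reg_eq; lia. Qed.

Lemma agree_trans d m1 m2 m3 :
  agree_below d m1 m2 -> agree_below d m2 m3 -> agree_below d m1 m3.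
Proof. by move=> a12 a23 j hj; rewrite a23 // a12. Qed.

Lemma agree_le d d' m m' : d <= d' -> agree_below d' m m' -> agree_below d m m'.
Proof.
by move=> le_dd' agr j hj; apply: agr => d1 /(leq_trans le_dd'); apply: hj.
Qed.

Lemma agree_set d d' m x : d <= d' ->
  agree_below d m (set_register m (reg tmp d') x).
Proof. by move=> le_dd' j hj; rewrite /set_register (negbTE (hj _ le_dd')). Qed.

Definition represents (m : nat -> nat) (M : memory) : Prop :=
  forall a i, a < 30 -> m (reg a i) = M a i.

Lemma agree_represents d m m' M :
  agree_below d m m' -> represents m M -> represents m' M.
Proof. by move=> agr rep a i lta; rewrite (agree_reg i agr) ?rep //; lia. Qed.

Fixpoint expr_ok (e : expr) : bool :=
  match e with
  | Cst _ => true
  | Get a e => (a < 30) && expr_ok e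
  | Plus e1 e2 | Minus e1 e2 => expr_ok e1 && expr_ok e2
  end.

Lemma run_address d o m xs os a :
  exists m', [/\ run (nseq 5 (IAdd (reg tmp d) (reg tmp d) (reg tmp d)) ++
       [:: IConst (reg tmp d.+1) a; IAdd (reg tmp d) (reg tmp d) (reg tmp d.+1)])
       (Config o m xs os) = Config (o + 7) m' xs os,
     m' (reg tmp d) = reg a (m (reg tmp d)) & agree_below d m m'].
Proof.
have neq : (reg tmp d == reg tmp d.+1) = false by rewrite reg_eq // eqxx /=; lia.
eexists; split => /=; first by rewrite !addnS addn0.
- by rewrite /set_register !eqxx neq /reg; lia.
- by do 7! (apply: agree_trans; last by apply: agree_set; lia).
Qed.

Lemma run_expr e d o m xs os M : represents m M -> expr_ok e ->
  exists m', [/\ run (compile_expr d e) (Config o m xs os) =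
                   Config (o + size (compile_expr d e)) m' xs os,
                 m' (reg tmp d) = eval M e & agree_below d m m'].
Proof.
have neq d1 : (reg tmp d1 == reg tmp d1.+1) = false.
  by rewrite reg_eq // eqxx /=; lia.
elim: e d o m => [k|a e IH|e1 IH1 e2 IH2|e1 IH1 e2 IH2] d o m rep /=.
- move=> _; eexists; split; first by rewrite addn1.
    by rewrite /set_register eqxx.
  exact: agree_set.
- move=> /andP[lta ok]; have [m1 [r1 v1 g1]] := IH d o m rep ok.
  rewrite foldl_cat r1.
  set o1 := o + size _.
  have [m2 [r2 v2 g2]] := run_address d o1 m1 xs os a.
  have g02 := agree_trans g1 g2.
  exists (set_register m2 (reg tmp d) (m2 (m2 (reg tmp d)))); split.
  + have -> : run (nseq 5 (IAdd (reg tmp d) (reg tmp d) (reg tmp d)) ++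
        [:: IConst (reg tmp d.+1) a; IAdd (reg tmp d) (reg tmp d) (reg tmp d.+1);
            ILoad (reg tmp d) (reg tmp d)]) (Config o1 m1 xs os) =
      exec_instr (ILoad (reg tmp d) (reg tmp d)) (Config (o1 + 7) m2 xs os).
      by rewrite -r2.
    by rewrite /o1 size_cat /=; congr Config; lia.
  + rewrite /set_register eqxx v2 v1 (agree_reg _ g02) ?rep //; lia.
  + exact: agree_trans g02 (agree_set _ _ (leqnn d)).
- move=> /andP[ok1 ok2]; have [m1 [r1 v1 g1]] := IH1 d o m rep ok1.
  have [m2 [r2 v2 g2]] := IH2 d.+1 (o + size (compile_expr d e1)) m1
    (agree_represents g1 rep) ok2.
  rewrite !foldl_cat r1 r2 /=; eexists; split.
  + by rewrite !size_cat /=; congr Config; lia.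
  + rewrite /set_register eqxx v2 g2 ?v1 // => d' ltdd'.
    by rewrite reg_eq // eqxx /=; lia.
  + apply: agree_trans (agree_set _ _ (leqnn d)).
    by apply: agree_trans g1 (agree_le (leqnSn d) g2).
- move=> /andP[ok1 ok2]; have [m1 [r1 v1 g1]] := IH1 d o m rep ok1.
  have [m2 [r2 v2 g2]] := IH2 d.+1 (o + size (compile_expr d e1)) m1
    (agree_represents g1 rep) ok2.
  rewrite !foldl_cat r1 r2 /=; eexists; split.
  + by rewrite !size_cat /=; congr Config; lia.
  + rewrite /set_register eqxx v2 g2 ?v1 // => d' ltdd'.
    by rewrite reg_eq // eqxx /=; lia.
  + apply: agree_trans (agree_set _ _ (leqnn d)).
    by apply: agree_trans g1 (agree_le (leqnSn d) g2).
Qed.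

(** ** Correctness of the compiler *)

Definition reaches (P : program) (k : nat) (s s' : config) : Prop :=
  exists2 t, t <= k & iter t (ram_step P) s = s'.

Lemma reaches_trans P k1 k2 s1 s2 s3 :
  reaches P k1 s1 s2 -> reaches P k2 s2 s3 -> reaches P (k1 + k2) s1 s3.
Proof.
move=> [t1 le1 <-] [t2 le2 <-]; exists (t2 + t1); first by lia.
by rewrite iterD.
Qed.

Lemma reaches_le P k k' s s' : k <= k' -> reaches P k s s' -> reaches P k' s s'.
Proof. by move=> le_kk' [t le_tk <-]; exists t => //; apply: leq_trans le_kk'. Qed.

Lemma reaches0 P k s : reaches P k s s.
Proof. by exists 0. Qed.

Lemma reaches_straight P code s :
  code_at P (counter s) code -> all straight code ->
  reaches P (size code) s (run code s).
Proof. by move=> at_s sc; exists (size code) => //; rewrite run_straight. Qed.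

Lemma reaches_jump P o m xs os i l : code_at P o [:: IJz i l] ->
  reaches P 1 (Config o m xs os) (Config (if m i == 0 then l else o.+1) m xs os).
Proof. by move=> /code_at_onth at_o; exists 1; rewrite //= /ram_step /= at_o. Qed.

Lemma set_register_same m i x : set_register m i x i = x.
Proof. by rewrite /set_register eqxx. Qed.

Lemma reaches_goto P o m xs os d l :
  code_at P o [:: IConst (reg tmp d) 0; IJz (reg tmp d) l] ->
  reaches P 2 (Config o m xs os)
              (Config l (set_register m (reg tmp d) 0) xs os).
Proof.
move=> at_o; have [at1 at2] := @code_at_cat P o [:: _] [:: _] at_o.
apply: (@reaches_trans P 1 1); first exact: (reaches_straight (s := Config o m xs os) at1).
have /= := reaches_jump (set_register m (reg tmp d) 0) xs os at2.
by rewrite set_register_same eqxx addn1.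
Qed.

Fixpoint com_ok (c : com) : bool :=
  match c with
  | Skip => true
  | Seq c1 c2 => com_ok c1 && com_ok c2
  | Store a e1 e2 => [&& a < size_name, expr_ok e1 & expr_ok e2]
  | If e c1 c2 => [&& expr_ok e, com_ok c1 & com_ok c2]
  | For a c => (a < size_name) && com_ok c
  | Read a => a < size_name
  | Print e => expr_ok e
  end.

(** Compiled loops compare with [size_name] in every round, whereas [exec] reads it once, on entry;
    the two agree because accepted programs never write it. *)
Lemma size_not_written c : com_ok c -> size_name \notin writes c.
Proof.
elim: c => //= [c1 IH1 c2 IH2|a e1 e2|e c1 IH1 c2 IH2|a c IH|a].
- by move=> /andP[/IH1 h1 /IH2 h2]; rewrite mem_cat (negbTE h1) (negbTE h2).
- by rewrite inE => /and3P[lta _ _]; lia.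
- by move=> /and3P[_ /IH1 h1 /IH2 h2]; rewrite mem_cat (negbTE h1) (negbTE h2).
- by move=> /andP[lta /IH h]; rewrite inE (negbTE h) orbF; lia.
- by rewrite inE; lia.
Qed.

(** An upper bound: adding up both branches of a conditional keeps it a polynomial in n. The 8
    counts two instructions each for the test, the copy of the counter, its increment and the jump
    back; the final 2 is the failing test. *)
Fixpoint cost (c : com) (n : nat) : nat :=
  match c with
  | Seq c1 c2 => cost c1 n + cost c2 n
  | If e c1 c2 => size (compile_expr 0 e) + 1 + cost c1 n + 2 + cost c2 n
  | For a c => 1 + n * (8 + cost c n) + 2
  | _ => com_size c
  end.

Lemma represents_upd m M a i x : a < 30 -> represents m M ->
  represents (set_register m (reg a i) x) (upd M a i x).
Proof.
move=> lta rep b j ltb; rewrite /set_register /upd reg_eq ?rep //; lia.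
Qed.

Lemma represents_ctr m M d x :
  represents m M -> represents (set_register m (reg ctr d) x) M.
Proof.
move=> rep a i lta; rewrite /set_register reg_eq ?(rep a i) //; last by lia.
by case: eqP => // ea; lia.
Qed.

(** Loops count in hidden registers, so a body may overwrite its loop variable. The last clause
    protects the counters of the enclosing loops. *)
Definition compiles (P : program) (n : nat) (c : com) : Prop :=
  forall o d m s, code_at P o (compile c o d) -> represents m (cells s) ->
    cells s size_name 0 = n ->
  exists2 m', reaches P (cost c n) (Config o m (inp s) (out s))
     (Config (o + com_size c) m' (inp (exec c s)) (out (exec c s))) &
   represents m' (cells (exec c s)) /\
   forall d', d' < d -> m' (reg ctr d') = m (reg ctr d').

Lemma reaches_expr P e d o m xs os M :
    code_at P o (compile_expr d e) -> represents m M -> expr_ok e ->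
  exists m', [/\ reaches P (size (compile_expr d e)) (Config o m xs os)
                   (Config (o + size (compile_expr d e)) m' xs os),
                 m' (reg tmp d) = eval M e & agree_below d m m'].
Proof.
move=> at_o rep ok; have [m' [r v g]] := run_expr d o xs os rep ok.
exists m'; split => //; rewrite -r.
exact: (reaches_straight (s := Config o m xs os) at_o (straight_expr d e)).
Qed.

Lemma compiles_store P n a e1 e2 :
  a < size_name -> expr_ok e1 -> expr_ok e2 -> compiles P n (Store a e1 e2).
Proof.
move=> lta ok1 ok2 o d m s at_o rep _.
have rs : all straight (compile (Store a e1 e2) o d).
  by rewrite /= !all_cat /= !straight_expr.
have := reaches_straight (s := Config o m (inp s) (out s)) at_o rs.
rewrite size_compile /= !foldl_cat.
have [m1 [-> v1 g1]] := run_expr 0 o (inp s) (out s) rep ok1.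
have [m2 [r2 v2 g2]] := run_address 0 (o + size (compile_expr 0 e1)) m1
  (inp s) (out s) a.
move: r2; rewrite foldl_cat => ->.
have rep2 := agree_represents (agree_trans g1 g2) rep.
have [m3 [-> v3 g3]] := run_expr 1 (o + size (compile_expr 0 e1) + 7) (inp s)
  (out s) rep2 ok2.
rewrite /= => hr.
exists (set_register m3 (m3 (reg tmp 0)) (m3 (reg tmp 1))).
  rewrite (_ : o + com_size (Store a e1 e2) =
    (o + size (compile_expr 0 e1) + 7 + size (compile_expr 1 e2)).+1).
    exact: hr.
  by rewrite /=; lia.
have v30 : m3 (reg tmp 0) = reg a (eval (cells s) e1).
  by rewrite g3 ?v2 ?v1 // => d' hd'; rewrite reg_eq // eqxx /=; lia.
rewrite v30 v3; split.
  by apply: represents_upd; [lia | exact: agree_represents g3 rep2].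
move=> d' _; rewrite /set_register reg_eq //; last by lia.
rewrite (_ : (ctr == a) = false) /=; last by lia.
by rewrite (agree_reg _ g3) // (agree_reg _ g2) // (agree_reg _ g1).
Qed.

Lemma compiles_if P n e c1 c2 : expr_ok e ->
  compiles P n c1 -> compiles P n c2 -> compiles P n (If e c1 c2).
Proof.
move=> ok IH1 IH2 o d m s /= at_o rep nE.
have [at_e at1] := code_at_cat at_o.
have [at_j at2] := @code_at_cat P _ [:: _] _ at1.
have [at_c1 at3] := code_at_cat at2.
have [at_g at_c2] := @code_at_cat P _ [:: _; _] _ at3.
move: at_c1 at_g at_c2; rewrite size_compile /=.
set o1 := o + _ + 1; set o2 := o1 + _ + 2 => at_c1 at_g at_c2.
have [m1 [r1 v1 g1]] := reaches_expr (inp s) (out s) at_e rep ok.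
have rep1 := agree_represents g1 rep.
have := reaches_jump m1 (inp s) (out s) at_j; rewrite v1 => rj.
have r2 := reaches_trans r1 rj.
case: ifP r2 => _ r2.
- have [m2 r3 [rep2 g2]] := IH2 _ _ m1 s at_c2 rep1 nE.
  exists m2; last first.
    by split => // d' hd'; rewrite g2 // (agree_reg _ g1).
  have := reaches_trans r2 r3.
  rewrite (_ : o2 + com_size c2 =
    o + (size (compile_expr 0 e) + 1 + com_size c1 + 2 + com_size c2)).
    by apply: reaches_le; lia.
  by rewrite /o2 /o1; lia.
- rewrite -[(_ + size _).+1]addn1 in r2.
  have [m2 r3 [rep2 g2]] := IH1 _ _ m1 s at_c1 rep1 nE.
  have r4 := reaches_goto m2 (inp (exec c1 s)) (out (exec c1 s)) at_g.
  exists (set_register m2 (reg tmp 0) 0); last first.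
    split; first exact: agree_represents (agree_set _ _ (leqnn 0)) rep2.
    move=> d' hd'; rewrite (agree_reg _ (agree_set _ _ (leqnn 0))) //.
    by rewrite g2 // (agree_reg _ g1).
  have := reaches_trans r2 (reaches_trans r3 r4).
  rewrite (_ : o2 + com_size c2 =
    o + (size (compile_expr 0 e) + 1 + com_size c1 + 2 + com_size c2)).
    by apply: reaches_le; lia.
  by rewrite /o2 /o1; lia.
Qed.

Lemma compiles_for P n a c : a < size_name -> com_ok c ->
  compiles P n c -> compiles P n (For a c).
Proof.
move=> lta okc IH o d m s at_o rep nE.
have [at_i at1] := @code_at_cat P o [:: _] _ at_o.
have [at_h at2] := @code_at_cat P _ [:: _; _; _; _] _ at1.
have [at_c at_e] := code_at_cat at2.
rewrite size_compile in at_e.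
have [at_h1 at_h2] := @code_at_cat P _ [:: _] _ at_h.
have [at_hj at_h3] := @code_at_cat P _ [:: _] _ at_h2.
have [at_e1 at_g] := @code_at_cat P _ [:: _; _] _ at_e.
rewrite /= in at_i at_h1 at_hj at_h3 at_c at_e1 at_g.
have e2 : o + 1 + 1 = o + 2 by rewrite -addnA.
have e3 : o + 1 + 1 + 1 = o + 3 by rewrite -!addnA.
have e5 : o + 1 + 4 = o + 5 by rewrite -!addnA.
rewrite e2 in at_hj; rewrite e3 in at_h3; rewrite e5 in at_c at_e1 at_g.
have cd j d' a' : a' < 30 -> (reg ctr d' == reg a' j) = false.
  by move=> lt; rewrite reg_eq //; lia.
have tc j d' : (reg ctr d' == reg tmp j) = false by rewrite reg_eq.
pose k := reg ctr d.
(* The invariant is placed at the loop head, after the counter has been initialized, and carries the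
   time spent so far. *)
pose I (i : nat) (s' : store) := cells s' size_name 0 = n /\
  exists m1, [/\ reaches P (1 + i * (8 + cost c n))
      (Config o m (inp s) (out s)) (Config (o + 1) m1 (inp s') (out s')),
    represents m1 (cells s'), m1 k = i &
    forall d', d' < d -> m1 (reg ctr d') = m (reg ctr d')].
have ctr_neq d' : d' < d -> (reg ctr d' == k) = false.
  by move=> lt; rewrite /k reg_eq // eqxx /=; lia.
have : I n (exec (For a c) s).
  rewrite -[X in I X]nE; apply: for_ind.
    split => //; exists (set_register m k 0); split.
    - rewrite addn1.
      exact: (reaches_straight (s := Config o m (inp s) (out s)) at_i).
    - exact: represents_ctr.
    - by rewrite /set_register eqxx.
    - by move=> d' ltd; rewrite /set_register ctr_neq.
  move=> i s'; rewrite nE => lt_in [nE' [m1 [r1 rep1 k1 g1]]].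
  set s1 := set_mem s' a 0 i.
  have nE1 : cells s1 size_name 0 = n.
    by rewrite /= /upd (_ : (_ == a) = false) //; lia.
  split; first by rewrite exec_frame // size_not_written.
  have m1n : m1 (reg size_name 0) = n by rewrite rep1.
  pose m2 := set_register m1 (reg tmp 0) (n - i).
  have r2 : reaches P 2 (Config (o + 1) m1 (inp s') (out s'))
                        (Config (o + 3) m2 (inp s') (out s')).
    apply: (@reaches_trans P 1 1 _ (Config (o + 2) m2 (inp s') (out s'))).
      rewrite -e2 [X in Config X m2]addn1 /m2 -{1}m1n -{1}k1.
      exact: (reaches_straight (s := Config (o + 1) m1 (inp s') (out s')) at_h1).
    have := reaches_jump m2 (inp s') (out s') at_hj.
    rewrite /m2 set_register_same.
    rewrite (_ : (n - i == 0) = false); last by lia.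
    by rewrite -addnS; apply.
  pose m3 := set_register (set_register m2 (reg tmp 0) 0) (reg a 0) i.
  have r3 : reaches P 2 (Config (o + 3) m2 (inp s') (out s'))
                        (Config (o + 5) m3 (inp s1) (out s1)).
    have := reaches_straight (s := Config (o + 3) m2 (inp s') (out s')) at_h3 isT.
    have -> : m3 = set_register (set_register m2 (reg tmp 0) 0) (reg a 0)
        (set_register m2 (reg tmp 0) 0 k + set_register m2 (reg tmp 0) 0 (reg tmp 0)).
      by rewrite set_register_same addn0 {2}/set_register /m2 /set_register !tc k1.
    by rewrite /= -!addnS; apply.
  have rep3 : represents m3 (cells s1).
    apply: represents_upd; first by lia.
    by do 2! apply: (agree_represents (agree_set _ _ (leqnn 0))).
  have [m4 r4 [rep4 g4]] := IH _ _ m3 s1 at_c rep3 nE1.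
  have k4 : m4 k = i.
    rewrite g4 // /m3 /m2 /set_register !tc cd; last by lia.
    by rewrite k1.
  pose m5 := set_register (set_register m4 (reg tmp 0) 1) k i.+1.
  pose m6 := set_register m5 (reg tmp 0) 0.
  have r5 : reaches P 2
      (Config (o + 5 + com_size c) m4 (inp (exec c s1)) (out (exec c s1)))
      (Config (o + 5 + com_size c + 2) m5 (inp (exec c s1)) (out (exec c s1))).
    have := reaches_straight (s := Config (o + 5 + com_size c) m4
      (inp (exec c s1)) (out (exec c s1))) at_e1 isT.
    have -> : m5 = set_register (set_register m4 (reg tmp 0) 1) k
        (set_register m4 (reg tmp 0) 1 k + set_register m4 (reg tmp 0) 1 (reg tmp 0)).
      by rewrite set_register_same addn1 {3}/set_register tc k4.
    by rewrite /= addn2; apply.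
  have r6 := reaches_goto m5 (inp (exec c s1)) (out (exec c s1)) at_g.
  exists m6; split.
  - have := reaches_trans r1 (reaches_trans r2 (reaches_trans r3
              (reaches_trans r4 (reaches_trans r5 r6)))).
    by apply: reaches_le; lia.
  - apply: (agree_represents (agree_set _ _ (leqnn 0))).
    apply: represents_ctr.
    exact: (agree_represents (agree_set _ _ (leqnn 0))).
  - by rewrite /m6 /m5 /set_register tc eqxx.
  - move=> d' ltd; rewrite /m6 /m5 {1 2 3}/set_register !tc ctr_neq //.
    rewrite g4; last by lia.
    rewrite /m3 /m2 /set_register !tc cd ?g1 //; lia.
move=> [_ [m1 [r1 rep1 k1 g1]]].
set s' := exec _ s in r1 rep1 *.
exists (set_register m1 (reg tmp 0) 0); last first.
  split; first exact: (agree_represents (agree_set _ _ (leqnn 0))).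
  by move=> d' ltd; rewrite /set_register tc g1.
have m1n : m1 (reg size_name 0) = n.
  by rewrite rep1 // exec_frame ?nE // size_not_written //= lta.
pose m2 := set_register m1 (reg tmp 0) 0.
have r2 : reaches P 2 (Config (o + 1) m1 (inp s') (out s'))
                      (Config (o + com_size (For a c)) m2 (inp s') (out s')).
  apply: (@reaches_trans P 1 1 _ (Config (o + 2) m2 (inp s') (out s'))).
    rewrite -e2 [X in Config X m2]addn1 /m2 -[X in set_register _ _ X](subnn n).
    rewrite -{1}m1n -{1}k1.
    exact: (reaches_straight (s := Config (o + 1) m1 (inp s') (out s')) at_h1).
  have := reaches_jump m2 (inp s') (out s') at_hj.
  by rewrite /m2 set_register_same; apply.
by have := reaches_trans r1 r2; apply: reaches_le => /=; lia.
Qed.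

Lemma compile_correct P n c : com_ok c -> compiles P n c.
Proof.
elim: c => [|c1 IH1 c2 IH2|a e1 e2|e c1 IH1 c2 IH2|a c IH|a|e] /=.
- by move=> _ o d m s _ rep _; exists m => //; rewrite addn0; apply: reaches0.
- move=> /andP[ok1 ok2] o d m s at_o rep nE.
  have [at1 at2] := code_at_cat at_o; rewrite size_compile in at2.
  have [m1 r1 [rep1 g1]] := IH1 ok1 _ _ _ _ at1 rep nE.
  have nE1 : cells (exec c1 s) size_name 0 = n.
    by rewrite exec_frame // size_not_written.
  have [m2 r2 [rep2 g2]] := IH2 ok2 _ _ _ _ at2 rep1 nE1.
  exists m2; first by rewrite addnA; apply: reaches_trans r1 r2.
  by split => // d' ltd; rewrite g2 // g1.
- by move=> /and3P[]; apply: compiles_store.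
- by move=> /and3P[ok /IH1 h1 /IH2 h2]; apply: compiles_if.
- by move=> /andP[lta okc]; apply: compiles_for => //; apply: IH.
- move=> lta o d m s at_o rep _.
  exists (set_register m (reg a 0) (head 0 (inp s))).
    rewrite addn1.
    exact: (reaches_straight (s := Config o m (inp s) (out s)) at_o).
  split; first by apply: represents_upd => //; lia.
  move=> d' _; rewrite /set_register reg_eq //; last by lia.
  by rewrite (_ : (ctr == a) = false) //; lia.
- move=> ok o d m s at_o rep _; have [at1 at2] := code_at_cat at_o.
  have [m1 [r1 v1 g1]] := reaches_expr (inp s) (out s) at1 rep ok.
  exists m1; last first.
    split; first exact: agree_represents g1 rep.
    by move=> d' _; rewrite (agree_reg _ g1).
  rewrite /= -v1 [X in Config X m1]addnA [X in Config X m1]addn1.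
  apply: reaches_trans r1 _.
  exact: (reaches_straight (s := Config _ m1 (inp s) (out s)) at2).
Qed.

(** ** Polynomial running time *)

Fixpoint cost_poly (c : com) : {poly nat} :=
  match c with
  | Seq c1 c2 => cost_poly c1 + cost_poly c2
  | If e c1 c2 => (size (compile_expr 0 e) + 3)%N%:P + cost_poly c1 + cost_poly c2
  | For a c => 3%N%:P + 'X * (8%N%:P + cost_poly c)
  | _ => (com_size c)%:P
  end%R.

Lemma cost_polyE c n : ((cost_poly c).[n])%R = cost c n.
Proof.
elim: c => [|c1 IH1 c2 IH2|a e1 e2|e c1 IH1 c2 IH2|a c IH|a|e];
  rewrite /= ?(hornerD, hornerM, hornerX, hornerC) ?IH1 ?IH2 ?IH //.
- by rewrite /GRing.add /=; lia.
- by rewrite /GRing.add /GRing.mul /=; lia.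
Qed.

(** Natural coefficients make the polynomial monotone, so a bound in n passes to one in the bit
    size. *)
Lemma horner_nat_le (p : {poly nat}) m n : m <= n -> p.[m]%R <= p.[n]%R.
Proof.
move=> le_mn; elim/poly_ind: p => [|p c IH]; first by rewrite !horner0.
by rewrite !hornerMXaddC leq_add2r leq_mul.
Qed.

(** The first input number goes directly to [size_name], which commands accepted by [com_ok] cannot
    write. *)
Definition machine_code (c : com) : program :=
  IRead (reg size_name 0) :: compile c 1 0.

Definition initial_store (n : nat) (xs : seq nat) : store :=
  St (upd (fun _ _ => 0) size_name 0 n) xs [::].

Lemma machine_code_correct c n xs : com_ok c ->
  exists2 t, t <= (1%:P + cost_poly c)%R.[n]%R &
    computes_within (machine_code c) t (n :: xs) (out (exec c (initial_store n xs))).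
Proof.
move=> okc; set P := machine_code c.
have at0 : code_at P 0 [:: IRead (reg size_name 0)] by exists [::], (compile c 1 0).
have at1 : code_at P 1 (compile c 1 0).
  by exists [:: IRead (reg size_name 0)], [::]; rewrite cats0.
pose m0 := set_register (fun=> 0) (reg size_name 0) n.
have rep : represents m0 (cells (initial_store n xs)) by apply: represents_upd.
have nE : cells (initial_store n xs) size_name 0 = n by [].
have [m1 r1 _] := compile_correct okc at1 rep nE.
have r0 := reaches_straight (s := ram_init (n :: xs)) at0 isT.
have [t le_t tE] := reaches_trans r0 r1.
exists t; first by rewrite hornerD hornerC cost_polyE.
by rewrite /computes_within tE /= size_compile.
Qed.

(** * Matchings as involutions *)


(** The hypothesis that a step either does nothing or raises [m] passes from a step to a whole
    sweep, so that sweeps can be iterated under the same rule. *)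
Lemma foldl_stable (S X : Type) (f : S -> X -> S) (m : S -> nat) (l : seq X) s :
    (forall s x, f s x = s \/ m s < m (f s x)) ->
  foldl f s l = s \/ m s < m (foldl f s l).
Proof.
move=> step; elim: l s => [|x l IH] s /=; first by left.
case: (step s x) => [->|lt1]; first exact: IH.
by right; case: (IH (f s x)) => [->|lt2] //; apply: ltn_trans lt2.
Qed.

(** Once some step raises [m], no later one can bring the state back; so a sweep with no net effect
    consists of steps without effect. *)
Lemma foldl_fixed (S : Type) (X : eqType) (f : S -> X -> S) (m : S -> nat)
    (l : seq X) s :
    (forall s x, f s x = s \/ m s < m (f s x)) ->
  foldl f s l = s -> forall x, x \in l -> f s x = s.
Proof.
move=> step; elim: l => //= y l IH; case: (step s y) => [yE|lt1].
  by rewrite yE => /IH lE x; rewrite inE => /predU1P[->|/lE].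
move=> lE; have := foldl_stable l (f s y) step; rewrite lE.
by case=> [e|]; [move: lt1; rewrite -e ltnn | move/(ltn_trans lt1); rewrite ltnn].
Qed.

(** With [m] bounded and k large enough, only the first alternative is left: a fixed number of
    rounds replaces a loop that runs until nothing changes. *)
Lemma iter_stable (S : Type) (f : S -> S) (m : S -> nat) k s :
    (forall s, f s = s \/ m s < m (f s)) ->
  f (iter k f s) = iter k f s \/ m s + k <= m (iter k f s).
Proof.
move=> step; elim: k => [|k IH]; first by right; rewrite addn0.
rewrite iterS; case: IH => [e|IH]; first by left; rewrite !e.
by case: (step (iter k f s)) => [e|lt]; [left; rewrite !e | right; lia].
Qed.

Section Involutions.
Variable V : finType.

Lemma involution_even (f : V -> V) (A : {set V}) :
    (forall z, z \in A -> [/\ f z \in A, f (f z) = z & f z != z]) ->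
  ~~ odd #|A|.
Proof.
have [k] := ubnP #|A|; elim: k A => // k IH A ltA fA.
case: (set_0Vmem A) => [->|[a aA]]; first by rewrite cards0.
have [faA ffa fa] := fA a aA.
have e1 : #|A| = #|A :\ a :\ f a|.+2.
  by rewrite (cardsD1 a A) aA (cardsD1 (f a) (A :\ a)) !inE fa faA.
rewrite e1 /= negbK; apply: IH; first by lia.
move=> z; rewrite !inE => /and3P[z1 z2 zA]; have [h1 h2 h3] := fA z zA.
split=> //; rewrite h1 andbT; apply/andP; split.
  by apply: contra z2 => /eqP e; rewrite -h2 e ffa.
by apply: contra z1 => /eqP e; rewrite -h2 e.
Qed.

Variable G : sgraph V.

(** The fixed points are the exposed vertices. In this form a matching is an array, and an exchange
    along an edge changes a few of its cells. *)
Definition involutive_matching (T : V -> V) : Prop :=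
  (forall z, T (T z) = z) /\ (forall z, T z != z -> adj G z (T z)).

(* Trades the edge {w, T w} for {e, w}: if [e] is exposed in [T], then [T w]
   is exposed in the result, and [w] being exposed too makes it an augmentation. *)
Definition switch (T : V -> V) (e w z : V) : V :=
  if z == w then e else if z == e then w else if z == T w then z else T z.

Lemma adj_neq u v : adj G u v -> (u == v) = false.
Proof. by move=> uv; apply/eqP => e; rewrite e adj_irr in uv. Qed.

Lemma switch_matching T e w : involutive_matching T -> T e = e -> adj G e w ->
  involutive_matching (switch T e w).
Proof.
move=> [invT adjT] Te ew; have new := adj_neq ew.
have injT : injective T := can_inj invT.
split=> z; rewrite /switch.
- have [->|zw] := eqVneq z w; first by rewrite new eqxx.
  have [->|ze] := eqVneq z e; first by rewrite eqxx.
  have [e1|zu] := eqVneq z (T w).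
    by rewrite -e1 (negbTE zw) (negbTE ze) eqxx.
  case: eqVneq => [e1|_]; first by rewrite -e1 invT eqxx in zu.
  case: eqVneq => [e1|_].
    by case/negP: ze; rewrite -{1}(invT z) e1 Te.
  case: eqVneq => [/injT e1|_]; first by rewrite e1 eqxx in zw.
  exact: invT.
- have [->|zw] := eqVneq z w; first by rewrite adj_sym.
  have [->|ze] := eqVneq z e; first by [].
  by case: (z =P T w) => [_|_]; [rewrite eqxx | apply: adjT].
Qed.

Lemma switch_fix T e w z : involutive_matching T -> T e = e -> adj G e w ->
  (switch T e w z == z) = [&& z != e, z != w & (T z == z) || (z == T w)].
Proof.
move=> [invT _] Te ew; have new := adj_neq ew.
rewrite /switch; have [->|zw] := eqVneq z w; first by rewrite new /= andbF.
have [->|ze] := eqVneq z e; first by rewrite eq_sym new.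
by case: (z =P T w) => [->|_] /=; rewrite ?eqxx ?orbT ?orbF.
Qed.

End Involutions.

(** * Growing the set of exposable vertices *)

Section Search.
Variables (V : finType) (G : sgraph V).

(* [even] collects vertices u for which a matching [tab u] of the same size as
   the current one, exposing u in place of the root, has been found. *)
Record search := Search { even : {set V}; tab : V -> V -> V }.

(** The first matching found for a vertex is kept for good, so the entries that a walk reads do not
    change while it adds others. *)
Definition add_even (s : search) (u : V) (T : V -> V) : search :=
  if u \in even s then s
  else Search (u |: even s) (fun x => if x == u then T else tab s x).

Record walk := Walk {
  walk_search : search;
  walk_matching : V -> V;
  walk_end : V;
  walk_next : V
}.

(** Moves the exposed vertex two edges along the path: {e, c} enters the matching and {c, T c}
    leaves it. The walk stops where [tab s v'] fixes the end, or when it is led back to v. *)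
Definition walk_step (v v' : V) (p : walk) : walk :=
  let: Walk s T e c := p in
  if (c == e) || (c == v) then p
  else let u := T c in
       let T' := switch T e c in
       let s' := add_even s u T' in
       Walk s' T' u (tab s' v' u).

Definition walk_from (v v' c : V) (s : search) : walk :=
  iter #|V| (walk_step v v') (Walk s (tab s v) v c).

(* For adjacent v, v' in [even s], the matchings [tab s v] and [tab s v'] differ
   by an alternating path from v to v', which the edge {v, v'} closes to an odd
   cycle.  The first walk follows the path from v, exposing every other vertex;
   the second one starts with the edge {v, v'} and exposes the others. *)
Definition blossom (v v' : V) (s : search) : search :=
  let s' := walk_search (walk_from v v' (tab s v' v) s) in
  walk_search (walk_from v v' v' s').

(** [augmented] freezes the state, since the surrounding loops run to their end in any case. *)
Record phase_state := PhaseState {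
  found : search;
  augmented : bool;
  current : V -> V
}.

Definition scan (st : phase_state) (p : V * V) : phase_state :=
  let: PhaseState s a M := st in
  let: (v, w) := p in
  if a then st
  else if v \in even s then
    if adj G v w then
      if w \in even s then PhaseState (blossom v w s) a M
      else let T := switch (tab s v) v w in
           let u := tab s v w in
           if u == w then PhaseState s true T
           else PhaseState (add_even s u T) a M
    else st
  else st.

Definition all_pairs : seq (V * V) := [seq (v, w) | v <- enum V, w <- enum V].

Definition sweep (st : phase_state) : phase_state := foldl scan st all_pairs.

Definition phase (M : V -> V) (r : V) : phase_state :=
  iter #|V| sweep (PhaseState (Search [set r] (fun=> M)) false M).

Section Invariant.
Variables (M : V -> V) (r : V).

Definition exposed (z : V) : bool := (z != r) && (M z == z).

(* Edmonds' blossoms are the classes of [blk] on [D].  Every stored matching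
   leaves each blossom at most once, and the blossom of its exposed vertex not
   at all; the vertices outside [D] reached by the search are those matched into
   [D], and link two fixed blossoms.  [D] exceeds the set of even vertices only
   while the vertices of a new blossom are being exposed. *)
Record invariant (D : {set V}) (blk : V -> V) (s : search) : Prop := Invariant {
  inv_root : r \in even s;
  inv_tab_root : tab s r =1 M;
  inv_sub : even s \subset D;
  inv_exposed : forall z, z \in D -> ~~ exposed z;
  inv_matching : forall u, u \in even s -> involutive_matching G (tab s u);
  inv_fix : forall u, u \in even s ->
    forall z, (tab s u z == z) = (z == u) || exposed z;
  inv_blk : forall z, z \in D -> blk z \in D;
  inv_leave : forall u z1 z2, u \in even s -> z1 \in D -> z2 \in D ->
    blk z1 = blk z2 -> tab s u z1 \notin D -> tab s u z2 \notin D -> z1 = z2;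
  inv_stay : forall u z, u \in even s -> z \in D -> blk z = blk u ->
    tab s u z \in D;
  inv_same : forall u z, u \in even s -> z \in D -> tab s u z \in D ->
    blk (tab s u z) = blk z;
  inv_out : forall w, w \notin D ->
    (exists p q, [/\ p \in D, q \in D & forall u, u \in even s ->
       tab s u w \in D /\ (blk (tab s u w) = p \/ blk (tab s u w) = q)]) \/
    (forall u, u \in even s -> tab s u w = M w /\ M w \notin D)
}.

Lemma invariant_init : involutive_matching G M -> M r = r ->
  invariant [set r] id (Search [set r] (fun=> M)).
Proof.
move=> matM Mr; split=> //=.
- by rewrite inE.
- by move=> z /set1P ->; rewrite /exposed eqxx.
- move=> u /set1P -> z; rewrite /exposed.
  by have [->|] := eqVneq z r; rewrite ?Mr ?eqxx.
- by move=> u z _ /set1P -> _; rewrite Mr inE.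
- by move=> u z _ /set1P -> _.
- move=> w wr; right=> u _; split=> //; apply: contra wr => /set1P e.
  by rewrite -(matM.1 w) e Mr inE.
Qed.

(** The blossoms p and q and the vertex w between them become one blossom. In each stored matching w
    is matched into p or q, and this edge, formerly the only exit of its blossom, is now internal;
    so only the exit of the other blossom can remain. If the exposed vertex lies in p or q, it lies
    in that other blossom, which has no exit either. *)
Lemma invariant_merge D blk s w p q : invariant D blk s -> w \notin D ->
    p \in D -> q \in D ->
    (forall u, u \in even s ->
       tab s u w \in D /\ (blk (tab s u w) = p \/ blk (tab s u w) = q)) ->
  invariant (w |: D) (fun z => if (z == w) || (blk z == q) then p else blk z) s.
Proof.
move=> [i1 i2 i3 i4 i5 i6 i7 i8 i9 i10 i11] wD pD qD wpq.
have neq z : z \in D -> (z == w) = false.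
  by move=> zD; apply/eqP => e; rewrite e (negbTE wD) in zD.
have evD u : u \in even s -> u \in D by apply: (subsetP i3).
have inv u z : u \in even s -> tab s u (tab s u z) = z by move/i5 => [].
split=> //.
- by apply: subset_trans i3 (subsetU1 _ _).
- move=> z /setU1P[->|/i4 //]; apply/negP => ew.
  have [twD _] := wpq r i1; case/negP: wD; rewrite -[w](eqP (_ : tab s r w == w)) //.
  by rewrite i6 // ew orbT.
- move=> z /setU1P[->|zD]; first by rewrite eqxx in_setU1 pD orbT.
  by case: ifP => _; rewrite in_setU1 ?pD ?i7 ?orbT.
- move=> u z1 z2 uE z1D z2D; have [yD ypq] := wpq u uE.
  (* A vertex matched outside the enlarged set is not in the blossom of the partner of w, whose only
     exit led to w. *)
  have cl z : z \in w |: D -> tab s u z \notin w |: D ->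
      [/\ z \in D, tab s u z \notin D & blk z <> blk (tab s u w)].
    move=> /setU1P[->|zD]; first by rewrite in_setU1 yD orbT.
    rewrite in_setU1 => /norP[t1 t2]; split=> // e.
    have := i8 u z _ uE zD yD e t2; rewrite inv // => /(_ wD) ezy.
    by rewrite ezy inv // eqxx in t1.
  move=> e t1 t2; have [{}z1D {}t1 n1] := cl _ z1D t1.
  have [{}z2D {}t2 n2] := cl _ z2D t2; apply: (i8 u) => //.
  move: e; rewrite !neq //=.
  case: (blk z1 =P q); case: (blk z2 =P q);
    by case: ypq => ypq *; congruence.
- move=> u z uE; have [yD ypq] := wpq u uE; have uD := evD u uE.
  move=> /setU1P[->|zD]; first by rewrite in_setU1 yD orbT.
  rewrite !neq //= => e; rewrite in_setU1.
  have nyu : blk (tab s u w) <> blk u.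
    by move=> /(i9 u _ uE yD); rewrite inv // (negbTE wD).
  have [zu|nzu] := eqVneq (blk z) (blk u); first by rewrite (i9 u) ?orbT.
  have zy : blk z = blk (tab s u w).
    move: e; move/eqP: nzu; case: (blk z =P q); case: (blk u =P q);
      by case: ypq => ypq *; congruence.
  case tzD : (tab s u z \in D); first by rewrite orbT.
  have := i8 u z _ uE zD yD zy (negbT tzD); rewrite inv // => /(_ wD) ->.
  by rewrite inv // eqxx.
- have wblk u : u \in even s ->
      (if (tab s u w == w) || (blk (tab s u w) == q) then p else blk (tab s u w)) = p.
    by move=> /wpq[_ ypq]; case: ifP => // /norP[_ /eqP]; case: ypq.
  move=> u z uE; have [yD ypq] := wpq u uE.
  move=> /setU1P[->|zD]; first by move=> _ /=; rewrite wblk // eqxx.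
  move=> /setU1P[tzw|tzD]; last by rewrite !neq //= i10.
  have zE : z = tab s u w by rewrite -tzw inv.
  by rewrite tzw zE /= wblk // eqxx.
- move=> w'; rewrite in_setU1 => /norP[w'w w'D].
  case: (i11 w' w'D) => [[p' [q' [p'D q'D h]]]|h]; last first.
    right=> u uE; have [e m] := h u uE; split=> //.
    rewrite in_setU1 negb_or m andbT; apply/eqP => mw.
    have [] := wpq r i1; rewrite -mw -(h r i1).1 inv // => w'D'.
    by rewrite w'D' in w'D.
  pose ren c := if c == q then p else c.
  have renD c : c \in D -> ren c \in w |: D.
    by rewrite /ren in_setU1 => cD; case: ifP => _; rewrite ?pD ?cD orbT.
  left; exists (ren p'), (ren q'); split; [exact: renD | exact: renD |].
  move=> u uE; have [tD tpq] := h u uE; split; first by rewrite in_setU1 tD orbT.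
  by rewrite neq //=; case: tpq => ->; [left | right].
Qed.

(** Vertices of P are absorbed one at a time. Being matched into D by the root matching excludes the
    second alternative of [inv_out] and provides the two blossoms to be merged. *)
Lemma invariant_merge_set D blk s (P : {set V}) : invariant D blk s ->
    (forall w, w \in P -> w \notin D -> tab s r w \in D) ->
  exists blk', invariant (D :|: P) blk' s.
Proof.
have [k] := ubnP #|P :\: D|; elim: k D blk => // k IH D blk ltk inv PD.
case: (set_0Vmem (P :\: D)) => [/eqP|[w]].
  by rewrite setD_eq0 => /setUidPl ->; exists blk.
rewrite inE => /andP[wD wP].
have [|h] := inv_out inv wD; last first.
  have [e m] := h r (inv_root inv); have := PD w wP wD.
  by rewrite e (negbTE m).
move=> [p [q [pD qD h]]]; have inv' := invariant_merge inv wD pD qD h.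
have -> : D :|: P = (w |: D) :|: P.
  by rewrite -setUA (setUidPr _ : [set w] :|: (D :|: P) = _) // sub1set inE wP orbT.
apply: (IH _ _ _ inv').
- have : #|P :\: D| = #|P :\: (w |: D)|.+1.
    rewrite (cardsD1 w) inE wD wP; congr _.+1; apply: eq_card => z.
    by rewrite !inE negb_or andbA.
  by move: ltk => /[swap] ->.
- by move=> w' w'P; rewrite !in_setU1 negb_or => /andP[_ /(PD _ w'P) ->]; rewrite orbT.
Qed.

Lemma even_add s u T : even (add_even s u T) = u |: even s.
Proof.
rewrite /add_even; case: ifP => //= uE; apply/esym/setUidPr.
by rewrite sub1set.
Qed.

Lemma tab_add s u T v : v \in even s -> tab (add_even s u T) v = tab s v.
Proof.
rewrite /add_even; case: ifP => //= uE vE.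
by case: eqP => // e; rewrite e uE in vE.
Qed.

Lemma tab_new s u T : u \notin even s -> tab (add_even s u T) u = T.
Proof. by rewrite /add_even => /negbTE -> /=; rewrite eqxx. Qed.

(** T differs from [tab s v] only within P, which T preserves and which lies in the blossom of v. So
    T leaves blossoms exactly where [tab s v] does, and inherits all clauses from it. *)
Lemma invariant_expose D blk s v (P : {set V}) u T : invariant D blk s ->
    v \in even s -> P \subset D -> (forall z, z \in P -> blk z = blk v) ->
    u \in P -> involutive_matching G T ->
    (forall z, (T z == z) = (z == u) || exposed z) ->
    (forall z, z \notin P -> T z = tab s v z) ->
    (forall z, z \in P -> T z \in P) ->
  invariant D blk (add_even s u T).
Proof.
move=> inv vE PD Pblk uP matT fixT Tout Tin.
case uE : (u \in even s); first by rewrite /add_even uE.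
have tE x : x \in even s -> tab (add_even s u T) x = tab s x by apply: tab_add.
have tu : tab (add_even s u T) u = T by rewrite tab_new ?uE.
have sub := subsetP (inv_sub inv); have PD' z : z \in P -> z \in D := subsetP PD z.
have out z : T z \notin D -> T z = tab s v z.
  by move=> TzD; apply: Tout; apply: contra TzD => /Tin/PD'.
split.
- by rewrite even_add in_setU1 (inv_root inv) orbT.
- by move=> z; rewrite tE ?(inv_root inv) ?(inv_tab_root inv).
- by rewrite even_add subUset (inv_sub inv) sub1set PD'.
- exact: inv_exposed inv.
- by move=> x; rewrite even_add => /setU1P[->|xE]; rewrite ?tu ?tE //;
    apply: (inv_matching inv).
- by move=> x; rewrite even_add => /setU1P[->|xE]; rewrite ?tu ?tE //;
    apply: (inv_fix inv).
- exact: inv_blk inv.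
- move=> x z1 z2; rewrite even_add => /setU1P[->|xE]; rewrite ?tu ?tE //;
    last exact: (inv_leave inv).
  move=> z1D z2D e t1 t2; apply: (inv_leave inv vE z1D z2D e).
    by rewrite -out.
  by rewrite -out.
- move=> x z; rewrite even_add => /setU1P[->|xE]; rewrite ?tu ?tE //;
    last exact: (inv_stay inv).
  move=> zD e; case zP : (z \in P); first by rewrite PD' ?Tin.
  by rewrite Tout ?zP //; apply: (inv_stay inv vE zD); rewrite e Pblk.
- move=> x z; rewrite even_add => /setU1P[->|xE]; rewrite ?tu ?tE //;
    last exact: (inv_same inv).
  move=> zD; case zP : (z \in P); first by rewrite !Pblk ?Tin.
  by rewrite Tout ?zP //; apply: (inv_same inv).
- move=> w wD; have wP : w \notin P by apply: contra wD => /PD'.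
  case: (inv_out inv wD) => [[p [q [pD qD h]]]|h].
    left; exists p, q; split=> // x; rewrite even_add => /setU1P[->|xE].
      by rewrite tu Tout //; apply: h.
    by rewrite tE //; apply: h.
  right=> x; rewrite even_add => /setU1P[->|xE].
    by rewrite tu Tout //; apply: h.
  by rewrite tE //; apply: h.
Qed.

(** As the partner u of w is not even, [inv_out] says that all stored matchings contain the edge {w,
    u}. The vertex u becomes a blossom by itself, and w links it to the blossom of v: the old
    matchings send w to u, the new one sends it to v. That edge is the only exit of the blossom of v
    in the new matching, since the old one, exposing v, had none. *)
Lemma invariant_grow blk s v w :
    let u := tab s v w in
    invariant (even s) blk s -> v \in even s -> adj G v w ->
    w \notin even s -> u \notin even s -> u != w ->
  invariant (u |: even s) (fun z => if z == u then u else blk z)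
            (add_even s u (switch (tab s v) v w)).
Proof.
move=> u inv vE vw wE uE uw; set T := switch _ _ _.
have [h|h] := inv_out inv wE.
  have [p [q [_ _ h']]] := h; have [] := h' v vE.
  by rewrite -/u (negbTE uE).
have tE x : x \in even s -> tab (add_even s u T) x = tab s x by apply: tab_add.
have tu : tab (add_even s u T) u = T by rewrite tab_new ?uE.
have invo x z : x \in even s -> tab s x (tab s x z) = z.
  by move=> xE; apply: (inv_matching inv xE).1.
have xw x : x \in even s -> tab s x w = u.
  by move=> xE; rewrite /u !(proj1 (h _ _)).
have xu x : x \in even s -> tab s x u = w by move=> xE; rewrite -(xw x xE) invo.
have nu z : z \in even s -> (z == u) = false.
  by move=> zE; apply/eqP => e; rewrite e (negbTE uE) in zE.
have nw z : z \in even s -> (z == w) = false.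
  by move=> zE; apply/eqP => e; rewrite e (negbTE wE) in zE.
have tvv : tab s v v = v by apply/eqP; rewrite (inv_fix inv vE) eqxx.
have nblk z : z \in even s -> (blk z == u) = false.
  by move=> zE; apply: nu; apply: (inv_blk inv).
have Tin z : z \in even s -> z != v -> T z = tab s v z.
  by move=> zE zv; rewrite /T /switch (nw z zE) (negbTE zv) -/u (nu z zE).
have Tv : T v = w by rewrite /T /switch (nw v vE) eqxx.
have Tw : T w = v by rewrite /T /switch eqxx.
have uv : (u == v) = false by rewrite eq_sym nu.
have Tu : T u = u by rewrite /T /switch (negbTE uw) uv -/u eqxx.
have nexp : ~~ exposed u.
  apply/negP => eu; have := inv_fix inv vE u; rewrite eu orbT xu // eq_sym.
  by rewrite (negbTE uw).
split.
- by rewrite even_add in_setU1 (inv_root inv) orbT.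
- by move=> z; rewrite tE ?(inv_root inv) ?(inv_tab_root inv).
- by rewrite even_add.
- by move=> z /setU1P[->//|]; apply: (inv_exposed inv).
- move=> x; rewrite even_add => /setU1P[->|xE]; rewrite ?tu ?tE //;
    last exact: (inv_matching inv).
  by apply: switch_matching => //; apply: (inv_matching inv).
- move=> x; rewrite even_add => /setU1P[->|xE]; rewrite ?tu ?tE //;
    last exact: (inv_fix inv).
  move=> z; rewrite /T (switch_fix (G := G)) //; last exact: (inv_matching inv).
  rewrite (inv_fix inv vE) -/u; have [->|zu] := eqVneq z u.
    by rewrite uv (negbTE uw) orbT.
  rewrite orbF /=; have [->|zv] := eqVneq z v.
    by rewrite (negbTE (inv_exposed inv vE)).
  rewrite /=; have [->|//] := eqVneq z w; apply/esym/negbTE/negP => ew.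
  have := inv_fix inv vE w; rewrite ew orbT -/u => /eqP e.
  by rewrite e eqxx in uw.
- move=> z /setU1P[->|zE]; first by rewrite eqxx setU11.
  by rewrite nu // in_setU1 (inv_blk inv) ?orbT.
- have cl x z : x \in even s -> z \in u |: even s -> z != u -> z \in even s.
    by move=> _; rewrite in_setU1 => /orP[-> //|].
  move=> x z1 z2; rewrite even_add => xE z1E z2E.
  have [->|z1u] := eqVneq z1 u.
    case: ifP => [/eqP //|z2u] e; have := nblk z2.
    by rewrite -e eqxx => h'; move: z2E; rewrite in_setU1 z2u => /h'.
  have [->|z2u] := eqVneq z2 u.
    move=> e; have := nblk z1; rewrite e eqxx => h'.
    by move: z1E; rewrite in_setU1 (negbTE z1u) => /h'.
  have {}z1E : z1 \in even s by move: z1E; rewrite in_setU1 (negbTE z1u).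
  have {}z2E : z2 \in even s by move: z2E; rewrite in_setU1 (negbTE z2u).
  move: xE => /setU1P[->|xE] e; rewrite ?tu ?tE //; last first.
    rewrite !in_setU1 !negb_or => /andP[_ t1] /andP[_ t2].
    exact: (inv_leave inv xE).
  have st z : z \in even s -> blk z = blk v -> z != v -> T z \in even s.
    by move=> zE bz zv; rewrite Tin //; apply: (inv_stay inv vE).
  rewrite !in_setU1 !negb_or => /andP[_ t1] /andP[_ t2].
  have [z1v|z1v] := eqVneq z1 v.
    have [->//|z2v] := eqVneq z2 v.
    by case/negP: t2; apply: st; rewrite // -e z1v.
  have [z2v|z2v] := eqVneq z2 v.
    by case/negP: t1; apply: st; rewrite // e z2v.
  by rewrite !Tin // in t1 t2; apply: (inv_leave inv vE).
- move=> x z; rewrite even_add => xE zE.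
  have [->|zu] := eqVneq z u.
    have [->|xu'] := eqVneq x u; first by rewrite tu Tu setU11.
    move=> e; have := nblk x; rewrite -e eqxx => h'.
    by move: xE; rewrite in_setU1 (negbTE xu') => /h'.
  have {}zE : z \in even s by move: zE; rewrite in_setU1 (negbTE zu).
  have [->|xu'] := eqVneq x u.
    by move=> e; have := nblk z zE; rewrite e eqxx.
  have {}xE : x \in even s by move: xE; rewrite in_setU1 (negbTE xu').
  by rewrite tE // in_setU1 => /(inv_stay inv xE zE) ->; rewrite orbT.
- move=> x z; rewrite even_add => xE zE.
  have [->|zu] := eqVneq z u.
    move: xE => /setU1P[->|xE]; first by rewrite tu Tu eqxx.
    by rewrite tE // xu // in_setU1 eq_sym (negbTE uw) (negbTE wE).
  have {}zE : z \in even s by move: zE; rewrite in_setU1 (negbTE zu).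
  move: xE => /setU1P[->|xE].
    rewrite tu; have [->|zv] := eqVneq z v.
      by rewrite Tv in_setU1 eq_sym (negbTE uw) (negbTE wE).
    rewrite Tin // in_setU1; case: eqVneq => [e|_ /=].
      by have := invo v z vE; rewrite e xu // => e1; rewrite -e1 (negbTE wE) in zE.
    exact: (inv_same inv).
  rewrite tE // in_setU1; case: eqVneq => [e|_ /=]; last exact: (inv_same inv).
  by have := invo x z xE; rewrite e xu // => e1; rewrite -e1 (negbTE wE) in zE.
- move=> z; rewrite in_setU1 negb_or => /andP[zu zE].
  have [->|zw] := eqVneq z w.
    left; exists (blk v), u; split.
    - by rewrite in_setU1 (inv_blk inv) ?orbT.
    - exact: setU11.
    - move=> x; rewrite even_add => /setU1P[->|xE]; rewrite ?tu ?tE //.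
        by rewrite Tw nu // in_setU1 vE orbT; split=> //; left.
      by rewrite xw // eqxx setU11; split=> //; right.
  have zv : z != v by apply: contra zE => /eqP ->.
  have Tz : T z = tab s v z.
    by rewrite /T /switch (negbTE zw) (negbTE zv) -/u (negbTE zu).
  case: (inv_out inv zE) => [[p [q [pE qE h']]]|h'].
    left; exists p, q; split; try by rewrite in_setU1 ?pE ?qE orbT.
    have go x : x \in even s -> tab s x z \in u |: even s /\
       ((if tab s x z == u then u else blk (tab s x z)) = p \/
        (if tab s x z == u then u else blk (tab s x z)) = q).
      by move=> xE; have [t1 t2] := h' x xE; rewrite nu // in_setU1 t1 orbT.
    move=> x; rewrite even_add => /setU1P[->|xE]; rewrite ?tu ?tE ?Tz //.
      exact: go.
    exact: go.
  have go x : x \in even s -> tab s x z = M z /\ M z \notin u |: even s.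
    move=> xE; have [t1 t2] := h' x xE; split=> //.
    rewrite in_setU1 negb_or t2 andbT; apply: contra zw => /eqP e.
    by rewrite -(invo x z xE) t1 e xu.
  right=> x; rewrite even_add => /setU1P[->|xE]; rewrite ?tu ?tE ?Tz //.
    exact: go.
  exact: go.
Qed.

(** * Walks along the alternating path of two stored matchings *)

Definition stopped (v : V) (p : walk) : bool :=
  (walk_next p == walk_end p) || (walk_next p == v).

Lemma walk_step_stopped v v' p : stopped v p -> walk_step v v' p = p.
Proof. by case: p => s T e c; rewrite /stopped /= => ->. Qed.

(** The component of v in the union of two matchings; as a reachability set it needs no numbering of
    the path. *)
Definition path_set (f g : V -> V) (v : V) : {set V} :=
  [set z | connect [rel x y | (y == f x) || (y == g x)] v z].

Lemma path_set_root f g v : v \in path_set f g v.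
Proof. by rewrite inE connect0. Qed.

Lemma path_setl f g v z : z \in path_set f g v -> f z \in path_set f g v.
Proof.
by rewrite !inE => h; apply: connect_trans h (connect1 _); rewrite /= eqxx.
Qed.

Lemma path_setr f g v z : z \in path_set f g v -> g z \in path_set f g v.
Proof.
by rewrite !inE => h; apply: connect_trans h (connect1 _); rewrite /= eqxx orbT.
Qed.

Lemma path_set_min f g v (Q : {pred V}) : v \in Q ->
    (forall z, z \in Q -> f z \in Q) -> (forall z, z \in Q -> g z \in Q) ->
  {subset path_set f g v <= Q}.
Proof.
move=> vQ fQ gQ z; rewrite inE => /connectP[l + ->].
elim: l v vQ => //= y l IH v vQ /andP[yE]; apply: IH.
by case/orP: yE => /eqP ->; [apply: fQ | apply: gQ].
Qed.

Section Walk.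
Variables (D : {set V}) (blk : V -> V) (s0 : search) (v v' : V).
Hypotheses (inv0 : invariant D blk s0) (vE : v \in even s0) (v'E : v' \in even s0).
Hypothesis vv' : adj G v v'.
Let f := tab s0 v.
Let g := tab s0 v'.
Let P := path_set f g v.
Hypotheses (PD : P \subset D) (Pblk : forall z, z \in P -> blk z = blk v).

(* [b] tells the walk along the path from the walk along the edge {v, v'}. *)
Record walk_inv (b : bool) (A W : {set V}) (p : walk) : Prop := WalkInv {
  wi_inv : invariant D blk (walk_search p);
  wi_even : even (walk_search p) = A :|: even s0;
  wi_tab : forall x, x \in even s0 -> tab (walk_search p) x = tab s0 x;
  wi_matching : involutive_matching G (walk_matching p);
  wi_fix : forall z, (walk_matching p z == z) = (z == walk_end p) || exposed z;
  wi_out : forall z, z \notin A :|: W -> walk_matching p z = f z;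
  wi_in : forall z, z \in A :|: W -> walk_matching p z \in A :|: W;
  wi_end : walk_end p \in A;
  wi_start : v \in A;
  wi_disjoint : forall z, z \in A -> z \notin W;
  wi_fA : forall z, z \in A -> z != v -> f z \in W;
  wi_fW : forall z, z \in W -> f z \in A;
  wi_gA : forall z, z \in A -> z != walk_end p -> b || (z != v) -> g z \in W;
  wi_gW : forall z, z \in W -> b || (z != v') ->
    (g z \in A) && (g z != walk_end p);
  wi_next : walk_next p = g (walk_end p) /\ (b \/ walk_end p != v /\ v' \in W) \/
    [/\ ~~ b, walk_end p = v, walk_next p = v', A = [set v] & W = set0];
  wi_path : A :|: W \subset P;
  wi_next_path : walk_next p \in P;
  wi_cross : forall A1 W1 : {set V}, ~~ b -> v' \in A1 ->
    (forall z, z \in A1 -> z != v -> f z \in W1) ->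
    (forall z, z \in W1 -> g z \in A1) ->
    W \subset A1 /\ A \subset v |: W1
}.

Let invf z : f (f z) = z. Proof. exact: (inv_matching inv0 vE).1. Qed.
Let invg z : g (g z) = z. Proof. exact: (inv_matching inv0 v'E).1. Qed.
Let fixf z : (f z == z) = (z == v) || exposed z.
Proof. exact: (inv_fix inv0). Qed.
Let fixg z : (g z == z) = (z == v') || exposed z.
Proof. exact: (inv_fix inv0). Qed.
Let fv : f v = v. Proof. by apply/eqP; rewrite fixf eqxx. Qed.
Let gv' : g v' = v'. Proof. by apply/eqP; rewrite fixg eqxx. Qed.
Let vP : v \in P. Proof. exact: path_set_root. Qed.
Let fP z : z \in P -> f z \in P. Proof. exact: path_setl. Qed.
Let gP z : z \in P -> g z \in P. Proof. exact: path_setr. Qed.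
Let nexp z : z \in P -> ~~ exposed z.
Proof. by move=> /(subsetP PD); apply: (inv_exposed inv0). Qed.

Lemma walk_inv_init (b : bool) : (~~ b -> v' \in P) ->
  walk_inv b [set v] set0 (Walk s0 f v (if b then g v else v')).
Proof.
move=> v'P; split=> //=.
- by apply/esym/setUidPr; rewrite sub1set.
- exact: (inv_matching inv0).
- by move=> z; rewrite setU0 => /set1P ->; rewrite fv inE.
- by rewrite inE.
- by rewrite inE.
- by move=> z _; rewrite in_set0.
- by move=> z /set1P ->; rewrite eqxx.
- by move=> z; rewrite in_set0.
- by move=> z /set1P ->; rewrite eqxx.
- by move=> z; rewrite in_set0.
- by case: b v'P => _; [left; split=> //; left | right].
- by rewrite setU0 sub1set.
- by case: b v'P => [_|]; [apply: gP | apply].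
- by move=> A1 W1 _ _ _ _; rewrite sub0set sub1set setU11.
Qed.

(** A holds the vertices exposed so far and W the vertices passed over between them. The growth of A
    is what bounds the length of the walk. *)
Lemma walk_inv_step b A W p : walk_inv b A W p -> ~~ stopped v p ->
  exists A' W', walk_inv b A' W' (walk_step v v' p) /\ #|A'| = #|A|.+1.
Proof.
case: p => s T e c [/= iI iE iT iM iF iO iN ie iv iD ifA ifW igA igW ic iP icP iX].
rewrite /stopped /= => nst; rewrite (negbTE nst).
move: nst; rewrite negb_or => /andP[ce cv].
have AP z : z \in A -> z \in P by move=> zA; apply: (subsetP iP); rewrite inE zA.
have WP z : z \in W -> z \in P.
  by move=> zW; apply: (subsetP iP); rewrite inE zW orbT.
(* The walk meets only new vertices: [g] would lead from c back to e, but it sends visited vertices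
   of A to W, and those of W to vertices of A other than e. The start along the edge {v, v'} and the
   fixed point v' are treated apart. *)
have cA : c \notin A.
  apply/negP => cA; case: ic => [[cE _]|[_ _ _ A1 _]].
    have := igA c cA ce; rewrite cv orbT cE invg => /(_ isT) eW.
    by have := iD e ie; rewrite eW.
  by move: cA; rewrite A1 inE (negbTE cv).
have cW : c \notin W.
  apply/negP => cW; case: ic => [[cE bE]|[_ _ _ _ W0]].
    have [cv'|cv'] := eqVneq c v'.
      have ev' : e = v' by rewrite -(invg e) -cE cv' gv'.
      by have := iD e ie; rewrite ev' -cv' cW.
    by have := igW c cW; rewrite cv' orbT cE invg eqxx andbF => /(_ isT).
  by move: cW; rewrite W0 inE.
set u := T c.
(* The current matching still equals [f] off A and W, so the walk follows the two original matchings
   although it reads a modified one. *)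
have uE : u = f c by rewrite /u iO // inE negb_or cA cW.
have uA : u \notin A.
  apply/negP => uA; case/negP: cW; rewrite -(invf c) -uE; apply: ifA => //.
  by apply/negP => /eqP e1; move: cv; rewrite -(invf c) -uE e1 fv eqxx.
have uW : u \notin W.
  by apply/negP => uW; case/negP: cA; rewrite -(invf c) -uE; apply: ifW.
have uc : u != c by rewrite uE fixf negb_or cv nexp.
have uP : u \in P by rewrite uE fP.
have Te : T e = e by apply/eqP; rewrite iF eqxx.
have ec : adj G e c.
  case: ic => [[cE _]|[_ -> -> _ _]] //; rewrite cE.
  by apply: (inv_matching inv0 v'E).2; rewrite -/g -cE.
have ue : u != e by apply: contra uA => /eqP ->.
have uv : u != v by apply: contra uA => /eqP ->.
set T' := switch T e c.
have matT' : involutive_matching G T' by apply: switch_matching.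
have Tc : T' c = e by rewrite /T' /switch eqxx.
have Te' : T' e = c by rewrite /T' /switch eqxx eq_sym (negbTE ce).
have Tu : T' u = u.
  by rewrite /T' /switch (negbTE uc) (negbTE ue) eqxx.
have Tz z : z != c -> z != e -> z != u -> T' z = T z.
  by move=> /negbTE h1 /negbTE h2 /negbTE h3; rewrite /T' /switch h1 h2 -/u h3.
have fixT' z : (T' z == z) = (z == u) || exposed z.
  have [->|zu] := eqVneq z u; first by rewrite Tu eqxx.
  rewrite /T' (switch_fix (G := G)) // -/u (negbTE zu) orbF iF /=.
  have [->|ze] := eqVneq z e; first by rewrite (negbTE (nexp (AP e ie))).
  by have [->|//] := eqVneq z c; rewrite (negbTE (nexp icP)).
pose s' := add_even s u T'.
pose A' := u |: A; pose W' := c |: W.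
have v's : v' \in even s by rewrite iE inE v'E orbT.
have vs : v \in even s by rewrite iE inE vE orbT.
have tE : tab s' v' = g by rewrite /s' tab_add // iT.
have AW z : z \in A :|: W -> z \in A' :|: W'.
  by rewrite !inE => /orP[] ->; rewrite ?orbT.
have AW' z : z \notin A' :|: W' -> [/\ z != u, z != c & z \notin A :|: W].
  by rewrite !inE !negb_or => /andP[/andP[-> ->] /andP[-> ->]].
have nAu z : z \in A -> (z == u) = false.
  by move=> zA; apply/eqP => e1; rewrite -e1 zA in uA.
have nAc z : z \in A -> (z == c) = false.
  by move=> zA; apply/eqP => e1; rewrite -e1 zA in cA.
have nWu z : z \in W -> (z == u) = false.
  by move=> zA; apply/eqP => e1; rewrite -e1 zA in uW.
have nWc z : z \in W -> (z == c) = false.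
  by move=> zA; apply/eqP => e1; rewrite -e1 zA in cW.
exists A', W'; split; last by rewrite cardsU1 uA.
rewrite -/u -/T' -/s' tE; split=> //=.
- apply: (invariant_expose iI vs PD) => //.
  + move=> z zP; rewrite Tz; [rewrite iT // iO // | | |].
    * by apply: contra zP => /(subsetP iP).
    * by apply: contra zP => /eqP ->.
    * by apply: contra zP => /eqP ->; apply: AP.
    * by apply: contra zP => /eqP ->.
  + move=> z zP; have [->|zc] := eqVneq z c; first by rewrite Tc AP.
    have [->|ze] := eqVneq z e; first by rewrite Te'.
    have [->|zu] := eqVneq z u; first by rewrite Tu.
    rewrite Tz //; case zV : (z \in A :|: W); first exact: (subsetP iP _ (iN z zV)).
    by rewrite iO ?zV // fP.
- by rewrite even_add iE setUA.
- by move=> x xE; rewrite tab_add ?iT // iE inE xE orbT.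
- move=> z /AW'[zu zc zAW]; rewrite Tz ?iO //.
  by apply: contra zAW => /eqP ->; rewrite inE ie.
- move=> z; have [-> _|zc] := eqVneq z c; first by rewrite Tc AW // inE ie.
  have [-> _|ze] := eqVneq z e; first by rewrite Te' !inE eqxx !orbT.
  have [-> _|zu] := eqVneq z u; first by rewrite Tu !inE eqxx.
  rewrite Tz // => zA'; apply: AW; apply: iN.
  by move: zA'; rewrite !inE (negbTE zc) (negbTE zu).
- exact: setU11.
- by rewrite inE iv orbT.
- move=> z /setU1P[->|zA]; first by rewrite inE negb_or uW inE uc.
  by rewrite !inE negb_or iD // nAc.
- move=> z /setU1P[->|zA]; first by rewrite uE invf setU11.
  by move=> zv; rewrite in_setU1 ifA ?orbT.
- move=> z /setU1P[->|zW]; first by rewrite -uE setU11.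
  by rewrite in_setU1 ifW ?orbT.
- move=> z /setU1P[->|zA]; first by rewrite eqxx.
  move=> _ bz; have [ze|ze] := eqVneq z e; last by rewrite in_setU1 igA ?orbT.
  rewrite ze; case: ic => [[<- _]|[nb ev _ _ _]]; first exact: setU11.
  by move: bz; rewrite ze ev eqxx (negbTE nb).
- move=> z /setU1P[->|zW] bz.
    case: ic => [[cE _]|[nb _ cE _ _]].
      by rewrite cE invg in_setU1 ie orbT eq_sym ue.
    by move: bz; rewrite cE eqxx (negbTE nb).
  have /andP[gA _] := igW z zW bz.
  by rewrite in_setU1 gA orbT /= nAu.
- left; split=> //; case: ic => [[_ [|[_ h]]]|[_ _ cE _ _]]; [by left | |].
    by right; rewrite uv in_setU1 h orbT.
  by right; rewrite uv -cE setU11.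
- apply/subsetP => z; rewrite in_setU !in_setU1 => /orP[]/orP[].
  + by move=> /eqP ->.
  + exact: AP.
  + by move=> /eqP ->.
  + exact: WP.
- exact: gP.
- move=> A1 W1 nb v'A hf hg; have [hW hA] := iX A1 W1 nb v'A hf hg.
  have cA1 : c \in A1.
    case: ic => [[-> [|[ev _]]]|[_ _ -> _ _]] //; first by rewrite (negbTE nb).
    by apply: hg; have := subsetP hA e ie; rewrite in_setU1 (negbTE ev).
  split; apply/subsetP => z /setU1P[->//|].
  + exact: (subsetP hW).
  + by rewrite uE in_setU1 hf ?orbT.
  + exact: (subsetP hA).
Qed.

(** A starts with one vertex and gains one in every active step, so |V| steps without a stop would
    make it larger than V. *)
Lemma walk_inv_end b : (~~ b -> v' \in P) ->
  exists A W, let p := walk_from v v' (if b then g v else v') s0 in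
    walk_inv b A W p /\ stopped v p.
Proof.
move=> v'P; rewrite /walk_from; set p0 := Walk _ _ _ _.
suff [A [W [iAW [st|lt]]]] : exists A W,
    walk_inv b A W (iter #|V| (walk_step v v') p0) /\
    (stopped v (iter #|V| (walk_step v v') p0) \/ #|V| < #|A|).
- by exists A, W.
- by have := leq_trans lt (max_card (mem A)); rewrite ltnn.
elim: #|V| => [|k [A [W [iAW h]]]].
  exists [set v], set0; split; first exact: walk_inv_init.
  by right; rewrite cards1.
case st : (stopped v (iter k (walk_step v v') p0)).
  by exists A, W; rewrite iterS walk_step_stopped //; split=> //; left.
case: h => [|lt]; first by rewrite st.
have [A' [W' [iA' cA']]] := walk_inv_step iAW (negbT st).
by exists A', W'; split=> //; right; rewrite cA'.
Qed.

(** The path leads from v to v' with [g] and [f] in turn, and the walk exposes every second vertex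
    of it. The clauses on A and W are the form in which the second walk can use this. *)
Lemma walk_along_path :
  let s := walk_search (walk_from v v' (g v) s0) in
  exists A W : {set V},
    [/\ invariant D blk s, even s = A :|: even s0,
        forall x, x \in even s0 -> tab s x = tab s0 x,
        P = A :|: W & [/\ v' \in A, v \in A,
        forall z, z \in A -> z != v -> f z \in W &
        forall z, z \in W -> g z \in A]].
Proof.
move=> s; have [//|A [W [/= iAW st]]] := walk_inv_end (b := true).
rewrite -/s in iAW st; exists A, W.
set p := walk_from _ _ _ _ in iAW st s *.
have nvv' : v != v' by rewrite (adj_neq vv').
have [cE|[]//] : walk_next p = g (walk_end p) \/ false.
  by case: (wi_next iAW) => [[]|[]] //; left.
have eP : walk_end p \in P.
  by apply: (subsetP (wi_path iAW)); rewrite inE (wi_end iAW).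
(* A return to v would make the end equal to [g v], which the walk has passed over. *)
have ev' : walk_end p = v'.
  move: st; rewrite /stopped cE => /orP[|/eqP gE].
    by rewrite fixg (negbTE (nexp eP)) orbF => /eqP.
  have eE : walk_end p = g v by rewrite -gE invg.
  have [ev|ev] := eqVneq v (walk_end p).
    have : g v == v by rewrite -eE -ev.
    by rewrite fixg (negbTE (nexp vP)) orbF -ev => /eqP.
  have := wi_gA iAW (wi_start iAW) ev isT; rewrite -eE => eW.
  by have := wi_disjoint iAW (wi_end iAW); rewrite eW.
have gA z : z \in A :|: W -> g z \in A :|: W.
  rewrite !inE => /orP[zA|zW].
    have [->|ze] := eqVneq z (walk_end p); last by rewrite (wi_gA iAW) ?orbT.
    by rewrite ev' gv' -ev' (wi_end iAW).
  by have /andP[-> _] := wi_gW iAW zW isT.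
split; [exact: wi_inv iAW | exact: wi_even iAW | exact: wi_tab iAW | |].
  apply/eqP; rewrite eqEsubset (wi_path iAW) andbT; apply/subsetP.
  apply: path_set_min => //; first by rewrite inE (wi_start iAW).
  move=> z; rewrite !inE => /orP[zA|zW]; last by rewrite (wi_fW iAW).
  have [->|zv] := eqVneq z v; first by rewrite fv (wi_start iAW).
  by rewrite (wi_fA iAW) ?orbT.
split; [by rewrite -ev' (wi_end iAW) | exact: wi_start iAW | exact: wi_fA iAW |].
by move=> z zW; have /andP[] := wi_gW iAW zW isT.
Qed.

(** This walk traverses the path from v' back to v, with the other parity: what it passes over is
    exposed by the first walk. The last clause says so for any A1 and W1 closed like the sets of the
    first walk, and is proved along with the walk as [wi_cross]. *)
Lemma walk_along_edge : v' \in P ->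
  let s := walk_search (walk_from v v' v' s0) in
  exists A W : {set V},
    [/\ invariant D blk s, even s = A :|: even s0,
        forall x, x \in even s0 -> tab s x = tab s0 x,
        P = A :|: W & forall A1 W1 : {set V}, v' \in A1 ->
          (forall z, z \in A1 -> z != v -> f z \in W1) ->
          (forall z, z \in W1 -> g z \in A1) -> W \subset A1].
Proof.
move=> v'P s; have [//|A [W [/= iAW st]]] := walk_inv_end (b := false).
rewrite -/s in iAW st; exists A, W.
set p := walk_from _ _ _ _ in iAW st s *.
have nvv' : v != v' by rewrite (adj_neq vv').
have eP : walk_end p \in P.
  by apply: (subsetP (wi_path iAW)); rewrite inE (wi_end iAW).
have [cE ev v'W] : [/\ walk_next p = g (walk_end p), walk_end p != v & v' \in W].
  case: (wi_next iAW) => [[cE []//[h1 h2]]|[_ eE cE _ _]] //.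
  by move: st; rewrite /stopped cE eE orbb eq_sym (negbTE nvv').
(* The walk cannot end at the fixed point v' of [g], which it passed over at once; so it closes the
   cycle at v. *)
have ge : g (walk_end p) = v.
  move: st; rewrite /stopped cE => /orP[|/eqP //].
  rewrite fixg (negbTE (nexp eP)) orbF => /eqP eE.
  by have := wi_disjoint iAW (wi_end iAW); rewrite eE v'W.
have gA z : z \in A :|: W -> g z \in A :|: W.
  rewrite !inE => /orP[zA|zW].
    have [->|ze] := eqVneq z (walk_end p); first by rewrite ge (wi_start iAW).
    have [->|zv] := eqVneq z v; first by rewrite -ge invg (wi_end iAW).
    by rewrite (wi_gA iAW) ?orbT.
  have [->|zv'] := eqVneq z v'; first by rewrite gv' v'W orbT.
  by have /andP[-> _] := wi_gW iAW zW zv'.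
split; [exact: wi_inv iAW | exact: wi_even iAW | exact: wi_tab iAW | |].
  apply/eqP; rewrite eqEsubset (wi_path iAW) andbT; apply/subsetP.
  apply: path_set_min => //; first by rewrite inE (wi_start iAW).
  move=> z; rewrite !inE => /orP[zA|zW]; last by rewrite (wi_fW iAW).
  have [->|zv] := eqVneq z v; first by rewrite fv (wi_start iAW).
  by rewrite (wi_fA iAW) ?orbT.
by move=> A1 W1 h1 h2 h3; have [] := wi_cross iAW isT h1 h2 h3.
Qed.

End Walk.

(** All of the path is first merged into one blossom, which makes D larger than the set of even
    vertices; the two walks then expose the new vertices. The second claim is what an idle blossom
    step contributes to [certificate]. *)
Lemma blossom_invariant blk s v v' : invariant (even s) blk s ->
    v \in even s -> v' \in even s -> adj G v v' ->
  exists blk', invariant (even (blossom v v' s)) blk' (blossom v v' s) /\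
    (even (blossom v v' s) = even s -> blk v = blk v').
Proof.
move=> inv vE v'E vv'; set P := path_set (tab s v) (tab s v') v.
have rE := inv_root inv.
(* The even vertices and those matched into them by the root matching form a set closed under all
   stored matchings, so it contains the path. *)
pose Q := [pred z | (z \in even s) || (tab s r z \in even s)].
have QP u z : u \in even s -> z \in Q -> tab s u z \in Q.
  move=> uE; rewrite !inE; have [zE _|zE /= h] := boolP (z \in even s); last first.
    case: (inv_out inv zE) => [[p [q [_ _ /(_ u uE)[-> _]]]]|h'] //.
    by move: h; rewrite (h' r rE).1 (negbTE (h' r rE).2).
  case tE : (tab s u z \in even s) => //=.
  case: (inv_out inv (negbT tE)) => [[p [q [_ _ /(_ r rE)[]]]]|h'] //.
  have [e1 e2] := h' u uE; move: e2; rewrite -e1.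
  by rewrite (inv_matching inv uE).1 zE.
have PQ z : z \in P -> z \in Q.
  apply: path_set_min; [by rewrite !inE vE | by move=> y; apply: QP |].
  by move=> y; apply: QP.
have [blk' inv'] : exists blk', invariant (even s :|: P) blk' s.
  by apply: invariant_merge_set inv _ => w /PQ; rewrite inE => /orP[->|].
have PD : P \subset even s :|: P by apply: subsetUr.
have Pblk z : z \in P -> blk' z = blk' v.
  pose B := [pred y | (y \in P) && (blk' y == blk' v)].
  suff PB : {subset P <= B} by move=> /PB /andP[_ /eqP].
  apply: path_set_min; first by rewrite !inE connect0 eqxx.
    move=> y /andP[yP /eqP yb]; have tP := path_setl yP.
    by rewrite inE [_ \in P]tP /= (inv_same inv') ?yb ?(subsetP PD) ?eqxx.
  move=> y /andP[yP /eqP yb]; have tP := path_setr yP.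
  by rewrite inE [_ \in P]tP /= (inv_same inv') ?yb ?(subsetP PD) ?eqxx.
have [A1 [W1 [inv1 E1 T1 P1 [v'A1 vA1 fA1 gW1]]]] :=
  walk_along_path inv' vE v'E vv' PD Pblk.
rewrite -/P in P1; rewrite /blossom; set s1 := walk_search _ in inv1 E1 T1 *.
have vE1 : v \in even s1 by rewrite E1 inE vE orbT.
have v'E1 : v' \in even s1 by rewrite E1 inE v'E orbT.
have PE : path_set (tab s1 v) (tab s1 v') v = P by rewrite !T1.
have v'P : v' \in path_set (tab s1 v) (tab s1 v') v by rewrite PE P1 inE v'A1.
have := walk_along_edge inv1 vE1 v'E1 vv'; rewrite PE.
move=> /(_ PD Pblk) []; first by rewrite -PE.
move=> A2 [W2 [inv2 E2 T2 P2 X2]]; set s2 := walk_search _ in inv2 E2 T2 *.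
have W2A1 : W2 \subset A1 by apply: (X2 _ W1) => //; rewrite !T1.
(* Every vertex of the path is exposed by one of the two walks, so D is again the set of even
   vertices. *)
have ED : even s :|: P = even s2.
  rewrite E2 E1; apply/setP => z; rewrite !in_setU; apply/idP/idP.
    case/orP => [->|]; first by rewrite !orbT.
    rewrite P2 inE => /orP[->//|/(subsetP W2A1) ->]; by rewrite orbT.
  case/orP => [zA|/orP[zA|-> //]].
    by rewrite P2 in_setU zA orbT.
  by rewrite P1 in_setU zA orbT.
exists blk'; split; first by rewrite -ED.
(* With nothing new exposed, the path already lay among the even vertices, where matched pairs share
   their blossom; so the old [blk] is constant from v to v'. *)
move=> E; have {}ED : P \subset even s by rewrite -E -ED.
have v'P' : v' \in P by rewrite -PE.
pose B := [pred y | (y \in P) && (blk y == blk v)].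
suff PB : {subset P <= B} by have /andP[_ /eqP ->] := PB _ v'P'.
apply: path_set_min; first by rewrite !inE connect0 eqxx.
  move=> y /andP[yP /eqP yb]; have tP := path_setl yP.
  have tE := subsetP ED _ tP; have yE := subsetP ED _ yP.
  by rewrite inE [_ \in P]tP /= (inv_same inv vE yE tE) yb eqxx.
move=> y /andP[yP /eqP yb]; have tP := path_setr yP.
have tE := subsetP ED _ tP; have yE := subsetP ED _ yP.
by rewrite inE [_ \in P]tP /= (inv_same inv v'E yE tE) yb eqxx.
Qed.

(** The count of the Tutte-Berge formula, with O as barrier. If z is not even, q exposes no even
    vertex and must leave every blossom, as these are odd; by closure under edges it arrives in O,
    at distinct vertices. So there are at most |O| blossoms, while the matching M shows that there
    are more. *)
Lemma certificate blk s (z : V) (q : V -> V) :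
    invariant (even s) blk s ->
    (forall v w, v \in even s -> adj G v w ->
       if w \in even s then blk v = blk w else tab s v w \in even s) ->
    involutive_matching G q -> (forall y, (q y == y) = (y == z)) ->
  z \in even s.
Proof.
move=> inv closed matq fixq; apply/negPn/negP => zE.
set E := even s in inv closed zE *; have rE := inv_root inv.
have tr := inv_tab_root inv.
have invM w : M (M w) = w by rewrite -!tr (inv_matching inv rE).1.
pose O := [set w | (w \notin E) && (M w \in E)]; pose B := blk @: E.
(* M sends distinct vertices of O into distinct blossoms, and none into that of the root. *)
have BO : #|O| < #|B|.
  rewrite (cardsD1 (blk r) B) imset_f // ltnS -(card_in_imset (f := blk \o M) (D := mem O)).
    apply/subset_leq_card/subsetP => _ /imsetP[w + ->].
    rewrite inE => /andP[wE MwE]; rewrite !inE /= imset_f // andbT.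
    apply/eqP => e; case/negP: wE; rewrite -(invM w) -tr.
    exact: (inv_stay inv).
  move=> w1 w2; rewrite !inE => /andP[w1E m1] /andP[w2E m2] /= e.
  rewrite -(invM w1) -(invM w2); congr M.
  by apply: (inv_leave inv rE m1 m2 e); rewrite tr invM.
suff OB : #|B| <= #|O| by have := leq_trans BO OB; rewrite ltnn.
(* The matching stored for u pairs up the other vertices of its blossom, which is therefore odd and
   cannot be paired up within itself by q. *)
have exit b : b \in B -> exists y, [&& y \in E, blk y == b & q y \notin E].
  case/imsetP => u uE ->; case: (pickP [pred y | [&& y \in E, blk y == blk u &
    q y \notin E]]) => [y yP|nq]; first by exists y.
  pose C := [set y in E | blk y == blk u].
  have qC y : y \in C -> [/\ q y \in C, q (q y) = y & q y != y].
    rewrite inE => /andP[yE by_].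
    have qyE : q y \in E by have := nq y; rewrite /= yE by_ /= => /negbFE.
    have qy : q y != y by rewrite fixq; apply: contra zE => /eqP <-.
    split=> //; last exact: matq.1.
    rewrite inE qyE /= -(eqP by_) eq_sym; apply/eqP.
    by have := closed y (q y) yE (matq.2 y qy); rewrite qyE.
  have tC y : y \in C :\ u ->
      [/\ tab s u y \in C :\ u, tab s u (tab s u y) = y & tab s u y != y].
    rewrite !inE => /and3P[yu yE /eqP yb].
    have tyE : tab s u y \in E by apply: (inv_stay inv).
    have invo := (inv_matching inv uE).1.
    split=> //; last by rewrite (inv_fix inv uE) negb_or yu (inv_exposed inv).
    rewrite tyE (inv_same inv) // yb eqxx !andbT.
    apply: contra yu => /eqP e; rewrite -(invo y) e.
    by rewrite (inv_fix inv uE) eqxx.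
  have := involution_even qC; rewrite (cardsD1 u) !inE uE eqxx /=.
  by rewrite (negbTE (involution_even tC)).
pose out b := odflt z [pick y | [&& y \in E, blk y == b & q y \notin E]].
have outP b : b \in B -> [/\ out b \in E, blk (out b) = b & q (out b) \notin E].
  move=> /exit[y yP]; rewrite /out; case: pickP => [x /= /and3P[? /eqP ? ?] //|].
  by move/(_ y); rewrite yP.
rewrite -(card_in_imset (f := q \o out) (D := mem B)).
  apply/subset_leq_card/subsetP => _ /imsetP[b bB ->] /=.
  have [oE _ qoE] := outP b bB; rewrite inE qoE /=.
  have qo : q (out b) != out b by apply: contra qoE => /eqP ->.
  have := closed _ _ oE (matq.2 _ qo); rewrite (negbTE qoE) => tE.
  case: (inv_out inv qoE) => [[p [p' [_ _ /(_ r rE)[]]]]|/(_ _ oE)[e]].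
    by rewrite tr.
  by rewrite -e -/E tE.
move=> b1 b2 b1B b2B /= /(congr1 q); rewrite !matq.1 => e.
by have [_ <- _] := outP b1 b1B; have [_ <- _] := outP b2 b2B; rewrite e.
Qed.

(** * Termination and correctness of the phases *)

Definition grows (s s' : search) : Prop := s' = s \/ #|even s| < #|even s'|.

Lemma grows_trans s1 s2 s3 : grows s1 s2 -> grows s2 s3 -> grows s1 s3.
Proof.
move=> [-> //|lt1] [->|lt2]; first by right.
by right; apply: ltn_trans lt2.
Qed.

Lemma grows_add s u T : grows s (add_even s u T).
Proof.
rewrite /grows /add_even; case: ifP => uE; first by left.
by right; rewrite /= cardsU1 uE.
Qed.

Lemma grows_walk v v' c s : grows s (walk_search (walk_from v v' c s)).
Proof.
rewrite /walk_from; elim: #|V| => [|k IH]; first by left.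
rewrite iterS; apply: grows_trans IH _; case: (iter _ _ _) => s' T e c' /=.
by case: ifP => _ /=; [left | apply: grows_add].
Qed.

Definition progress (st : phase_state) : nat := #|even (found st)| + augmented st.

Lemma scan_progress st p :
  scan st p = st \/ progress st < progress (scan st p).
Proof.
case: st p => s [] N [v w] /=; first by left.
case: ifP => _; last by left.
case: ifP => _; last by left.
case: ifP => _.
  have g := grows_walk v w (tab s w v) s.
  have := grows_trans g (grows_walk v w w _); rewrite -/(blossom v w s).
  by case=> [->|lt]; [left | right; rewrite /progress /= !addn0].
case: ifP => _; first by right; rewrite /progress /= addn0 addn1.
have [->|lt] := grows_add s (tab s v w) (switch (tab s v) v w); first by left.
by right; rewrite /progress /= !addn0.
Qed.

(** An augmentation covers one vertex w and the root; the latter is already left out by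
    [exposed]. *)
Definition phase_inv (st : phase_state) : Prop :=
  if augmented st then
    involutive_matching G (current st) /\
    exists2 w, exposed w & forall z, (current st z == z) = exposed z && (z != w)
  else current st = M /\ exists blk, invariant (even (found st)) blk (found st).

Lemma scan_inv st p : phase_inv st -> phase_inv (scan st p).
Proof.
case: st p => s [] N [v w]; rewrite //= {1}/phase_inv /= => -[-> [blk inv]].
case: ifP => vE; last by split=> //; exists blk.
case: ifP => vw; last by split=> //; exists blk.
case: ifP => wE /=.
  by split=> //; have [blk' []] := blossom_invariant inv vE wE vw; exists blk'.
have tvv : tab s v v = v by apply/eqP; rewrite (inv_fix inv vE) eqxx.
have mat := inv_matching inv vE.
case: ifP => [/eqP tw|/negbT tw]; rewrite /phase_inv /=.
  split; first exact: switch_matching.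
  exists w.
    have := inv_fix inv vE w; rewrite tw eqxx eq_sym (adj_neq vw) /=.
    by move=> <-.
  move=> z; rewrite (switch_fix (G := G)) // tw (inv_fix inv vE).
  have [->|zw] := eqVneq z w; first by rewrite andbF andbF.
  have [->|zv] := eqVneq z v; first by rewrite (negbTE (inv_exposed inv vE)).
  by rewrite orbF andbT.
split=> //; case tE : (tab s v w \in even s).
  by rewrite /add_even tE; exists blk.
rewrite even_add; eexists; apply: invariant_grow inv vE vw _ _ tw.
  by rewrite wE.
by rewrite tE.
Qed.

(** The root is even from the start, so |V| sweeps that all change something would push [progress]
    beyond |V|. *)
Lemma phase_inv_phase : involutive_matching G M -> M r = r ->
  phase_inv (phase M r) /\
  (~~ augmented (phase M r) -> forall p, scan (phase M r) p = phase M r).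
Proof.
move=> matM Mr; rewrite /phase; set st0 := PhaseState _ _ _.
have I0 : phase_inv st0 by split=> //; exists id; apply: invariant_init.
have It k : phase_inv (iter k sweep st0).
  elim: k => // k; rewrite iterS /sweep; move: (iter _ _ _) => st.
  by elim: all_pairs st => //= p l IH st Ist; apply: IH; apply: scan_inv.
split=> // na.
have [st|] := iter_stable #|V| st0 (fun s => foldl_stable all_pairs s scan_progress).
  move=> [v w]; apply: (foldl_fixed scan_progress st).
  by apply/allpairsP; exists (v, w); rewrite !mem_enum.
rewrite /progress (negbTE na) addn0 /= cards1 addn0 add1n => lt.
by rewrite ltnNge max_card in lt.
Qed.

Hypothesis G_critical :
  forall z, exists2 q, involutive_matching G q & forall y, (q y == y) = (y == z).

(** Without an augmentation the search is closed, so [certificate], applied to every z, makes all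
    vertices even. Even vertices are not [exposed], hence M misses the root only, and the table
    holds a near-perfect matching for every vertex. *)
Lemma phase_correct : involutive_matching G M -> M r = r ->
  let st := phase M r in
  if augmented st then
    involutive_matching G (current st) /\
    #|[set z | M z == z]| = #|[set z | current st z == z]|.+2
  else [/\ current st = M, #|[set z | M z == z]| = 1, even (found st) = setT,
    forall u, involutive_matching G (tab (found st) u) &
    forall u z, (tab (found st) u z == z) = (z == u)].
Proof.
move=> matM Mr; have [] := phase_inv_phase matM Mr; rewrite /phase_inv.
case: (phase M r) => s [] N /=.
  move=> [matN [w ew fixN]] _; split=> //.
  have rw : r != w by apply: contraTneq ew => <-; rewrite /exposed eqxx.
  rewrite (cardsD1 r) inE Mr eqxx (cardsD1 w) !inE eq_sym rw.
  have -> : M w == w by case/andP: ew.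
  congr _.+2; apply: eq_card => z; rewrite !inE fixN /exposed.
  by case: (z == r); case: (z == w); rewrite ?andbF ?andbT.
move=> [-> [blk inv]] /(_ isT) fixed.
have E : even s = setT.
  apply/setP => z; rewrite inE; have [q matq fixq] := G_critical z.
  apply: (certificate inv _ matq fixq) => v w vE vw.
  (* An unchanged state means that the blossom step found nothing new, or that the partner of w was
     already even. *)
  have := fixed (v, w); rewrite /= vE vw.
  case: ifP => wE [e].
    have [blk' [_]] := blossom_invariant inv vE wE vw; by rewrite e => /(_ erefl).
  move: e; case: ifP => // _ [e]; apply/negPn/negP => tE.
  have := even_add s (tab s v w) (switch (tab s v) v w); rewrite e => e'.
  by case/negP: tE; rewrite e' setU11.
have nexp z : exposed z = false.
  by apply/negbTE/(inv_exposed inv); rewrite E.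
split=> //.
- rewrite -(cards1 r); apply: eq_card => z; rewrite !inE -(inv_tab_root inv).
  by rewrite (inv_fix inv) ?nexp ?orbF ?E.
- by move=> u; apply: (inv_matching inv); rewrite E.
- by move=> u z; rewrite (inv_fix inv) ?nexp ?orbF ?E.
Qed.

End Invariant.

Definition exposed_vertex (r0 : V) (M : V -> V) : V :=
  foldl (fun r z => if M z == z then z else r) r0 (enum V).

Lemma exposed_vertexP r0 M : [set z | M z == z] != set0 ->
  M (exposed_vertex r0 M) = exposed_vertex r0 M.
Proof.
case/set0Pn => z; rewrite inE => zP; rewrite /exposed_vertex.
have : z \in enum V by rewrite mem_enum.
have fixl l r : M r = r ->
    let r' := foldl (fun r z => if M z == z then z else r) r l in M r' = r'.
  elim: l r => //= y l IH r Mr; apply: IH.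
  by case: eqP.
elim: (enum V) r0 => //= y l IH r0; rewrite inE => /predU1P[<-|]; last exact: IH.
by rewrite zP; apply: fixl; apply/eqP.
Qed.

Definition augment (r0 : V) (M : V -> V) : V -> V :=
  current (phase M (exposed_vertex r0 M)).

Definition all_near_perfect (r0 : V) : phase_state :=
  let M := iter #|V| (augment r0) id in phase M (exposed_vertex r0 M).

(** The order is odd, so each phase has an exposed root. An augmentation removes two exposed
    vertices, which cannot happen |V| times; and a phase without augmentation returns its matching,
    so the remaining rounds change nothing. *)
Lemma all_near_perfect_correct r0 :
    (forall z, exists2 q, involutive_matching G q & forall y, (q y == y) = (y == z)) ->
  even (found (all_near_perfect r0)) = setT /\
  forall u, involutive_matching G (tab (found (all_near_perfect r0)) u) /\
    forall z, (tab (found (all_near_perfect r0)) u z == z) = (z == u).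
Proof.
move=> crit; pose nf (M : V -> V) := #|[set z | M z == z]|.
have nfE M : involutive_matching G M -> odd (nf M) = odd #|V|.
  move=> [invM _]; rewrite -(cardsC [set z | M z == z]) oddD.
  rewrite -[LHS]addbF; congr (_ (+) _); apply/esym/negbTE.
  apply: (@involution_even _ M) => z; rewrite !inE => Mz.
  by split=> //; rewrite invM eq_sym.
have oddV : odd #|V|.
  have [q matq fixq] := crit r0; rewrite -(nfE q matq) /nf.
  by rewrite (_ : [set z | _] = [set r0]) ?cards1 //; apply/setP => z; rewrite !inE fixq.
have root M : involutive_matching G M ->
    M (exposed_vertex r0 M) = exposed_vertex r0 M.
  move=> matM; apply: exposed_vertexP; rewrite -card_gt0 -/(nf M).
  by move: (nfE M matM); rewrite oddV; case: (nf M).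
pose final M := ~~ augmented (phase M (exposed_vertex r0 M)).
have H k : involutive_matching G (iter k (augment r0) id) /\
    (final (iter k (augment r0) id) \/ nf (iter k (augment r0) id) + k.*2 <= #|V|).
  elim: k => [|k [matM IH]].
    split; first by split=> // z; rewrite eqxx.
    by right; rewrite addn0 max_card.
  rewrite iterS; set M := iter k _ _ in matM IH *.
  have := phase_correct crit matM (root M matM).
  rewrite /augment /final; case: IH => [nM|le].
    rewrite (negbTE nM) => -[-> _ _ _ _]; by split=> //; left.
  case: ifP => [_ [mat' cE]|/negbT na [-> _ _ _ _]]; last by split=> //; left.
  split=> //; right; move: le; rewrite /nf cE doubleS; lia.
have [matM hM] := H #|V|.
have := phase_correct crit matM (root _ matM); rewrite /all_near_perfect.
case: ifP => [aug [_ cE]|_ [_ _ evE h1 h2]]; last by split.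
case: hM => [|]; first by rewrite /final aug.
by rewrite /nf cE; lia.
Qed.

End Search.

(** * From factor-critical graphs to involutions *)

Lemma edgesP (V : finType) (G : sgraph V) e :
  reflect (exists u v, adj G u v /\ e = [set u; v]) (e \in edges G).
Proof.
rewrite inE; apply: (iffP existsP) => [[u /existsP[v /andP[uv /eqP ->]]]|].
  by exists u, v.
by move=> [u [v [uv ->]]]; exists u; apply/existsP; exists v; rewrite uv eqxx.
Qed.

Lemma perfect_matching_involution (V : finType) (G : sgraph V) M :
    perfect_matching G M ->
  exists q : V -> V, (forall u, q (q u) = u) /\ forall u, adj G u (q u).
Proof.
move=> /andP[/andP[/subsetP subM trivM] /eqP covM].
have partner u : exists v, adj G u v && ([set u; v] \in M).
  have : u \in cover M by rewrite covM.
  case/bigcupP => e eM; have /edgesP[a [b [ab eE]]] := subM e eM.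
  rewrite eE => /set2P[->|->]; first by exists b; rewrite ab -eE.
  by exists a; rewrite adj_sym ab setUC -eE.
pose q u := odflt u [pick v | adj G u v && ([set u; v] \in M)].
have qP u : adj G u (q u) /\ [set u; q u] \in M.
  rewrite /q; case: pickP => [v /andP[] //|nv].
  by have [v] := partner u; rewrite nv.
exists q; split=> u; last by have [] := qP u.
have [uq e1] := qP u; have [qq e2] := qP (q u).
have e12 : [set u; q u] = [set q u; q (q u)].
  apply/eqP; apply: contraT => ne.
  have /disjoint_setI0 := trivIsetP trivM _ _ e1 e2 ne.
  by move/setP/(_ (q u)); rewrite !inE !eqxx orbT.
have : q (q u) \in [set u; q u] by rewrite e12 !inE eqxx orbT.
by case/set2P => // e; move: (adj_neq qq); rewrite e eqxx.
Qed.

Lemma factor_critical_involution (V : finType) (G : sgraph V) z :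
    factor_critical G ->
  exists2 q, involutive_matching G q & forall y, (q y == y) = (y == z).
Proof.
move=> /(_ z)[M /perfect_matching_involution[q [invq adjq]]].
(* The default extends the matching of G - z by the fixed point z. *)
pose q' y := if insub y is Some y' then val (q y') else y.
have q'z : q' z = z by rewrite /q' insubF ?eqxx.
have q'E (y : {y | y != z}) : q' (val y) = val (q y) by rewrite /q' valK.
have q'P y : y != z -> [/\ q' (q' y) = y & adj G y (q' y)].
  move=> yz; rewrite -[y]/(val (Sub y yz : {y | y != z})) !q'E invq; split=> //.
  exact: adjq.
exists q'; last first.
  move=> y; have [->|yz] := eqVneq y z; first by rewrite q'z eqxx.
  by have [_ yq] := q'P y yz; rewrite eq_sym (adj_neq yq).
split=> y; first by have [->|/q'P[]//] := eqVneq y z; rewrite !q'z.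
by have [->|/q'P[]//] := eqVneq y z; rewrite q'z eqxx.
Qed.

(** * Fractional covers vanishing at a vertex *)


Section Cover.
Variables (V : finType) (G : sgraph V) (x : V).

(** A cover vanishing at x is at least 1 on the neighbours of x, and the value 1 there settles every
    edge at a neighbour. Only edges among these vertices are left to cover. *)
Definition nonneighbours : {set V} := [set u | (u != x) && ~~ adj G x u].

(* A matching of the bipartite double cover without the neighbours of [x] and
   the left copy of [x]: [T w] is the left partner of the right copy of [w],
   which is unmatched if [T w = w]. *)
Definition half_matching (T : V -> V) : Prop :=
  (forall w, T w != w -> [/\ adj G w (T w), ~~ adj G x w & T w \in nonneighbours]) /\
  (forall w w', T w != w -> T w' != w' -> T w = T w' -> w = w').

Definition matched (T : V -> V) : {set V} := [set w | T w != w].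

(** [T u = u] means that the right copy of u is unmatched, not that u is its own partner; hence the
    exemption of w = u. *)
Definition free_left (T : V -> V) : {set V} :=
  [set u in nonneighbours | [forall w, (T w == u) ==> (w == u)]].

(** A bipartite alternating search from all free left vertices at once. [tab s v] is a matching as
    large as the current one in which the left copy of v is free; an edge {v, w} then augments it,
    or frees the former partner of w. *)
Definition half_scan (st : phase_state V) (p : V * V) : phase_state V :=
  let: PhaseState s a M := st in
  let: (v, w) := p in
  if a then st
  else if v \in even s then
    if adj G v w then
      if adj G x w then st
      else let T := fun z => if z == w then v else tab s v z in
           let u := tab s v w in
           if u == w then PhaseState s true T
           else PhaseState (add_even s u T) a M
    else st
  else st.

Definition half_sweep (st : phase_state V) : phase_state V :=
  foldl half_scan st (all_pairs V).

Definition half_phase (M : V -> V) : phase_state V :=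
  iter #|V| half_sweep (PhaseState (Search (free_left M) (fun=> M)) false M).

Definition half_augment (M : V -> V) : V -> V := current (half_phase M).

Definition half_search : phase_state V :=
  half_phase (iter #|V| half_augment id).

Lemma half_scan_progress st p :
  half_scan st p = st \/ progress st < progress (half_scan st p).
Proof.
case: st p => s [] N [v w] /=; first by left.
case: ifP => _; last by left.
case: ifP => _; last by left.
case: ifP => _; first by left.
case: ifP => _; first by right; rewrite /progress /= addn0 addn1.
set T := (T in add_even _ _ T); have [->|lt] := grows_add s (tab s v w) T.
  by left.
by right; rewrite /progress /= !addn0.
Qed.

Section HalfInvariant.
Variable M : V -> V.
Hypothesis matM : half_matching M.

(** [hi_change] confines the changes to reached left vertices. It turns the final closure under the
    stored matchings into closure under M itself. *)
Record half_inv (s : search V) : Prop := HalfInv {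
  hi_free : free_left M \subset even s;
  hi_left : even s \subset nonneighbours;
  hi_matching : forall u, u \in even s -> half_matching (tab s u);
  hi_unmatched : forall u w, u \in even s -> tab s u w = u -> w = u;
  hi_matched : forall u w, u \in even s -> (tab s u w == w) = (M w == w);
  hi_change : forall u w, u \in even s ->
    tab s u w = M w \/ (M w \in even s /\ tab s u w \in even s)
}.

Definition half_phase_inv (st : phase_state V) : Prop :=
  if augmented st then
    half_matching (current st) /\ #|matched (current st)| = #|matched M|.+1
  else current st = M /\ half_inv (found st).

Lemma half_update s v w : half_inv s -> v \in even s -> adj G v w ->
    ~~ adj G x w -> half_matching (fun z => if z == w then v else tab s v z).
Proof.
move=> inv vE vw xw; have [h1 h2] := hi_matching inv vE.
have un z : tab s v z = v -> z = v by apply: hi_unmatched.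
split=> [z|z z'].
  case: (z =P w) => [-> _|_]; last exact: h1.
  by rewrite adj_sym; split=> //; apply: (subsetP (hi_left inv)).
case: (z =P w) => [->|zw]; case: (z' =P w) => [->|z'w] //.
- by move=> _ z'z' h; have e := un _ (esym h); rewrite -h e eqxx in z'z'.
- by move=> zz _ h; have e := un _ h; rewrite h e eqxx in zz.
- exact: h2.
Qed.

Lemma half_scan_inv st p : half_phase_inv st -> half_phase_inv (half_scan st p).
Proof.
case: st p => s [] N [v w]; rewrite //= {1}/half_phase_inv /= => -[-> inv].
case: ifP => vE //; case: ifP => vw //; case: ifP => // /negbT xw.
have mat := half_update inv vE vw xw.
set T := (fun z : V => _) in mat *.
case: ifP => [/eqP tw|/negbT tw]; rewrite /half_phase_inv /=.
  split=> //; have -> : matched T = w |: matched M.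
    apply/setP => z; rewrite !inE /T; case: (z =P w) => [->|_]; first by rewrite (adj_neq vw).
    by rewrite (hi_matched inv _ vE).
  by rewrite cardsU1 inE -(hi_matched inv _ vE) tw eqxx.
split=> //; case uE : (tab s v w \in even s); first by rewrite /add_even uE.
set u := tab s v w in uE tw *.
have Mw : M w = u.
  by case: (hi_change inv w vE) => [//|[]]; rewrite -/u uE.
have tE y : y \in even s -> tab (add_even s u T) y = tab s y by apply: tab_add.
have tu : tab (add_even s u T) u = T by rewrite tab_new ?uE.
have [h1 h2] := hi_matching inv vE.
split.
- by rewrite even_add (subset_trans (hi_free inv)) ?subsetU1.
- rewrite even_add subUset (hi_left inv) sub1set andbT.
  by have [] := h1 w tw.
- by move=> y; rewrite even_add => /setU1P[->|yE]; rewrite ?tu ?tE //;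
    apply: (hi_matching inv).
- move=> y z; rewrite even_add => /setU1P[->|yE]; rewrite ?tu ?tE //; last first.
    exact: (hi_unmatched inv).
  rewrite /T; case: (z =P w) => [_ vu|zw tzu]; first by rewrite -vu vE in uE.
  apply/eqP/negPn/negP => zu; case: zw; apply: h2 => //.
  by rewrite tzu eq_sym.
- move=> y z; rewrite even_add => /setU1P[->|yE]; rewrite ?tu ?tE //; last first.
    exact: (hi_matched inv).
  rewrite /T; case: (z =P w) => [->|_]; last exact: (hi_matched inv).
  by rewrite (adj_neq vw) Mw (negbTE tw).
- move=> y z; rewrite even_add => /setU1P[->|yE]; rewrite ?tu ?tE //; last first.
    case: (hi_change inv z yE) => [|[m1 m2]]; first by left.
    by right; rewrite !in_setU1 m1 m2 !orbT.
  rewrite /T; case: (z =P w) => [->|_].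
    by right; rewrite Mw setU11 in_setU1 vE orbT.
  case: (hi_change inv z vE) => [|[m1 m2]]; first by left.
  by right; rewrite !in_setU1 m1 m2 !orbT.
Qed.

(** The closure reached at the end is that of König's argument: right neighbours of reached left
    vertices are matched, and to reached ones. *)
Lemma half_phase_correct : let st := half_phase M in
  if augmented st then
    half_matching (current st) /\ #|matched (current st)| = #|matched M|.+1
  else let E := even (found st) in
    [/\ current st = M, free_left M \subset E, E \subset nonneighbours &
      forall v w, v \in E -> adj G v w -> ~~ adj G x w ->
        (M w != w) && (M w \in E)].
Proof.
rewrite /half_phase; set st0 := PhaseState _ _ _.
have I0 : half_phase_inv st0.
  split=> //; split=> //=; first by apply/subsetP => u; rewrite inE => /andP[].
    by move=> u w; rewrite inE => /andP[_ /forallP/(_ w)/implyP h] /eqP/h/eqP.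
  by move=> u w _; left.
have It k : half_phase_inv (iter k half_sweep st0).
  elim: k => // k; rewrite iterS /half_sweep; move: (iter _ _ _) => st.
  elim: (all_pairs V) st => //= p l IH st Ist; apply: IH; exact: half_scan_inv.
have := It #|V|; rewrite /half_phase_inv; case: ifP => // /negbT na [-> inv].
split; [by [] | exact: hi_free | exact: hi_left |] => v w vE vw xw.
have [st|] := iter_stable #|V| st0
  (fun s => foldl_stable (all_pairs V) s half_scan_progress).
  have pw : (v, w) \in all_pairs V by apply/allpairsP; exists (v, w); rewrite !mem_enum.
  have := foldl_fixed half_scan_progress st pw.
  have -> : iter #|V| ((foldl half_scan)^~ (all_pairs V)) st0 =
    iter #|V| half_sweep st0 by [].
  move: na inv vE; case: (iter _ _ _) => s [] //= N _ inv vE.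
  rewrite vE vw (negbTE xw); case: ifP => // /negbT tw [e].
  have eE := even_add s (tab s v w) (fun z => if z == w then v else tab s v z).
  rewrite e in eE; have tE : tab s v w \in even s by rewrite eE setU11.
  rewrite -(hi_matched inv w vE) tw /=.
  by case: (hi_change inv w vE) => [<-|[]].
(* Here the initial set may be empty, but x never enters it, so again it cannot reach |V|
   elements. *)
rewrite /progress (negbTE na) addn0 => /(leq_trans (leq_addl _ _)) lt.
have xE : x \notin even (found (iter #|V| half_sweep st0)).
  by apply/negP => /(subsetP (hi_left inv)); rewrite inE eqxx.
have := max_card (mem (x |: even (found (iter #|V| half_sweep st0)))).
by rewrite cardsU1 xE; move: lt; set k := #|_| => lt; lia.
Qed.

End HalfInvariant.
Lemma half_search_correct : let M := current half_search in
  let E := even (found half_search) in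
  [/\ half_matching M, free_left M \subset E, E \subset nonneighbours &
    forall v w, v \in E -> adj G v w -> ~~ adj G x w ->
      (M w != w) && (M w \in E)].
Proof.
pose final M := ~~ augmented (half_phase M).
have H k : half_matching (iter k half_augment id) /\
    (final (iter k half_augment id) \/ k <= #|matched (iter k half_augment id)|).
  elim: k => [|k [matM IH]].
    by split; [split=> [w|w w']; rewrite eqxx | right].
  rewrite iterS; set M := iter k _ _ in matM IH *.
  have := half_phase_correct matM; rewrite /half_augment /final.
  case: IH => [nM|le].
    by rewrite (negbTE nM) => -[-> _ _ _]; split=> //; left.
  case: ifP => [_ [mat' cE]|/negbT na [-> _ _ _]]; last by split=> //; left.
  by split=> //; right; rewrite cE ltnS.
have [matM hM] := H #|V|.
have := half_phase_correct matM; rewrite -/half_search /=.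
case: ifP => [aug [mat' cE]|_ [-> h1 h2 h3]]; last by split.
case: hM => [|le]; first by rewrite /final -/half_search aug.
by have := max_card (mem (matched (current half_search))); rewrite cE ltnNge le.
Qed.

Definition cover_set : {set V} := x |: even (found half_search).

(** König's cover of the bipartite double cover: left copies outside the reached set, and right
    copies adjacent to it. Adding the two copies gives twice a half-integral cover of G. Putting x
    into the set makes its own left value 0 and charges both copies of its neighbours. *)
Definition double_cover (v : V) : nat :=
  1 - (v \in cover_set) + [exists u, (u \in cover_set) && adj G u v].

Definition degree : nat := #|[set v | adj G x v]|.

Definition cover_value : nat := degree.*2 + #|matched (current half_search)|.

Lemma cover_set_nadj u : u \in cover_set -> adj G u x = false.
Proof.
have [_ _ sub _] := half_search_correct; case/setU1P => [->|/(subsetP sub)].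
  exact: adj_irr.
by rewrite inE adj_sym => /andP[_ /negbTE].
Qed.

Lemma double_cover_root : double_cover x = 0.
Proof.
rewrite /double_cover setU11; apply/eqP; rewrite eqb0; apply/existsP => -[u].
by case/andP => /cover_set_nadj ->.
Qed.

Lemma double_cover_edge u v : adj G u v -> 2 <= double_cover u + double_cover v.
Proof.
move=> uv; rewrite /double_cover.
have h a b : adj G a b -> a \in cover_set -> [exists c, (c \in cover_set) && adj G c b].
  by move=> ab aS; apply/existsP; exists a; rewrite aS.
have vu : adj G v u by rewrite adj_sym.
have h1 := h u v uv; have h2 := h v u vu.
case: (u \in cover_set) h1 => [/(_ isT) ->|_];
  case: (v \in cover_set) h2 => [/(_ isT) ->|_] //; by case: [exists _, _].
Qed.

(** On the left, the cover consists of the neighbours A of x and the unreached nonneighbours F; on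
    the right, of A and the vertices N2 matched to reached ones. All of F is matched, so M is a
    bijection from N3 to F, and N2 and N3 together are the matched vertices. *)
Lemma sum_double_cover : \sum_v double_cover v = cover_value.
Proof.
have [matM freeE subE closed] := half_search_correct.
rewrite /cover_value; set M := current _ in matM freeE closed *.
set E := even _ in freeE subE closed; set S := cover_set.
pose N := [set v | [exists u, (u \in S) && adj G u v]].
pose A := [set v | adj G x v]; pose F := nonneighbours :\: E.
pose N2 := [set w | (M w != w) && (M w \in E)].
pose N3 := [set w | (M w != w) && (M w \notin E)].
have card_sum (B : {pred V}) : \sum_v (v \in B : nat) = #|B|.
  by rewrite -sum1_card [RHS]big_mkcond; apply: eq_bigr => v _; case: (v \in B).
have SE : ~: S = A :|: F.
  apply/setP => v; rewrite !inE negb_or; have [->|vx] := eqVneq v x.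
    by rewrite adj_irr /= andbF.
  case xv : (adj G x v) => /=; last by rewrite andbT.
  by apply/negP => /(subsetP subE); rewrite inE xv andbF.
have NE : N = A :|: N2.
  apply/setP => w; rewrite !inE; apply/existsP/orP => [[u /andP[]]|].
    rewrite /S in_setU1 => /orP[/eqP ->|uE uw]; first by left.
    by case xw : (adj G x w); [left | right; apply: closed uE uw (negbT xw)].
  case=> [xw|/andP[Mw MwE]]; first by exists x; rewrite setU11.
  exists (M w); rewrite /S in_setU1 MwE orbT /= adj_sym.
  by have [] := matM.1 w Mw.
have mE : matched M = N2 :|: N3.
  by apply/setP => w; rewrite !inE; case: (M w \in E); rewrite ?andbT ?andbF ?orbF.
have dAF : [disjoint A & F].
  rewrite -setI_eq0; apply/eqP/setP => v; rewrite !inE.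
  by case: (adj G x v); rewrite ?andbF.
have dAN : [disjoint A & N2].
  rewrite -setI_eq0; apply/eqP/setP => w; rewrite !inE; apply/negP.
  by case/and3P=> xw /matM.1[_]; rewrite xw.
have d23 : [disjoint N2 & N3].
  rewrite -setI_eq0; apply/eqP/setP => w; rewrite !inE.
  by case: (M w \in E); rewrite ?andbF.
have cF : #|F| = #|N3|.
  rewrite -(card_in_imset (f := M) (D := mem N3)); last first.
    by move=> w w'; rewrite !inE => /andP[h _] /andP[h' _]; apply: matM.2.
  apply: eq_card => u; apply/idP/imsetP => [|[w + ->]].
    rewrite in_setD => /andP[uE uL].
    have : u \notin free_left M by apply: contra uE; apply: (subsetP freeE).
    rewrite inE uL /= negb_forall => /existsP[w]; rewrite negb_imply => /andP[/eqP e wu].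
    by exists w => //; rewrite inE e eq_sym wu.
  rewrite inE => /andP[Mw MwE]; rewrite in_setD MwE.
  by have [] := matM.1 w Mw.
have -> : \sum_v double_cover v = #|~: S| + #|N|.
  rewrite -!card_sum -big_split; apply: eq_bigr => v _.
  by rewrite /double_cover -/S in_setC [v \in N]inE /=; case: (v \in S).
rewrite SE NE mE !cardsU !disjoint_setI0 // !cards0 !subn0 cF /degree -/A.
lia.
Qed.

Lemma double_cover_le v : double_cover v <= 2.
Proof. by rewrite /double_cover; case: (v \in _); case: [exists _, _]. Qed.

End Cover.

(** * Optimal stabilizers *)

Section Matchings.
Variables (V : finType) (G : sgraph V).

Lemma sum_edge (R : zmodType) (f : V -> R) u v : adj G u v ->
  (\sum_(z in [set u; v]) f z = f u + f v)%R.
Proof.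
by move=> uv; rewrite big_setU1 ?big_set1 // inE (adj_neq uv).
Qed.

Lemma card_edge e : e \in edges G -> #|e| = 2.
Proof. by case/edgesP => u [v [uv ->]]; rewrite cards2 (adj_neq uv). Qed.

Lemma card_cover_matching M : matching G M -> #|cover M| = #|M|.*2.
Proof.
move=> /andP[/subsetP sub triv]; rewrite -(eqP triv).
by rewrite (eq_bigr (fun _ => 2)) ?sum_nat_const ?muln2 // => e /sub/card_edge.
Qed.

Lemma matching0 : matching G set0.
Proof. by rewrite /matching sub0set; apply/trivIsetP => e1; rewrite inE. Qed.

Definition edge_set (T : V -> V) : {set {set V}} :=
  [set [set v; T v] | v in [set v | T v != v]].

Variable T : V -> V.
Hypothesis matT : involutive_matching G T.

Lemma edge_set_eq e v : e \in edge_set T -> v \in e -> e = [set v; T v].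
Proof.
case/imsetP => z _ -> /set2P[->//|->].
by rewrite matT.1 setUC.
Qed.

Lemma mem_edge_set u v : adj G u v -> ([set u; v] \in edge_set T) = (T u == v).
Proof.
move=> uv; apply/idP/eqP => [eT|Tu]; last first.
  by apply/imsetP; exists u; rewrite ?Tu // inE Tu eq_sym (adj_neq uv).
have /setP/(_ v) := edge_set_eq eT (set21 u v).
by rewrite !inE eqxx orbT eq_sym (adj_neq uv) => /esym/eqP.
Qed.

Lemma matching_edge_set : matching G (edge_set T).
Proof.
apply/andP; split.
  apply/subsetP => e /imsetP[v +  ->]; rewrite inE => /matT.2 vT.
  by apply/edgesP; exists v, (T v).
apply/trivIsetP => e1 e2 e1T e2T; apply: contraR => /pred0Pn[v /= /andP[v1 v2]].
by rewrite (edge_set_eq e1T v1) (edge_set_eq e2T v2).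
Qed.

Lemma cover_edge_set : cover (edge_set T) = [set v | T v != v].
Proof.
apply/setP => v; apply/bigcupP/idP => [[e eT ve]|Tv].
  case/imsetP: eT ve => z + -> /set2P[->//|->]; rewrite !inE => Tz.
  by rewrite matT.1 eq_sym.
by exists [set v; T v]; [apply/imsetP; exists v | rewrite set21].
Qed.

End Matchings.

Local Open Scope ring_scope.

(** * Weak duality and approximate complementary slackness *)

Section Duality.
Variables (R : realType) (V : finType) (G : sgraph V).
Implicit Types (w : {set V} -> R) (y : V -> R) (M : {set {set V}}).

(** The uncovered vertices stay on the left: when the matching nearly attains the value of the
    cover, the cover nearly vanishes on them. *)
Lemma sum_matching_le w y M : matching G M -> fractional_cover G w y ->
  \sum_(e in M) w e + \sum_(v | v \notin cover M) y v <= \sum_v y v.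
Proof.
move=> /andP[/subsetP sub triv] [y0 yw].
rewrite [leRHS](bigID [in cover M]) /= lerD2r big_trivIset //.
apply: ler_sum => e /sub/edgesP[u [v [uv ->]]].
by rewrite (sum_edge _ uv) yw.
Qed.

Lemma sum_matching_le_cover w y M : matching G M -> fractional_cover G w y ->
  \sum_(e in M) w e <= \sum_v y v.
Proof.
move=> matM cov; apply: le_trans (sum_matching_le matM cov).
by rewrite lerDl sumr_ge0 // => v _; case: cov.
Qed.

Lemma tau_f_le w y : fractional_cover G w y -> tau_f G w <= \sum_v y v.
Proof.
move=> cov; apply: ge_inf; last by exists y.
by exists 0 => _ [y' [y0 _] ->]; apply: sumr_ge0 => v _; apply: y0.
Qed.

Lemma stable_of_tight w y M : matching G M -> fractional_cover G w y ->
  \sum_(e in M) w e = \sum_v y v -> stable G w.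
Proof.
move=> matM cov tight; apply/eqP; rewrite eq_le; apply/andP; split.
  apply: lb_le_inf; first by exists (\sum_v y v), y.
  move=> _ [y' cov' ->]; apply: bigmax_le.
    by apply: sumr_ge0 => v _; case: cov'.
  by move=> M' matM'; apply: sum_matching_le_cover.
apply: le_trans (tau_f_le cov) _; rewrite -tight.
exact: (le_bigmax_cond _ (fun M' : {set {set V}} => \sum_(e in M') w e)).
Qed.

Lemma nu_attained w : exists2 M, matching G M & nu G w = \sum_(e in M) w e.
Proof.
pose K s := exists2 M, matching G M & s = \sum_(e in M) w e.
apply: (big_ind K) => [|a b [M1 m1 ->] [M2 m2 ->]|M matM]; last by exists M.
  by exists set0; rewrite ?matching0 // big_set0.
by rewrite /Num.max; case: ifP => _; [exists M2 | exists M1].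
Qed.

(* The bound would be exact if the infimum defining [tau_f] were known to be
   attained, by complementary slackness. *)
Lemma stable_approx w eps : (exists y, fractional_cover G w y) ->
    stable G w -> 0 < eps ->
  exists M y, [/\ matching G M, fractional_cover G w y,
    forall v, v \notin cover M -> y v <= eps &
    \sum_v y v <= \sum_(e in M) w e + eps].
Proof.
move=> [y1 cov1] st eps0; have [M matM nuE] := nu_attained w.
have [|_ [y cov ->] lt] := inf_adherent (E := fun s => exists2 y,
    fractional_cover G w y & s = \sum_v y v) eps0.
  split; first by exists (\sum_v y1 v), y1.
  by exists 0 => _ [y' [y0 _] ->]; apply: sumr_ge0 => v _; apply: y0.
have le : \sum_v y v <= \sum_(e in M) w e + eps by rewrite -nuE st ltW.
exists M, y; split=> // v vM.
have := le_trans (sum_matching_le matM cov) le; rewrite lerD2l; apply: le_trans.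
rewrite (bigD1 v) //= lerDl sumr_ge0 // => u _; by case: cov.
Qed.

(** An infimum says something about covers only if there are some. The constant cover sums over all
    sets, hence the sign condition on all of them. *)
Lemma cover_exists w : (forall e, 0 <= w e) -> exists y, fractional_cover G w y.
Proof.
move=> w0; exists (fun=> \sum_e w e); split=> [v|u v _]; first exact: sumr_ge0.
rewrite (bigD1 [set u; v]) //= -addrA lerDl addr_ge0 ?sumr_ge0 //.
by rewrite addr_ge0 ?w0 ?sumr_ge0.
Qed.

(** LP duality with an explicit dual solution: the edges at x count twice, and those of the matching
    in the double cover once. A vertex not adjacent to x meets the latter at most twice, once on
    each side. The term in [y x] admits covers that vanish at x only approximately. *)
Lemma cover_value_le x y : (forall v, 0 <= y v) ->
    (forall u v, adj G u v -> 1 <= y u + y v) ->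
  (cover_value G x)%:R - (degree G x).*2%:R * y x <= 2 * \sum_v y v.
Proof.
move=> y0 y1; have [matM _ _ _] := half_search_correct G x.
rewrite /cover_value /degree; set M := current _ in matM *.
set A := [set v | adj G x v]; set Mt := matched M.
have hA : #|A|%:R - #|A|%:R * y x <= \sum_(v in A) y v.
  rewrite -[X in X - _]mulr1 -mulrBr mulr_natl -sumr_const; apply: ler_sum => v.
  by rewrite inE => /y1; rewrite -lerBlDl.
have h1 : \sum_(v in Mt) y v <= \sum_(v | v \notin A) y v.
  rewrite [leRHS](bigID [in Mt]) /= -[leLHS]addr0 lerD ?sumr_ge0 //.
  rewrite [leRHS](eq_bigl [in Mt]) // => v; rewrite /= !inE.
  by case: eqP => [|/eqP /matM.1[_ ->]]; rewrite ?andbF.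
have h2 : \sum_(v in Mt) y (M v) <= \sum_(v | v \notin A) y v.
  rewrite -(big_imset (h := M) y) /=; last first.
    by move=> v v'; rewrite !inE; apply: matM.2.
  rewrite [leRHS](bigID [in M @: Mt]) /= -[leLHS]addr0 lerD ?sumr_ge0 //.
  rewrite [leRHS](eq_bigl [in M @: Mt]) // => v; rewrite /=.
  case vM : (v \in M @: Mt); rewrite ?andbF ?andbT //.
  case/imsetP: vM => w; rewrite !inE => /matM.1[_ _ +] ->.
  by rewrite inE => /andP[].
have h3 : #|Mt|%:R <= \sum_(v in Mt) y v + \sum_(v in Mt) y (M v).
  rewrite -big_split /= -sumr_const; apply: ler_sum => v.
  by rewrite inE => /matM.1[/y1].
rewrite (bigID [in A]) /= natrD -!muln2 !natrM.
lra.
Qed.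

End Duality.

Section Optimum.
Variables (V : finType) (G : sgraph V).

(** [y] counts in halves, so on an edge this is the excess of the cover over the unit weight. *)
Definition stabilizer (T : V -> V) (y : V -> nat) (e : {set V}) : rat :=
  if e \in edge_set T then (\sum_(v in e) y v)%N%:R / 2 - 1 else 0.

(** Minimality is proved up to every positive eps, because a competing stabilizer is only known to
    have covers close to the weight of a matching. *)
Lemma stabilizer_optimal (R : realType) (x : V) (T : V -> V) :
    involutive_matching G T -> (forall v, (T v == v) = (v == x)) ->
    (forall x', (cover_value G x <= cover_value G x')%N) ->
  min_frac_additive_stabilizer G
    (fun e => ratr (stabilizer T (double_cover G x) e) : R).
Proof.
move=> matT fixT minx; set c := fun e : {set V} => _.
set y2 := double_cover G x; pose y v : R := (y2 v)%:R / 2.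
have matM := matching_edge_set matT; set MT := edge_set T in matM.
have subM : MT \subset edges G by case/andP: matM.
have cE e : e \in MT -> c e = \sum_(v in e) y v - 1.
  move=> eM; rewrite /c /stabilizer -/MT eM rmorphB rmorph1 fmorph_div !rmorph_nat.
  by rewrite natr_sum mulr_suml.
have c0 e : e \notin MT -> c e = 0.
  by move=> eM; rewrite /c /stabilizer -/MT (negbTE eM) rmorph0.
have yy u v : adj G u v -> 1 <= y u + y v.
  move=> uv; rewrite /y -mulrDl -natrD ler_pdivlMr ?mul1r ?ler_nat //.
  exact: double_cover_edge.
have y0 v : 0 <= y v by rewrite divr_ge0.
have cM e : e \in edges G -> 0 <= c e.
  move=> eG; have [eM|/c0 -> //] := boolP (e \in MT).
  have /edgesP[u [v [uv eE]]] := eG.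
  by rewrite cE // eE (sum_edge _ uv) subr_ge0 yy.
have cov : fractional_cover G (fun e => 1 + c e) y.
  split=> // u v uv; have [eM|/c0 ->] := boolP ([set u; v] \in MT).
    by rewrite cE // (sum_edge _ uv) addrC subrK.
  by rewrite addr0 yy.
have covM : cover MT = [set~ x].
  by rewrite (cover_edge_set matT); apply/setP => v; rewrite !inE fixT.
have sumM : \sum_(e in MT) (1 + c e) = \sum_v y v.
  transitivity (\sum_(e in MT) \sum_(v in e) y v).
    by apply: eq_bigr => e /cE ->; rewrite addrC subrK.
  rewrite -big_trivIset ?covM; last by case/andP: matM.
  rewrite [RHS](bigD1 x) //= /y /y2 double_cover_root mul0r add0r.
  by apply: eq_bigl => v; rewrite !inE.
have sumy : 2 * \sum_v y v = (cover_value G x)%:R.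
  by rewrite -mulr_suml -natr_sum sum_double_cover mulrC divfK ?pnatr_eq0.
have sumc : \sum_(e in edges G) c e = \sum_v y v - #|MT|%:R.
  rewrite (big_setID MT) /= (setIidPr subM) [X in _ + X]big1 => [|e].
    by rewrite addr0 -sumM big_split /= sumr_const addrAC subrr add0r.
  by rewrite inE => /andP[/c0].
have nM : #|V| = #|MT|.*2.+1.
  by rewrite -(card_cover_matching matM) covM cardsC1 prednK //; apply/card_gt0P; exists x.
split; first by split=> //; apply: stable_of_tight matM cov sumM.
move=> c' [c'0 st]; apply/ler_addgt0Pr => eps eps0.
(* A stabilizer may be negative off the edges, whereas [cover_exists] asks for nonnegative weights
   on all sets. *)
pose w e : R := if e \in edges G then c' e else 0.
have [y1 cov1] : exists y1, fractional_cover G (fun e => 1 + c' e) y1.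
  have [|y1 [y10 y1c]] := @cover_exists R V G (fun e => 1 + w e).
    by move=> e; rewrite addr_ge0 // /w; case: ifP => // /c'0.
  exists y1; split=> // u v uv; have := y1c u v uv; rewrite /w.
  by rewrite (_ : _ \in edges G) //; apply/edgesP; exists u, v.
(* The tolerance eps / k is spent once on the value of the cover, and at most |V| times on its value
   at x', which is weighted by a degree. *)
pose k : R := #|V|.+1%:R.
have k0 : 0 < k by rewrite ltr0n.
have e0 : 0 < eps / k by rewrite divr_gt0.
have [M [y' [matM' cov' yM le]]] := stable_approx (ex_intro _ y1 cov1) st e0.
have cardM := card_cover_matching matM'.
(* By [nM] the order is odd, so the cover of a matching is not everything. *)
have [x' x'M] : exists x', x' \notin cover M.
  apply/existsP; rewrite -negb_forall; apply/negP => /forallP all.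
  have : cover M = setT by apply/setP => v; rewrite all inE.
  by move=> e; move: cardM; rewrite e cardsT nM => /(congr1 odd); rewrite /= !odd_double.
have y'1 u v : adj G u v -> 1 <= y' u + y' v.
  move=> uv; apply: le_trans (cov'.2 u v uv); rewrite lerDl c'0 //.
  by apply/edgesP; exists u, v.
have lb := cover_value_le x' cov'.1 y'1.
have subM' : M \subset edges G by case/andP: matM'.
have sumc' : \sum_(e in M) (1 + c' e) - #|M|%:R <= \sum_(e in edges G) c' e.
  rewrite big_split /= sumr_const addrAC subrr add0r.
  rewrite [leRHS](big_setID M) /= (setIidPr subM') lerDl sumr_ge0 // => e.
  by rewrite inE => /andP[_ /c'0].
have leM : #|M|%:R <= #|MT|%:R :> R.
  rewrite ler_nat; have := max_card (mem (cover M)); rewrite cardM nM.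
  by move/half_leq; rewrite doubleK /= uphalf_double.
have min : (cover_value G x)%:R <= (cover_value G x')%:R :> R by rewrite ler_nat.
have yx : (degree G x')%:R * y' x' <= #|V|%:R * (eps / k).
  by rewrite ler_pM ?ler_nat ?max_card ?(cov'.1) ?yM.
have ek : #|V|%:R * (eps / k) + eps / k = eps.
  by rewrite -[X in _ + X]mul1r -mulrDl natr1 -/k mulrC divfK ?gt_eqF.
rewrite sumc; move: lb; rewrite -muln2 natrM; set t := eps / k in le yx ek *.
lra.
Qed.

End Optimum.

(** * The program *)

Local Open Scope nat_scope.

Fixpoint reads (e : expr) : seq nat :=
  match e with
  | Cst _ => [::]
  | Get a e => a :: reads e
  | Plus e1 e2 | Minus e1 e2 => reads e1 ++ reads e2
  end.

Lemma eval_ext m m' e :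
  (forall a, a \in reads e -> m a =1 m' a) -> eval m e = eval m' e.
Proof.
elim: e => //= [a e IH|e1 IH1 e2 IH2|e1 IH1 e2 IH2] h.
- rewrite IH => [|b be]; first by apply: h; rewrite inE eqxx.
  by apply: h; rewrite inE be orbT.
- by rewrite IH1 ?IH2 // => a ae; apply: h; rewrite mem_cat ae ?orbT.
- by rewrite IH1 ?IH2 // => a ae; apply: h; rewrite mem_cat ae ?orbT.
Qed.

Fixpoint silent (c : com) : bool :=
  match c with
  | Print _ => false
  | Seq c1 c2 | If _ c1 c2 => silent c1 && silent c2
  | For _ c => silent c
  | _ => true
  end.

Lemma out_silent c s : silent c -> out (exec c s) = out s.
Proof.
elim: c s => //= [c1 IH1 c2 IH2|e c1 IH1 c2 IH2|a c IH] s.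
- by move=> /andP[? ?]; rewrite IH2 // IH1.
- by move=> /andP[? ?]; case: ifP => _; rewrite ?IH1 ?IH2.
- move=> sc; move: (iota _ _) => l; elim: l s => //= k l IHl s.
  by rewrite IHl IH.
Qed.

Notation nV := 0 (only parsing).
Notation nW := 1 (only parsing).
Notation nK := 2 (only parsing).
Notation nE := 3 (only parsing).
Notation nC := 4 (only parsing).
Notation nU := 5 (only parsing).
Notation nX := 6 (only parsing).
Notation nR := 7 (only parsing).
Notation nA := 8 (only parsing).
Notation nJ := 9 (only parsing).
Notation nI := 10 (only parsing).
Notation nH := 11 (only parsing).
Notation nB := 12 (only parsing).
Notation nT := 13 (only parsing).
Notation nZ := 14 (only parsing).
Notation aADJ := 16 (only parsing).
Notation aROW := 17 (only parsing).
Notation aCUR := 18 (only parsing).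
Notation aTAB := 19 (only parsing).
Notation aEVEN := 20 (only parsing).
Notation aTMP := 21 (only parsing).
Notation aCOV := 22 (only parsing).
Notation aNBR := 23 (only parsing).

Notation Var a := (Get a (Cst 0)).
Notation Assign a e := (Store a (Cst 0) e).
(* The array [aROW] holds the multiples of n, there being no multiplication. *)
Notation At a u e := (Get a (Plus (Get aROW (Var u)) e)).
Notation Neq e1 e2 := (Plus (Minus e1 e2) (Minus e2 e1)).
Notation "c1 ;; c2" := (Seq c1 c2) (at level 60, right associativity).

Lemma updE m a i x b j :
  upd m a i x b j = if (b == a) && (j == i) then x else m b j.
Proof. by []. Qed.

Definition Fill (a : nat) (e1 e2 : expr) : com :=
  For nK (Store a (Plus e1 (Var nK)) e2).

(** As [e2] does not read the array being filled, each new cell is determined by the memory before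
    the loop. *)
Lemma fill_correct a e1 e2 s :
    let s' := exec (Fill a e1 e2) s in
    let n := cells s size_name 0 in
    let o := eval (cells s) e1 in
    a < size_name -> a != nK ->
    a \notin reads e1 -> nK \notin reads e1 -> a \notin reads e2 ->
  (forall i, i < n -> cells s' a (o + i) = eval (upd (cells s) nK 0 i) e2) /\
  (forall j, (j < o) || (o + n <= j) -> cells s' a j = cells s a j).
Proof.
move=> s' n o alt aK ae1 Ke1 ae2.
(* [e2] may read any cell of [nK]; the last clause fixes all of them except the loop variable. *)
pose I (k : nat) (t : store) :=
  [/\ forall b, b != a -> b != nK -> cells t b =1 cells s b,
      forall i, i < k -> cells t a (o + i) = eval (upd (cells s) nK 0 i) e2,
      forall j, (j < o) || (o + k <= j) -> cells t a j = cells s a j &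
      forall i, 0 < i -> cells t nK i = cells s nK i].
suff [_ h1 h2 _] : I n s' by [].
apply: for_ind; first by split.
move=> k t ltk [t1 t2 t3 t4].
rewrite /I /=.
have e1E m x : (forall b, b != a -> b != nK -> m b =1 cells s b) ->
    eval (upd m nK 0 x) e1 = o.
  move=> hm; apply: eval_ext => b be j; rewrite /upd.
  have bK : b == nK = false by apply: contraNF Ke1 => /eqP <-.
  rewrite bK hm ?bK //; by apply: contraNneq ae1 => <-.
rewrite e1E // updE /=; split.
- by move=> b ba bK j; rewrite !updE (negbTE ba) (negbTE bK) /= t1.
- move=> i; rewrite ltnS !updE eqxx (negbTE aK) /= eqn_add2l.
  case: eqP => [-> _|ik le]; last first.
    by rewrite t2 // ltn_neqAle le andbT; apply/eqP.
  apply: eval_ext => b be j; rewrite !updE; case bK : (b == nK) => /=.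
    rewrite (eqP bK); case: j => [|j] //=; exact: t4.
  by rewrite t1 ?bK //; apply: contraNneq ae2 => <-.
- move=> j hj; rewrite !updE eqxx (negbTE aK) /=; case: eqP => [e|_].
    by exfalso; move: hj; rewrite e; lia.
  by apply: t3; lia.
- by move=> i i0; rewrite !updE eq_sym (negbTE aK) /=; case: i i0 => // i _; apply: t4.
Qed.

Section Ordinals.
Variable n : nat.

(** Data refinement: R relates memory to a mathematical state, and a loop simulates a fold over the
    same indices once every round respects R. *)
Lemma for_foldl (S : Type) (R : store -> S -> Prop) (f : S -> 'I_n -> S) a c s x :
    (forall s x (i : 'I_n), R s x -> R (exec c (set_mem s a 0 i)) (f x i)) ->
    cells s size_name 0 = n -> R s x ->
  R (exec (For a c) s) (foldl f x (enum 'I_n)).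
Proof.
move=> step /= -> ; rewrite -val_enum_ord.
by elim: (enum _) s x => //= i l IH s x Rsx; apply: IH; apply: step.
Qed.

Lemma for_iter (S : Type) (R : store -> S -> Prop) (f : S -> S) a c s x :
    (forall s x i, R s x -> R (exec c (set_mem s a 0 i)) (f x)) ->
    cells s size_name 0 = n -> R s x ->
  R (exec (For a c) s) (iter n f x).
Proof.
move=> step nE Rsx; rewrite -nE.
pose I k t := R t (iter k f x); apply: (for_ind (I := I)) => // i t _ It.
exact: step.
Qed.

Lemma foldl_all_pairs (S : Type) (f : S -> 'I_n * 'I_n -> S) x :
  foldl f x (all_pairs 'I_n) =
  foldl (fun x v => foldl (fun x w => f x (v, w)) x (enum 'I_n)) x (enum 'I_n).
Proof.
suff H (l1 l2 : seq 'I_n) y : foldl f y [seq (v, w) | v <- l1, w <- l2] =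
    foldl (fun x v => foldl (fun x w => f x (v, w)) x l2) y l1 by apply: H.
elim: l1 y => //= v l1 IH y; rewrite foldl_cat IH; congr foldl.
by elim: l2 y {IH} => //= w l2 ->.
Qed.

Lemma index_inj (u v w z : 'I_n) :
  (u * n + w == v * n + z) = (u == v) && (w == z).
Proof.
apply/eqP/andP => [e|[/eqP -> /eqP ->]] //.
have n0 : 0 < n by apply: leq_ltn_trans (ltn_ord u).
have euv : u = v.
  apply: val_inj; have := congr1 (fun k => k %/ n) e.
  by rewrite !divnMDl // !divn_small // !addn0.
by rewrite euv eqxx; split=> //; move: e; rewrite euv => /addnI/val_inj ->.
Qed.

End Ordinals.

Definition AddEven : com :=
  If (Get aEVEN (Var nU)) Skip
     (Store aEVEN (Var nU) (Cst 1) ;;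
      Fill aTAB (Get aROW (Var nU)) (Get aTMP (Var nK))).

Definition LoadRow : com := Fill aTMP (Cst 0) (At aTAB nV (Var nK)).

(** The cases of [switch] become stores in reverse order, as the last store to a cell wins. *)
Definition Switch : com :=
  Assign nU (Get aTMP (Var nC)) ;;
  Store aTMP (Var nU) (Var nU) ;;
  Store aTMP (Var nE) (Var nC) ;;
  Store aTMP (Var nC) (Var nE).

Definition WalkStep : com :=
  If (Neq (Var nC) (Var nE))
     (If (Neq (Var nC) (Var nV))
        (Switch ;; AddEven ;; Assign nE (Var nU) ;;
         Assign nC (At aTAB nW (Var nU)))
        Skip)
     Skip.

Definition WalkFrom (e : expr) : com :=
  LoadRow ;; Assign nE (Var nV) ;; Assign nC e ;; For nJ WalkStep.

Definition Blossom : com :=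
  WalkFrom (At aTAB nW (Var nV)) ;; WalkFrom (Var nW).

Definition Keep : com :=
  Assign nA (Cst 1) ;; Fill aCUR (Cst 0) (Get aTMP (Var nK)).

Definition Scan : com :=
  If (Var nA) Skip
  (If (Get aEVEN (Var nV))
    (If (At aADJ nV (Var nW))
      (If (Get aEVEN (Var nW)) Blossom
        (LoadRow ;; Assign nE (Var nV) ;; Assign nC (Var nW) ;; Switch ;;
         If (Neq (Var nU) (Var nW)) AddEven Keep))
      Skip)
    Skip).

Definition ExposedVertex : com :=
  Assign nR (Cst 0) ;;
  For nK (If (Neq (Get aCUR (Var nK)) (Var nK)) Skip (Assign nR (Var nK))).

Definition Phase : com :=
  ExposedVertex ;;
  Fill aEVEN (Cst 0) (Cst 0) ;;
  Store aEVEN (Var nR) (Cst 1) ;;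
  Fill aTAB (Get aROW (Var nR)) (Get aCUR (Var nK)) ;;
  Assign nA (Cst 0) ;;
  For nI (For nV (For nW Scan)).

Definition NearPerfect : com :=
  Fill aCUR (Cst 0) (Var nK) ;; For nH Phase ;; Phase.


Arguments exec : simpl never.

Lemma exec_seq c1 c2 s : exec (c1 ;; c2) s = exec c2 (exec c1 s).
Proof. by []. Qed.

Lemma exec_if e c1 c2 s :
  exec (If e c1 c2) s = if eval (cells s) e == 0 then exec c2 s else exec c1 s.
Proof. by []. Qed.

Lemma exec_ifT e c1 c2 s : eval (cells s) e = true -> exec (If e c1 c2) s = exec c1 s.
Proof. by rewrite exec_if => ->. Qed.

Lemma exec_ifF e c1 c2 s : eval (cells s) e = false -> exec (If e c1 c2) s = exec c2 s.
Proof. by rewrite exec_if => ->. Qed.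

Lemma exec_store a e1 e2 s :
  exec (Store a e1 e2) s = set_mem s a (eval (cells s) e1) (eval (cells s) e2).
Proof. by []. Qed.

Lemma eval_cst m k : eval m (Cst k) = k. Proof. by []. Qed.

Lemma eval_get m a e : eval m (Get a e) = m a (eval m e). Proof. by []. Qed.

Lemma eval_plus m e1 e2 : eval m (Plus e1 e2) = eval m e1 + eval m e2.
Proof. by []. Qed.

Lemma eval_minus m e1 e2 : eval m (Minus e1 e2) = eval m e1 - eval m e2.
Proof. by []. Qed.

Definition evalE := (eval_cst, eval_get, eval_plus, eval_minus).

(** * Simulation of the blossom search *)

Section Simulation.
Variables (n : nat) (G : sgraph 'I_n).

Definition env (s : store) : Prop :=
  [/\ cells s size_name 0 = n,
      forall u : 'I_n, cells s aROW u = u * n &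
      forall u v : 'I_n, cells s aADJ (u * n + v) = adj G u v].

Lemma env_frame c s : all (fun a => a \notin writes c) [:: size_name; aROW; aADJ] ->
  env s -> env (exec c s).
Proof.
move=> /and4P[h1 h2 h3 _] [e1 e2 e3].
by split=> [|u|u v]; rewrite exec_frame // ?e1 ?e2 ?e3.
Qed.

Definition holds (s : store) (a : nat) (f : 'I_n -> 'I_n) : Prop :=
  forall z : 'I_n, cells s a z = f z.

(** The rows of vertices that are not even contain leftovers of earlier phases, so nothing is asked
    of them, although [tab] is a total function. *)
Definition holds_search (s : store) (x : search 'I_n) : Prop :=
  (forall z : 'I_n, cells s aEVEN z = (z \in even x)) /\
  (forall u z : 'I_n, u \in even x -> cells s aTAB (u * n + z) = tab x u z).

Lemma holds_frame c s a f : a \notin writes c -> holds s a f -> holds (exec c s) a f.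
Proof. by move=> ac h z; rewrite exec_frame. Qed.

Lemma holds_search_frame c s x :
  all (fun a => a \notin writes c) [:: aEVEN; aTAB] ->
  holds_search s x -> holds_search (exec c s) x.
Proof.
by move=> /and3P[h1 h2 _] [e1 e2]; split=> [z|u z ux];
  rewrite exec_frame // ?e1 ?e2.
Qed.

Lemma fill_array a e2 s : cells s size_name 0 = n ->
    a < size_name -> a != nK -> a \notin reads e2 ->
  forall z : 'I_n, cells (exec (Fill a (Cst 0) e2) s) a z = eval (upd (cells s) nK 0 z) e2.
Proof.
move=> nE alt aK ae2 z.
have [h _] := fill_correct (e1 := Cst 0) s alt aK isT isT ae2.
by rewrite -(h z) // nE.
Qed.

Lemma fill_row e1 e2 s (u : 'I_n) : cells s size_name 0 = n ->
    eval (cells s) e1 = u * n ->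
    aTAB \notin reads e1 -> nK \notin reads e1 -> aTAB \notin reads e2 ->
  forall v z : 'I_n, cells (exec (Fill aTAB e1 e2) s) aTAB (v * n + z) =
    if v == u then eval (upd (cells s) nK 0 z) e2 else cells s aTAB (v * n + z).
Proof.
move=> nE uE r1 r2 r3 v z.
have [h1 h2] := fill_correct s (isT : aTAB < size_name) isT r1 r2 r3.
rewrite uE nE in h1 h2; case: eqP => [->|vu]; first exact: h1.
apply: h2; have [lt|lt|/val_inj //] := ltngtP v u.
  by have := leq_mul lt (leqnn n); rewrite mulSn; have := ltn_ord z; lia.
by have := leq_mul lt (leqnn n); rewrite mulSn; lia.
Qed.

Lemma AddEven_sim s x (u : 'I_n) T : env s -> holds_search s x ->
    holds s aTMP T -> cells s nU 0 = u ->
  holds_search (exec AddEven s) (add_even x u T).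
Proof.
move=> [nE rE aE] [ev tb] hT uE; rewrite /AddEven /add_even.
rewrite exec_if /= uE ev eqb0; case: ifP => [/negbTE ->|/negbFE ->] //.
rewrite exec_seq exec_store /= uE; set s1 := St _ _ _.
have row := @fill_row (Get aROW (Var nU)) (Get aTMP (Var nK)) s1 u.
split=> [z|v z].
  rewrite exec_frame //= updE in_setU1 /=.
  by rewrite val_eqE; case: eqP => [-> //|_]; rewrite ev.
rewrite row //=; last by rewrite !updE /= uE rE.
rewrite in_setU1; case: eqP => [_ _|_ /= vx]; first by rewrite !updE /= hT.
by rewrite updE /= tb.
Qed.

Lemma LoadRow_sim s x (v : 'I_n) : env s -> holds_search s x ->
  cells s nV 0 = v -> v \in even x -> holds (exec LoadRow s) aTMP (tab x v).
Proof.
move=> [nE rE _] [_ tb] vE vx z; rewrite /LoadRow fill_array //=.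
by rewrite !updE /= vE rE tb.
Qed.

Lemma Switch_sim s T (e c : 'I_n) : holds s aTMP T ->
    cells s nE 0 = e -> cells s nC 0 = c ->
  holds (exec Switch s) aTMP (switch T e c) /\ cells (exec Switch s) nU 0 = T c.
Proof.
move=> hT eE cE; rewrite /Switch !exec_seq !exec_store; split; last by rewrite /= !updE /= cE hT.
move=> z; rewrite /= !updE /= eE cE !hT.
rewrite /switch -!val_eqE /=.
by case: ifP => // _; case: ifP => // _; case: eqP.
Qed.

Lemma neq_eval (a b : 'I_n) : (a - b + (b - a) == 0) = (a == b).
Proof. by rewrite -val_eqE /=; lia. Qed.

(** That v' is even makes the row from which the next vertex is read meaningful. *)
Definition holds_walk (v v' : 'I_n) (s : store) (p : walk 'I_n) : Prop :=
  [/\ env s, holds_search s (walk_search p), holds s aTMP (walk_matching p),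
      v' \in even (walk_search p) &
      [/\ cells s nV 0 = v, cells s nW 0 = v', cells s nE 0 = walk_end p &
          cells s nC 0 = walk_next p]].

Lemma WalkStep_sim v v' s p : holds_walk v v' s p ->
  holds_walk v v' (exec WalkStep s) (walk_step v v' p).
Proof.
case: p => x T e c [en hx hT v'x [vE wE eE cE]]; rewrite /= in hx hT v'x eE cE.
have en' : env (exec WalkStep s) by apply: env_frame en.
have vE' : cells (exec WalkStep s) nV 0 = v by rewrite exec_frame.
have wE' : cells (exec WalkStep s) nW 0 = v' by rewrite exec_frame.
move: en' vE' wE'; rewrite /WalkStep !exec_if /= vE eE cE !neq_eval.
case: ifP => /= [_|ce] en' vE' wE'; first by split.
move: en' vE' wE'; case: ifP => /= [_|cv] en' vE' wE'; first by split.
move: en' vE' wE'; rewrite !exec_seq; have [hS uS] := Switch_sim hT eE cE.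
set s1 := exec Switch s in hS uS *.
have en1 : env s1 by apply: env_frame en.
have hx1 : holds_search s1 x by apply: holds_search_frame hx.
have hx2 := AddEven_sim en1 hx1 hS uS.
set s2 := exec AddEven s1 in hx2 *.
have hT2 : holds s2 aTMP (switch T e c) by apply: holds_frame hS.
have en2 : env s2 by apply: env_frame en1.
have u2 : cells s2 nU 0 = T c by rewrite exec_frame.
have w2 : cells s2 nW 0 = v' by rewrite exec_frame // exec_frame.
set s3 := exec (Assign nE _) s2.
have hx3 : holds_search s3 (add_even x (T c) (switch T e c)).
  exact: holds_search_frame hx2.
have en3 : env s3 by apply: env_frame en2.
set s4 := exec _ s3 => en4 v4 w4.
have v'x' : v' \in even (add_even x (T c) (switch T e c)).
  by rewrite even_add inE v'x orbT.
split=> //; split=> //.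
have [_ r2 _] := en2.
by rewrite /s4 exec_store /= !updE /= u2 w2 r2 hx2.2.
Qed.

(** [e] is evaluated after the row has been loaded and [nE] set, so its value may depend only on
    cells that these commands leave alone. *)
Lemma WalkFrom_sim (v v' c0 : 'I_n) s x e : env s -> holds_search s x ->
    cells s nV 0 = v -> cells s nW 0 = v' ->
    v \in even x -> v' \in even x ->
    (forall m, (forall a, a \in [:: nV; nW; aROW; aTAB] -> m a =1 cells s a) ->
       eval m e = c0) ->
  holds_search (exec (WalkFrom e) s) (walk_search (walk_from v v' c0 x)).
Proof.
move=> en hx vE wE vx v'x eE.
have hT := LoadRow_sim en hx vE vx.
rewrite /WalkFrom !exec_seq; set s1 := exec LoadRow s in hT *.
set s2 := exec (Assign nE _) s1; set s3 := exec (Assign nC e) s2.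
have en3 : env s3 by do 3! apply: env_frame => //.
have hx3 : holds_search s3 x by do 3! apply: holds_search_frame => //.
have hT3 : holds s3 aTMP (tab x v) by do 2! apply: holds_frame => //.
have v3 : cells s3 nV 0 = v by rewrite !exec_frame.
have w3 : cells s3 nW 0 = v' by rewrite !exec_frame.
have e3 : cells s3 nE 0 = v.
  by rewrite /s3 exec_frame // /s2 exec_store /= updE /= exec_frame.
have c3 : cells s3 nC 0 = c0.
  rewrite /s3 exec_store /= updE /=; apply: eE => a ha i.
  move: ha; rewrite !inE => /or4P[]/eqP ->;
    by rewrite ?updE /= exec_frame.
have [nE _ _] := en3.
have : holds_walk v v' s3 (Walk x (tab x v) v c0) by split.
move=> h; rewrite /walk_from card_ord.
have step t p i : holds_walk v v' t p ->
    holds_walk v v' (exec WalkStep (set_mem t nJ 0 i)) (walk_step v v' p).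
  move=> ht; apply: WalkStep_sim.
  case: ht => h1 h2 h3 h4 [h5 h6 h7 h8].
  by split.
by case: (for_iter step nE h).
Qed.

Lemma Blossom_sim (v v' : 'I_n) s x : env s -> holds_search s x ->
    cells s nV 0 = v -> cells s nW 0 = v' -> v \in even x -> v' \in even x ->
  holds_search (exec Blossom s) (blossom v v' x).
Proof.
move=> en hx vE wE vx v'x; rewrite /Blossom exec_seq /blossom.
have keep y u : u \in even x -> u \in even (walk_search (walk_from v v' y x)).
  rewrite /walk_from; elim: #|_| => //= k IH /IH; case: (iter _ _ _) => x' T e c /=.
  by case: ifP => //= _; rewrite even_add inE => ->; rewrite orbT.
have h1 : holds_search (exec (WalkFrom (At aTAB nW (Var nV))) s)
    (walk_search (walk_from v v' (tab x v' v) x)).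
  apply: WalkFrom_sim => // m hm /=.
  by rewrite !hm ?inE //; case: en => _ r _; rewrite vE wE r hx.2.
apply: WalkFrom_sim h1 _ _ _ _ _; rewrite ?keep //.
- exact: env_frame en.
- by rewrite exec_frame.
- by rewrite exec_frame.
by move=> m hm /=; rewrite hm ?inE // exec_frame.
Qed.

Definition holds_state (s : store) (st : phase_state 'I_n) : Prop :=
  [/\ env s, holds_search s (found st), cells s nA 0 = augmented st &
      holds s aCUR (current st)].

Lemma Scan_sim (v w : 'I_n) s st : holds_state s st ->
    cells s nV 0 = v -> cells s nW 0 = w ->
  holds_state (exec Scan s) (scan G st (v, w)).
Proof.
case: st => x a M [en hx aE hM] vE wE; rewrite /= in hx aE hM; rewrite [scan _ _ _]/=.
have [_ rE adjE] := en; have [ev _] := hx.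
rewrite /Scan; case: a aE => aE; first by rewrite exec_ifT.
rewrite exec_ifF //; case vx : (v \in even x); last first.
  by rewrite exec_ifF // !evalE vE ev vx.
rewrite exec_ifT; last by rewrite !evalE vE ev vx.
case vw : (adj G v w); last by rewrite exec_ifF // !evalE vE wE rE adjE vw.
rewrite exec_ifT; last by rewrite !evalE vE wE rE adjE vw.
case wx : (w \in even x).
  rewrite exec_ifT; last by rewrite !evalE wE ev wx.
  split; [exact: env_frame en | exact: Blossom_sim | by rewrite exec_frame |].
  exact: holds_frame hM.
rewrite exec_ifF; last by rewrite !evalE wE ev wx.
rewrite 4!exec_seq; have hT := LoadRow_sim en hx vE vx.
set s1 := exec LoadRow s in hT *; set s2 := exec (Assign nE _) s1.
set s3 := exec (Assign nC _) s2.
have en3 : env s3 by do 3! apply: env_frame => //.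
have hx3 : holds_search s3 x by do 3! apply: holds_search_frame => //.
have hT3 : holds s3 aTMP (tab x v) by do 2! apply: holds_frame => //.
have hM3 : holds s3 aCUR M by do 3! apply: holds_frame => //.
have e3 : cells s3 nE 0 = v.
  by rewrite /s3 exec_frame // /s2 exec_store /= updE /= exec_frame.
have w3 : cells s3 nW 0 = w by rewrite !exec_frame.
have c3 : cells s3 nC 0 = w by rewrite /s3 exec_store /= !updE /= exec_frame.
have a3 : cells s3 nA 0 = false by rewrite !exec_frame.
have [hS uS] := Switch_sim hT3 e3 c3.
set s4 := exec Switch s3 in hS uS *.
have en4 : env s4 by apply: env_frame en3.
have hx4 : holds_search s4 x by apply: holds_search_frame hx3.
have hM4 : holds s4 aCUR M by apply: holds_frame hM3.
have w4 : cells s4 nW 0 = w by rewrite exec_frame.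
have a4 : cells s4 nA 0 = false by rewrite exec_frame.
clearbody s4; rewrite exec_if !evalE uS w4 neq_eval; case: ifP => _; last first.
  split; [exact: env_frame en4 | exact: AddEven_sim | by rewrite exec_frame |].
  exact: holds_frame hM4.
split; first exact: env_frame en4.
- exact: holds_search_frame hx4.
- by rewrite /Keep exec_seq exec_frame.
move=> z; rewrite /Keep exec_seq fill_array //=; last by case: en4.
by rewrite !updE /= hS.
Qed.

(** The outer index has to survive the inner loop, whence the condition on [writes c]; and R must be
    insensitive to both indices, which are no part of the mathematical state. *)
Lemma for_for (S : Type) (R : store -> S -> Prop) (f : S -> 'I_n * 'I_n -> S) a b c s x :
    a != size_name -> b != size_name -> a != b -> size_name \notin writes c ->
    a \notin writes c ->
    (forall s x (v w : 'I_n), R s x -> cells s a 0 = v -> cells s b 0 = w ->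
       R (exec c s) (f x (v, w))) ->
    (forall s x k, R s x -> R (set_mem s a 0 k) x) ->
    (forall s x k, R s x -> R (set_mem s b 0 k) x) ->
    cells s size_name 0 = n -> R s x ->
  R (exec (For a (For b c)) s) (foldl f x (all_pairs 'I_n)).
Proof.
move=> an bn ab nc ac step Ra Rb nE Rsx; rewrite foldl_all_pairs.
pose R' t y := R t y /\ cells t size_name 0 = n.
suff [] : R' (exec (For a (For b c)) s)
  (foldl (fun x v => foldl (fun x w => f x (v, w)) x (enum 'I_n)) x (enum 'I_n)) by [].
apply: (for_foldl (R := R')) => // t y v [Rt tn].
pose R2 u z := [/\ R u z, cells u size_name 0 = n & cells u a 0 = v].
suff [] : R2 (exec (For b c) (set_mem t a 0 v))
  (foldl (fun x w => f x (v, w)) y (enum 'I_n)) by [].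
apply: (for_foldl (R := R2)).
- move=> u z w [Ru un uv].
  have n2 : cells (set_mem u b 0 w) size_name 0 = n.
    by rewrite /= updE eq_sym (negbTE bn).
  have v2 : cells (set_mem u b 0 w) a 0 = v by rewrite /= updE (negbTE ab).
  split; rewrite ?exec_frame //; apply: step => //; first exact: Rb.
  by rewrite /= updE !eqxx.
- by rewrite /= updE eq_sym (negbTE an).
split; [exact: Ra | | by rewrite /= updE !eqxx].
by rewrite /= updE eq_sym (negbTE an).
Qed.

Lemma Sweep_sim s st : holds_state s st ->
  holds_state (exec (For nV (For nW Scan)) s) (sweep G st).
Proof.
move=> h; have [[nE _ _] _ _ _] := h.
by apply: (for_for (R := holds_state)) => // t y v w; apply: Scan_sim.
Qed.

Lemma ExposedVertex_sim s M (r0 : 'I_n) : env s -> holds s aCUR M -> val r0 = 0 ->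
  cells (exec ExposedVertex s) nR 0 = exposed_vertex r0 M.
Proof.
move=> en hM r0E; rewrite /ExposedVertex exec_seq.
set s1 := exec _ s; have [nE _ _] : env s1 by apply: env_frame en.
pose R t (r : 'I_n) := holds t aCUR M /\ cells t nR 0 = r.
have R1 : R s1 r0 by split; [apply: holds_frame hM | rewrite /s1 exec_store /= updE /= r0E].
suff [] : R (exec (For nK (If (Neq (Get aCUR (Var nK)) (Var nK)) Skip
   (Assign nR (Var nK)))) s1) (exposed_vertex r0 M) by [].
apply: (for_foldl (R := R)) => // t r z [hM' rE]; rewrite exec_if /= !updE /= hM'.
by rewrite neq_eval; case: ifP => _; split.
Qed.

Lemma Phase_sim s M (r0 : 'I_n) : env s -> holds s aCUR M -> val r0 = 0 ->
  holds_state (exec Phase s) (phase G M (exposed_vertex r0 M)).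
Proof.
move=> en hM r0E; have rE := ExposedVertex_sim en hM r0E.
set r := exposed_vertex r0 M in rE *; rewrite /Phase 5!exec_seq.
set s1 := exec ExposedVertex s in rE *; set s2 := exec _ s1.
set s3 := exec _ s2; set s4 := exec _ s3; set s5 := exec _ s4.
have en1 : env s1 by apply: env_frame en.
have en2 : env s2 by apply: env_frame en1.
have en3 : env s3 by apply: env_frame en2.
have en4 : env s4 by apply: env_frame en3.
have en5 : env s5 by apply: env_frame en4.
have r2 : cells s2 nR 0 = r by rewrite exec_frame.
have ev2 (z : 'I_n) : cells s2 aEVEN z = 0.
  by rewrite /s2 fill_array //; case: en1.
have r3 : cells s3 nR 0 = r by rewrite exec_frame // exec_frame.
have hM3 : holds s3 aCUR M by do 3! apply: holds_frame => //.
have h5 : holds_state s5 (PhaseState (Search [set r] (fun=> M)) false M).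
  split=> //=; last by do 2! apply: holds_frame => //.
  split=> [z|u z].
    rewrite /s5 exec_frame // /s4 exec_frame // /s3 exec_store; clearbody s2.
    by rewrite /= updE /= r2 ev2 inE -val_eqE /=; case: ifP.
  clearbody s3; rewrite inE => ur; rewrite /s5 exec_frame // /s4 (@fill_row _ _ _ r) //.
  - by rewrite ur /= !updE /= hM3.
  - by case: en3.
  by rewrite /= r3; case: en3.
have [nE _ _] := en5; rewrite /phase card_ord.
apply: (for_iter (R := holds_state)) => // t y i ht; apply: Sweep_sim.
by case: ht => ? ? ? ?; split.
Qed.

Lemma NearPerfect_sim s (r0 : 'I_n) : env s -> val r0 = 0 ->
  holds_state (exec NearPerfect s) (all_near_perfect G r0).
Proof.
move=> en r0E; rewrite /NearPerfect 2!exec_seq; set s1 := exec _ s.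
have en1 : env s1 by apply: env_frame en.
have hM1 : holds s1 aCUR id by move=> z; rewrite /s1 fill_array //; case: en.
pose R t (M : 'I_n -> 'I_n) := env t /\ holds t aCUR M.
rewrite /all_near_perfect card_ord.
have [] : R (exec (For nH Phase) s1) (iter n (augment G r0) id).
  apply: (for_iter (R := R)) => //; last by case: en1.
  move=> t M i [ent hMt].
  by have [] := @Phase_sim (set_mem t nH 0 i) M r0 _ _ r0E.
by move=> en2 hM2; apply: Phase_sim.
Qed.

End Simulation.

(** * Programs for the half-integral covers *)

Definition HalfScan : com :=
  If (Var nA) Skip
  (If (Get aEVEN (Var nV))
    (If (At aADJ nV (Var nW))
      (If (At aADJ nX (Var nW)) Skip
        (LoadRow ;; Assign nU (Get aTMP (Var nW)) ;;
         Store aTMP (Var nW) (Var nV) ;;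
         If (Neq (Var nU) (Var nW)) AddEven Keep))
      Skip)
    Skip).

(** Truncated subtraction from 1 negates, so the first loop marks the nonneighbours of x. The second
    one erases left partners, which leaves [free_left]. All rows receive the current matching
    because the search may start anywhere in that set. *)
Definition HalfPhase : com :=
  Fill aEVEN (Cst 0) (Minus (Cst 1) (Plus (At aADJ nX (Var nK))
    (Minus (Cst 1) (Neq (Var nK) (Var nX))))) ;;
  For nK (If (Neq (Get aCUR (Var nK)) (Var nK))
             (Store aEVEN (Get aCUR (Var nK)) (Cst 0)) Skip) ;;
  For nU (Fill aTAB (Get aROW (Var nU)) (Get aCUR (Var nK))) ;;
  Assign nA (Cst 0) ;;
  For nI (For nV (For nW HalfScan)).

Definition HalfSearch : com :=
  Fill aCUR (Cst 0) (Var nK) ;; For nH HalfPhase ;; HalfPhase.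

Definition CoverValue : com :=
  Assign nT (Cst 0) ;;
  For nK (If (At aADJ nX (Var nK)) (Assign nT (Plus (Var nT) (Cst 2))) Skip) ;;
  For nK (If (Neq (Get aCUR (Var nK)) (Var nK)) (Assign nT (Plus (Var nT) (Cst 1))) Skip).

(** Adding x to [aEVEN] turns the reached vertices into [cover_set]; the next search fills this
    array afresh. *)
Definition SaveCover : com :=
  Assign nB (Var nT) ;; Assign nZ (Var nX) ;;
  Store aEVEN (Var nX) (Cst 1) ;;
  Fill aNBR (Cst 0) (Cst 0) ;;
  For nV (For nW (If (Get aEVEN (Var nV))
    (If (At aADJ nV (Var nW)) (Store aNBR (Var nW) (Cst 1)) Skip) Skip)) ;;
  Fill aCOV (Cst 0) (Plus (Minus (Cst 1) (Get aEVEN (Var nK))) (Get aNBR (Var nK))).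

Definition BestCover : com :=
  For nX (HalfSearch ;; CoverValue ;; If (Minus (Var nB) (Var nT)) SaveCover Skip).

Section HalfSimulation.
Variables (n : nat) (G : sgraph 'I_n) (x : 'I_n).

Definition root_env (s : store) : Prop := env G s /\ cells s nX 0 = x.

Lemma root_env_frame c s :
  all (fun a => a \notin writes c) [:: size_name; aROW; aADJ; nX] ->
  root_env s -> root_env (exec c s).
Proof.
move=> /and5P[h1 h2 h3 h4 _] [en xE]; split; last by rewrite exec_frame.
by apply: env_frame en; rewrite /= h1 h2 h3.
Qed.

Definition half_state (s : store) (st : phase_state 'I_n) : Prop :=
  holds_state G s st /\ cells s nX 0 = x.

Lemma HalfScan_sim (v w : 'I_n) s st : half_state s st ->
    cells s nV 0 = v -> cells s nW 0 = w ->
  half_state (exec HalfScan s) (half_scan G x st (v, w)).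
Proof.
case: st => y a M [[en hx aE hM] xE] vE wE; split; last by rewrite exec_frame.
rewrite /= in hx aE hM; rewrite [half_scan _ _ _ _]/=.
have [_ rE adjE] := en; have [ev _] := hx.
rewrite /HalfScan; case: a aE => aE; first by rewrite exec_ifT.
rewrite exec_ifF //; case vx : (v \in even y); last first.
  by rewrite exec_ifF // !evalE vE ev vx.
rewrite exec_ifT; last by rewrite !evalE vE ev vx.
case vw : (adj G v w); last by rewrite exec_ifF // !evalE vE wE rE adjE vw.
rewrite exec_ifT; last by rewrite !evalE vE wE rE adjE vw.
case xw : (adj G x w); first by rewrite exec_ifT // !evalE xE wE rE adjE xw.
rewrite exec_ifF; last by rewrite !evalE xE wE rE adjE xw.
have hT := LoadRow_sim en hx vE vx.
rewrite 3!exec_seq; set s1 := exec LoadRow s in hT *.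
set s2 := exec _ s1; set s3 := exec _ s2.
have w1 : cells s1 nW 0 = w by rewrite exec_frame.
have v1 : cells s1 nV 0 = v by rewrite exec_frame.
have a1 : cells s1 nA 0 = false by rewrite exec_frame.
have en3 : env G s3 by do 3! apply: env_frame => //.
have hx3 : holds_search s3 y by do 3! apply: holds_search_frame => //.
have hM3 : holds s3 aCUR M by do 3! apply: holds_frame => //.
have w3 : cells s3 nW 0 = w by rewrite !exec_frame.
have a3 : cells s3 nA 0 = false by rewrite !exec_frame.
have u3 : cells s3 nU 0 = tab y v w.
  by rewrite /s3 exec_frame // /s2 exec_store; clearbody s1; rewrite /= updE /= w1 hT.
have hT3 : holds s3 aTMP (fun z => if z == w then v else tab y v z).
  move=> z; rewrite /s3 exec_store /s2 exec_store; clearbody s1.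
  rewrite /= !updE /= w1 v1 hT -val_eqE /=; by case: ifP.
clearbody s3; rewrite exec_if !evalE u3 w3 neq_eval; case: ifP => _; last first.
  split; [exact: env_frame en3 | exact: AddEven_sim en3 hx3 hT3 u3 | by rewrite exec_frame |].
  exact: holds_frame hM3.
split; first exact: env_frame en3.
- exact: holds_search_frame hx3.
- by rewrite /Keep exec_seq exec_frame.
move=> z; rewrite /Keep exec_seq fill_array //=; last by case: en3.
by rewrite !updE /= hT3.
Qed.

Lemma HalfPhase_sim s M : root_env s -> holds s aCUR M ->
  half_state (exec HalfPhase s) (half_phase G x M).
Proof.
move=> en hM; rewrite /HalfPhase 4!exec_seq.
set s1 := exec _ s; set s2 := exec _ s1; set s3 := exec _ s2; set s4 := exec _ s3.
have en1 : root_env s1 by apply: root_env_frame en.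
have en2 : root_env s2 by apply: root_env_frame en1.
have en3 : root_env s3 by apply: root_env_frame en2.
have en4 : root_env s4 by apply: root_env_frame en3.
have hM1 : holds s1 aCUR M by apply: holds_frame hM.
have hM2 : holds s2 aCUR M by apply: holds_frame hM1.
have hM4 : holds s4 aCUR M by do 2! apply: holds_frame => //.
have ev1 (z : 'I_n) : cells s1 aEVEN z = (z \in nonneighbours G x).
  have [[nE rE adjE] xE] := en.
  rewrite /s1 fill_array // !evalE !updE /= xE rE adjE inE -val_eqE /=.
  case: (adj G x z) => /=; first by rewrite andbF /=; lia.
  by case: (val z =P val x) => /= h; lia.
(* The mathematical state of this loop is a set from which partners are removed one w at a time; at
   the end no partner of a matched right vertex remains. *)
have ev2 (z : 'I_n) : cells s2 aEVEN z = (z \in free_left G x M).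
  pose R t (A : {set 'I_n}) := holds t aCUR M /\ forall z : 'I_n, cells t aEVEN z = (z \in A).
  pose f (A : {set 'I_n}) w := if M w == w then A else A :\ M w.
  have [_ ->] : R s2 (foldl f (nonneighbours G x) (enum 'I_n)).
    apply: (for_foldl (R := R)) => //; last by case: en1 => [[]].
    move=> t A w [hMt evt]; have Mw : cells t aCUR w = M w by rewrite hMt.
    have e0 : (eval (cells (set_mem t nK 0 w)) (Neq (Get aCUR (Var nK)) (Var nK)) == 0) =
      (M w == w) by rewrite /= !updE /= Mw neq_eval.
    rewrite exec_if e0 /f; case: ifP => _; first by split.
    rewrite exec_store.
    have -> : eval (cells (set_mem t nK 0 w)) (Get aCUR (Var nK)) = M w.
      by rewrite /= !updE /= Mw.
    split=> // u; rewrite /= !updE /= evt in_setD1 -val_eqE /=.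
    by case: ifP.
  congr nat_of_bool; rewrite inE.
  have H l A : (z \in foldl f A l) = (z \in A) && all (fun w => (M w == z) ==> (w == z)) l.
    elim: l A => [|w l IH] A /=; first by rewrite andbT.
    rewrite IH /f; case: (M w =P w) => [->|Mw].
      by case: (w == z); rewrite ?andbT.
    rewrite in_setD1 eq_sym; case: (M w =P z) => [e|_] //=.
    by rewrite -e; case: eqP => [/esym //|_]; rewrite /= ?andbF.
  rewrite H; congr (_ && _); apply/allP/forallP => h w; last by move=> _; apply: h.
  by apply: h; rewrite mem_enum.
have tb3 (u z : 'I_n) : cells s3 aTAB (u * n + z) = M z.
  pose R t (A : seq 'I_n) := [/\ env G t, holds t aCUR M &
    forall u z : 'I_n, u \in A -> cells t aTAB (u * n + z) = M z].
  have [_ _ h] : R s3 (foldl (fun A u => u :: A) [::] (enum 'I_n)).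
    apply: (for_foldl (R := R)); last 2 first.
    - by case: en2 => [[]].
    - by case: en2 => e2 _; split.
    move=> t A w [ent hMt tbt].
    set t' := set_mem t nU 0 w.
    have ent' : env G t' by [].
    have [nE rE _] := ent'.
    have wE : cells t' nU 0 = w by rewrite /= updE.
    have hMt' : holds t' aCUR M by [].
    have tbt' : forall u z : 'I_n, u \in A -> cells t' aTAB (u * n + z) = M z by [].
    clearbody t'; split; [exact: env_frame ent' | exact: holds_frame hMt' |].
    move=> u' z'; rewrite (@fill_row _ _ _ _ w) //; last by rewrite !evalE wE rE.
    by rewrite inE; case: ifP => [_ _|_ /= /tbt' //]; rewrite /= !updE /= hMt'.
  apply: h; have H l A : u \in l -> u \in foldl (fun A u => u :: A) A l.
    elim: l A => //= w l IH A; rewrite inE => /predU1P[<-|/IH //].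
    have K l' B : u \in B -> u \in foldl (fun A u => u :: A) B l'.
      by elim: l' B => //= y l' IH' B uB; apply: IH'; rewrite inE uB orbT.
    by apply: K; rewrite mem_head.
  by apply: H; rewrite mem_enum.
have h4 : half_state s4 (PhaseState (Search (free_left G x M) (fun=> M)) false M).
  have [e4 x4] := en4; split=> //; split=> //.
  split=> [z|u z _]; first by rewrite /s4 exec_frame // /s3 exec_frame.
  by rewrite /s4 exec_frame // tb3.
have [[nE _ _] _] := en4; rewrite /half_phase card_ord.
apply: (for_iter (R := half_state)) => // t y i [[et h1 h2 h3] xt].
apply: (for_for (R := half_state)) => //; last first.
  by case: et.
by move=> u z v w; apply: HalfScan_sim.
Qed.

Lemma HalfSearch_sim s : root_env s ->
  half_state (exec HalfSearch s) (half_search G x).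
Proof.
move=> en; rewrite /HalfSearch 2!exec_seq; set s1 := exec _ s.
have en1 : root_env s1 by apply: root_env_frame en.
have hM1 : holds s1 aCUR (id : 'I_n -> 'I_n).
  by move=> z; rewrite /s1 (@fill_array n) //; case: en => [[]].
pose R t (M : 'I_n -> 'I_n) := root_env t /\ holds t aCUR M.
rewrite /half_search card_ord.
have [] : R (exec (For nH HalfPhase) s1) (iter n (half_augment G x) id).
  apply: (for_iter (R := R)) => //; last by case: en1 => [[]].
  move=> t M i [ent hMt].
  by have [[]] := @HalfPhase_sim (set_mem t nH 0 i) M ent hMt.
by move=> en2 hM2; apply: HalfPhase_sim.
Qed.

End HalfSimulation.

(** The list of indices treated so far serves as ghost state where a loop has no other mathematical
    counterpart. *)
Lemma foldl_cons (T : Type) (l A : seq T) :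
  foldl (fun A u => u :: A) A l = catrev l A.
Proof. by elim: l A => //= u l IH A; apply: IH. Qed.

Lemma foldl_count (T : finType) (P : {pred T}) c k :
  foldl (fun k z => if P z then k + c else k) k (enum T) = k + c * #|[set z | P z]|.
Proof.
have H l k0 : foldl (fun k z => if P z then k + c else k) k0 l = k0 + c * count P l.
  elim: l k0 => [|z l IH] k0 /=; first by rewrite muln0 addn0.
  by rewrite IH; case: (P z); lia.
by rewrite H -sum1_count big_enum_cond -sum1_card; congr (_ + _ * _);
  apply: eq_bigl => z; rewrite inE.
Qed.

(** * Choice of the best root *)

Section BestCover.
Variables (n : nat) (G : sgraph 'I_n).

Lemma CoverValue_sim x s (M : 'I_n -> 'I_n) : root_env G x s -> holds s aCUR M ->
  cells (exec CoverValue s) nT 0 = (degree G x).*2 + #|matched M|.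
Proof.
move=> en hM; rewrite /CoverValue 2!exec_seq.
set s1 := exec _ s; set s2 := exec _ s1.
have en1 : root_env G x s1 by apply: root_env_frame en.
have en2 : root_env G x s2 by apply: root_env_frame en1.
have hM2 : holds s2 aCUR M by do 2! apply: holds_frame => //.
have t2 : cells s2 nT 0 = (degree G x).*2.
  pose R t k := root_env G x t /\ cells t nT 0 = k.
  have [_ ->] : R s2 (foldl (fun k z => if adj G x z then k + 2 else k) 0 (enum 'I_n)).
    apply: (for_foldl (R := R)); last 2 first.
    - by case: en1 => [[]].
    - by split=> //; rewrite /s1 exec_store.
    move=> t k z [ent tk]; set t' := set_mem t nK 0 z.
    have [[_ rE adjE] xE] : root_env G x t' by [].
    have z' : cells t' nK 0 = z by [].
    have k' : cells t' nT 0 = k by [].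
    have ent' : root_env G x t' by [].
    clearbody t'; split; first exact: root_env_frame ent'.
    case xz : (adj G x z); last by rewrite exec_ifF ?k' // !evalE xE rE z' adjE xz.
    rewrite exec_ifT; last by rewrite !evalE xE rE z' adjE xz.
    by rewrite exec_store /= updE /= k'.
  by rewrite foldl_count add0n mul2n.
pose R t k := [/\ root_env G x t, holds t aCUR M & cells t nT 0 = k].
have [_ _ ->] : R (exec (For nK (If (Neq (Get aCUR (Var nK)) (Var nK))
    (Assign nT (Plus (Var nT) (Cst 1))) Skip)) s2)
  (foldl (fun k z => if M z != z then k + 1 else k) (degree G x).*2 (enum 'I_n)).
  apply: (for_foldl (R := R)); last 2 first.
  - by case: en2 => [[]].
  - by split.
  move=> t k z [ent hMt tk]; set t' := set_mem t nK 0 z.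
  have ent' : root_env G x t' by [].
  have z' : cells t' nK 0 = z by [].
  have k' : cells t' nT 0 = k by [].
  have hM' : holds t' aCUR M by [].
  clearbody t'; split; [exact: root_env_frame ent' | exact: holds_frame hM' |].
  rewrite exec_if !evalE z' hM' neq_eval if_neg; case: (M z == z); first exact: k'.
  by rewrite exec_store /= updE /= k'.
by rewrite (foldl_count [pred z | M z != z]) mul1n.
Qed.

Lemma SaveCover_sim x s k : root_env G x s -> cells s nT 0 = k ->
    (forall z : 'I_n, cells s aEVEN z = (z \in even (found (half_search G x)))) ->
  let s' := exec SaveCover s in
  [/\ cells s' nB 0 = k, cells s' nZ 0 = x &
      forall z : 'I_n, cells s' aCOV z = double_cover G x z].
Proof.
move=> en kE evE; rewrite /SaveCover 5!exec_seq.
set s1 := exec _ s; set s2 := exec _ s1; set s3 := exec _ s2.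
set s4 := exec _ s3; set s5 := exec _ s4.
have en1 : root_env G x s1 by apply: root_env_frame en.
have en2 : root_env G x s2 by apply: root_env_frame en1.
have en3 : root_env G x s3 by apply: root_env_frame en2.
have en4 : root_env G x s4 by apply: root_env_frame en3.
have en5 : root_env G x s5 by apply: root_env_frame en4.
have b1 : cells s1 nB 0 = k by rewrite /s1 exec_store /= updE /= kE.
have z2 : cells s2 nZ 0 = x.
  have [_ x1] := en1; clearbody s1; by rewrite /s2 exec_store /= updE /= x1.
have b3 : cells s3 nB 0 = k by rewrite /s3 exec_frame // /s2 exec_frame.
have z3 : cells s3 nZ 0 = x by rewrite /s3 exec_frame.
split; first by rewrite exec_frame // /s5 exec_frame // /s4 exec_frame.
  by rewrite exec_frame // /s5 exec_frame // /s4 exec_frame.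
pose S := cover_set G x.
have ev2 (z : 'I_n) : cells s2 aEVEN z = (z \in even (found (half_search G x))).
  by rewrite /s2 exec_frame // /s1 exec_frame.
have ev3 (z : 'I_n) : cells s3 aEVEN z = (z \in S).
  have [_ x2] := en2; clearbody s2; rewrite /s3 exec_store /= updE /= x2 ev2.
  by rewrite /S /cover_set in_setU1 -val_eqE /=; case: ifP.
have ev4 (z : 'I_n) : cells s4 aEVEN z = (z \in S) by rewrite /s4 exec_frame.
have nb4 (z : 'I_n) : cells s4 aNBR z = 0.
  by rewrite /s4 fill_array //; case: en3 => [[]].
have ev5 (z : 'I_n) : cells s5 aEVEN z = (z \in S) by rewrite /s5 exec_frame.
have nb5 (z : 'I_n) : cells s5 aNBR z = [exists u, (u \in S) && adj G u z].
  pose R t (A : {set 'I_n}) := [/\ env G t, forall z : 'I_n, cells t aEVEN z = (z \in S) &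
    forall z : 'I_n, cells t aNBR z = (z \in A)].
  pose f (A : {set 'I_n}) (p : 'I_n * 'I_n) :=
    if (p.1 \in S) && adj G p.1 p.2 then p.2 |: A else A.
  have [_ _ ->] : R s5 (foldl f set0 (all_pairs 'I_n)).
    apply: (for_for (R := R)) => //; last 2 first.
    - by case: en4 => [[]].
    - split; [by case: en4 | exact: ev4 | by move=> u; rewrite nb4 inE].
    move=> t A v w [ent evt nbt] vE wE; have [_ rE adjE] := ent.
    split; [exact: env_frame ent | by move=> u; rewrite exec_frame |].
    move=> u; rewrite /f /=; case vS : (v \in S) => /=; last first.
      by rewrite exec_ifF ?evalE ?vE ?evt ?vS.
    rewrite exec_ifT ?evalE ?vE ?evt ?vS //.
    case vw : (adj G v w); last first.
      by rewrite exec_ifF // !evalE vE wE rE adjE vw.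
    rewrite exec_ifT; last by rewrite !evalE vE wE rE adjE vw.
    rewrite exec_store /= updE /= wE nbt in_setU1 -val_eqE /=.
    by case: ifP.
  congr nat_of_bool.
  have H l A : (z \in foldl f A l) =
      (z \in A) || has (fun p => [&& p.1 \in S, adj G p.1 p.2 & p.2 == z]) l.
    elim: l A => [|p l IH] A /=; first by rewrite orbF.
    rewrite IH /f; case: (p.1 \in S); case: (adj G p.1 p.2) => //=.
    by rewrite in_setU1 eq_sym; case: (p.2 == z); case: (z \in A).
  rewrite H inE /=; apply/hasP/existsP => [[p _ /and3P[pS a /eqP e]]|[u /andP[uS uz]]].
    by exists p.1; rewrite pS -e.
  exists (u, z); last by rewrite /= uS uz eqxx.
  by apply/allpairsP; exists (u, z); rewrite !mem_enum.
move=> z; rewrite fill_array //; last by case: en5 => [[]].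
by clearbody s5; rewrite !evalE !updE /= ev5 nb5.
Qed.

Definition best_so_far (s : store) (l : seq 'I_n) : Prop :=
  exists x, [/\ cells s nB 0 = cover_value G x, cells s nZ 0 = x,
    forall z : 'I_n, cells s aCOV z = double_cover G x z &
    forall x', x' \in l -> cover_value G x <= cover_value G x'].

(** Makes the initial value 2 n + 1 of [nB] too large for every root, so that the first one always
    saves its cover. *)
Lemma cover_value_bound x : cover_value G x <= n + n.
Proof.
rewrite -sum_double_cover addnn -muln2.
by rewrite -[X in X * 2](card_ord n) -sum_nat_const leq_sum // => v _;
  apply: double_cover_le.
Qed.

Lemma BestCover_sim s : env G s -> cells s nB 0 = (n + n).+1 ->
  env G (exec BestCover s) /\ (0 < n -> best_so_far (exec BestCover s) (enum 'I_n)).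
Proof.
move=> en bE; split; first exact: env_frame en.
pose R t (l : seq 'I_n) := env G t /\
  (l = [::] /\ cells t nB 0 = (n + n).+1 \/ best_so_far t l).
have : R (exec BestCover s) (foldl (fun A u => u :: A) [::] (enum 'I_n)).
  apply: (for_foldl (R := R)); last 2 first.
  - by case: en.
  - by split=> //; left.
  move=> t l x [ent bt]; set t' := set_mem t nX 0 x.
  have en' : root_env G x t' by split.
  have {}bt : l = [::] /\ cells t' nB 0 = (n + n).+1 \/ best_so_far t' l.
    by case: bt => [[]|[y []]]; [left | right; exists y; split].
  clearbody t'; rewrite 2!exec_seq.
  have [[en1 [ev1 _] _ hM1] x1] := HalfSearch_sim en'.
  set t1 := exec HalfSearch t' in en1 ev1 hM1 x1 *.
  have t2E := CoverValue_sim (conj en1 x1) hM1; rewrite -/(cover_value G x) in t2E.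
  set t2 := exec CoverValue t1 in t2E *.
  have en2 : root_env G x t2 by apply: root_env_frame (conj en1 x1).
  have ev2 (z : 'I_n) : cells t2 aEVEN z = (z \in even (found (half_search G x))).
    by rewrite /t2 exec_frame.
  have b2 : cells t2 nB 0 = cells t' nB 0 by rewrite !exec_frame.
  have z2 : cells t2 nZ 0 = cells t' nZ 0 by rewrite !exec_frame.
  have c2 z : cells t2 aCOV z = cells t' aCOV z by rewrite !exec_frame.
  split; first by apply: env_frame; [|case: en2].
  right; clearbody t2; rewrite exec_if !evalE t2E b2.
  have save : (forall x', x' \in l -> cover_value G x <= cover_value G x') ->
      best_so_far (exec SaveCover t2) (x :: l).
    move=> h; have [h1 h2 h3] := SaveCover_sim en2 t2E ev2.
    exists x; split; [exact: h1 | exact: h2 | exact: h3 | move=> x'].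
    by rewrite inE => /predU1P[->|/h].
  case: bt => [[lE bt]|[y [bt zt ct mt]]].
    rewrite bt subn_eq0 leqNgt ltnS cover_value_bound.
    by apply: save => x'; rewrite lE.
  rewrite bt subn_eq0; case: leqP => [h|/ltnW h].
    exists y; rewrite b2 z2.
    split; [exact: bt | exact: zt | by move=> z; rewrite c2 | move=> x'].
    by rewrite inE => /predU1P[-> //|/mt].
  by apply: save => x' /mt; apply: leq_trans.
rewrite foldl_cons => -[_ [[e _]|[x [h1 h2 h3 h4]]]] n0.
  have : size (rev (enum 'I_n)) = 0 by rewrite /rev e.
  by rewrite size_rev size_enum_ord => e'; rewrite e' in n0.
exists x; split; [exact: h1 | exact: h2 | exact: h3 | move=> x' x'n].
by apply: h4; rewrite -/(rev _) mem_rev.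
Qed.

End BestCover.

(** * Input, output and their encodings *)

Definition ReadGraph : com :=
  Assign nT (Cst 0) ;;
  For nV (Store aROW (Var nV) (Var nT) ;;
          Assign nT (Plus (Var nT) (Get size_name (Cst 0)))) ;;
  For nV (For nW (Read nC ;;
          Store aADJ (Plus (Get aROW (Var nV)) (Var nW)) (Var nC))).

(** The doubled excess on an edge is 0, 1 or 2, so lowest terms require no gcd. *)
Definition PrintHalf (e : expr) : com :=
  If e (If (Minus e (Cst 1)) (Print (Cst 1) ;; Print (Cst 1))
                             (Print (Cst 1) ;; Print (Cst 2)))
       (Print (Cst 0) ;; Print (Cst 1)).

Definition PrintStabilizer : com :=
  For nV (For nW (If (At aADJ nV (Var nW)) (If (Minus (Var nW) (Var nV))
    (Assign nT (Cst 0) ;;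
     If (Neq (At aTAB nZ (Var nV)) (Var nW)) Skip
        (Assign nT (Minus (Plus (Get aCOV (Var nV)) (Get aCOV (Var nW))) (Cst 2))) ;;
     PrintHalf (Var nT)) Skip) Skip)).

Definition StabilizerProgram : com :=
  ReadGraph ;;
  Assign nB (Plus (Plus (Get size_name (Cst 0)) (Get size_name (Cst 0))) (Cst 1)) ;;
  BestCover ;; NearPerfect ;; PrintStabilizer.

Section InputOutput.
Variables (n : nat) (G : sgraph 'I_n).

Lemma ReadGraph_sim s :
    cells s size_name 0 = n ->
    inp s = [seq nat_of_bool (adj G i j) | i <- enum 'I_n, j <- enum 'I_n] ->
  env G (exec ReadGraph s).
Proof.
move=> sE iE; rewrite /ReadGraph 2!exec_seq; set s1 := exec _ s; set s2 := exec _ s1.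
have sE1 : cells s1 size_name 0 = n by rewrite exec_frame.
have [sE2 rE2 iE2] : [/\ cells s2 size_name 0 = n,
    forall u : 'I_n, cells s2 aROW u = u * n & inp s2 = inp s].
  pose I k t := [/\ cells t size_name 0 = n, cells t nT 0 = k * n, inp t = inp s &
    forall u, u < k -> cells t aROW u = u * n].
  have [] : I (cells s1 size_name 0) s2.
    apply: for_ind; first by split.
    move=> k t _ [h1 h2 h3 h4]; rewrite exec_seq !exec_store.
    split; rewrite /= ?updE /= ?updE /= ?h1 ?h2 ?h3 //; first by rewrite mulSn addnC.
    move=> u; rewrite ltnS leq_eqVlt !updE /=.
    by case: eqP => [-> //|_] /=; apply: h4.
  by rewrite sE1 => h1 _ h3 h4; split=> // u; apply: h4.
(* [for_for] does not connect a round with a position of the input. The state therefore carries the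
   pairs still to come, the pairs already read, and a flag telling that the rounds have followed the
   list; in the actual run the flag stays true. *)
pose R t (y : seq ('I_n * 'I_n) * seq ('I_n * 'I_n) * bool) :=
  [/\ cells t size_name 0 = n, forall u : 'I_n, cells t aROW u = u * n &
   y.2 -> inp t = [seq nat_of_bool (adj G p.1 p.2) | p <- y.1.1] /\
   forall u v : 'I_n, (u, v) \in y.1.2 -> cells t aADJ (u * n + v) = adj G u v].
pose f (y : seq ('I_n * 'I_n) * seq ('I_n * 'I_n) * bool) p :=
  (behead y.1.1, p :: y.1.2, y.2 && (ohead y.1.1 == Some p)).
have [] : R (exec (For nV (For nW (Read nC ;;
    Store aADJ (Plus (Get aROW (Var nV)) (Var nW)) (Var nC)))) s2)
    (foldl f (all_pairs 'I_n, [::], true) (all_pairs 'I_n)).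
  apply: (for_for (R := R)) => //; last first.
    split=> // _; split=> //=; rewrite iE2 iE /all_pairs map_allpairs //.
  move=> t [[rest done] ok] v w [h1 h2 h3] vE wE.
  split; [by rewrite exec_frame | by move=> u; rewrite exec_frame |].
  move=> hf; have /andP[/h3[iEt dE]] : ok && (ohead rest == Some (v, w)) := hf.
  rewrite /= in iEt dE; case: rest iEt {h3 hf} => [//|p rest iEt /eqP[pE]]; rewrite pE /= in iEt.
  rewrite exec_seq; set t1 := exec (Read nC) t.
  have c1 : cells t1 nC 0 = adj G v w by rewrite /t1 /= updE iEt.
  have i1 : inp t1 = [seq nat_of_bool (adj G p.1 p.2) | p <- rest].
    by rewrite /t1 /= iEt.
  have v1 : cells t1 nV 0 = v by rewrite /t1 exec_frame.
  have w1 : cells t1 nW 0 = w by rewrite /t1 exec_frame.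
  have r1 u : cells t1 aROW u = cells t aROW u by rewrite /t1 exec_frame.
  have a1 u : cells t1 aADJ u = cells t aADJ u by rewrite /t1 exec_frame.
  clearbody t1; rewrite exec_store !evalE v1 w1 r1 h2 c1; split=> //= u u'.
  rewrite updE eqxx /= index_inj inE xpair_eqE.
  case: eqP => [->|_] /=; last by rewrite a1; apply: dE.
  by case: eqP => [->|_] //=; rewrite a1; apply: dE.
have H (l d : seq ('I_n * 'I_n)) : foldl f (l, d, true) l = ([::], catrev l d, true).
  by elim: l d => //= p l IH d; rewrite /f /= eqxx IH.
rewrite H /= => h1 h2 /(_ isT)[_ h3]; split=> // u v; apply: h3.
rewrite -/(rev _) mem_rev; apply/allpairsP; exists (u, v).
by rewrite !mem_enum.
Qed.

Definition half_code (k : nat) : seq nat :=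
  if k is k'.+1 then if k' is _.+1 then [:: 1; 1] else [:: 1; 2] else [:: 0; 1].

Lemma PrintHalf_out s e : out (exec (PrintHalf e) s) = out s ++ half_code (eval (cells s) e).
Proof.
rewrite /PrintHalf !exec_if !evalE.
by case: (eval _ e) => [|[|k]]; rewrite /= -!cats1 -!catA.
Qed.

Lemma PrintStabilizer_sim s (T : 'I_n -> 'I_n) (y : 'I_n -> nat) :
    env G s -> (forall v : 'I_n, cells s aTAB (cells s aROW (cells s nZ 0) + v) = T v) ->
    (forall v : 'I_n, cells s aCOV v = y v) ->
  out (exec PrintStabilizer s) = out s ++
    flatten [seq half_code (if T p.1 == p.2 then y p.1 + y p.2 - 2 else 0)
            | p <- [seq p <- all_pairs 'I_n | adj G p.1 p.2 && (p.1 < p.2)]].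
Proof.
move=> en hT hy.
pose R t o := [/\ env G t,
  forall v : 'I_n, cells t aTAB (cells t aROW (cells t nZ 0) + v) = T v,
  forall v : 'I_n, cells t aCOV v = y v & out t = o].
pose g (p : 'I_n * 'I_n) :=
  half_code (if T p.1 == p.2 then y p.1 + y p.2 - 2 else 0).
pose f o (p : 'I_n * 'I_n) := if adj G p.1 p.2 && (p.1 < p.2) then o ++ g p else o.
have [_ _ _ ->] : R (exec PrintStabilizer s) (foldl f (out s) (all_pairs 'I_n)).
  apply: (for_for (R := R)) => //; last by case: en.
  move=> t o v w [ent hTt hyt ot] vE wE; have [_ rE adjE] := ent.
  split; [exact: env_frame ent | by move=> u; rewrite !exec_frame |
    by move=> u; rewrite exec_frame |].
  rewrite /f /=; case vw : (adj G v w); last first.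
    by rewrite exec_ifF // !evalE vE wE rE adjE vw.
  rewrite exec_ifT; last by rewrite !evalE vE wE rE adjE vw.
  rewrite exec_if !evalE vE wE subn_eq0 leqNgt; case: ltnP => _ //=.
  rewrite 2!exec_seq PrintHalf_out !out_silent // ot; congr (_ ++ half_code _).
  set t1 := exec _ t.
  have v1 : cells t1 nV 0 = v by rewrite /t1 exec_frame.
  have w1 : cells t1 nW 0 = w by rewrite /t1 exec_frame.
  have T1 : cells t1 aTAB (cells t1 aROW (cells t1 nZ 0) + v) = T v.
    by rewrite /t1 !exec_frame.
  have y1 u : cells t1 aCOV u = cells t aCOV u by rewrite /t1 exec_frame.
  have k1 : cells t1 nT 0 = 0 by rewrite /t1 exec_store.
  clearbody t1; rewrite exec_if !evalE v1 w1 T1 neq_eval.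
  case: ifP => _; last exact: k1.
  by rewrite exec_store /= updE /= v1 w1 !y1 !hyt.
have H l o : foldl f o l =
    o ++ flatten [seq g p | p <- [seq p <- l | adj G p.1 p.2 && (p.1 < p.2)]].
  elim: l o => [|p l IH] o /=; first by rewrite cats0.
  by rewrite IH /f; case: ifP => //= _; rewrite -catA.
exact: H.
Qed.

End InputOutput.

(** On an edge the doubled cover values add up to at least 2, and each is at most 2; the three cases
    are decided by computation in [rat]. *)
Lemma half_codeE (k : nat) : 2 <= k <= 4 ->
  half_code (k - 2) = [:: `|numq (k%:R / 2 - 1)|%N; `|denq (k%:R / 2 - 1)|%N].
Proof. by case: k => [|[|[|[|[|k]]]]]. Qed.

Lemma half_code0 : half_code 0 = [:: `|numq 0|%N; `|denq 0|%N].
Proof. by []. Qed.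

Section Encoding.
Variables (n : nat) (G : sgraph 'I_n).

Lemma stabilizer_code (T : 'I_n -> 'I_n) (y : 'I_n -> nat) u v :
    involutive_matching G T -> adj G u v -> 2 <= y u + y v <= 4 ->
  half_code (if T u == v then y u + y v - 2 else 0) =
  [:: `|numq (stabilizer T y [set u; v])|%N; `|denq (stabilizer T y [set u; v])|%N].
Proof.
move=> matT uv yuv; rewrite /stabilizer (mem_edge_set matT uv).
case: ifP => _; last exact: half_code0.
by rewrite half_codeE // big_setU1 ?big_set1 // inE (adj_neq uv).
Qed.

Lemma encode_stabilizer (T : 'I_n -> 'I_n) (y : 'I_n -> nat) :
    involutive_matching G T ->
    (forall u v, adj G u v -> 2 <= y u + y v) -> (forall v, y v <= 2) ->
  encode_weights G (stabilizer T y) =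
    flatten [seq half_code (if T p.1 == p.2 then y p.1 + y p.2 - 2 else 0)
            | p <- [seq p <- all_pairs 'I_n | adj G p.1 p.2 && (p.1 < p.2)]].
Proof.
move=> matT y1 y2; rewrite /encode_weights; congr flatten.
apply/eq_in_map => p; rewrite mem_filter => /andP[/andP[a _] _].
rewrite stabilizer_code // y1 //= -[4]/(2 + 2).
exact: leq_add.
Qed.

(** The input consists of n^2 + 1 numbers of at least one bit each. *)
Lemma size_bound : n <= bit_size (encode_graph G).
Proof.
have h : size (encode_graph G) <= bit_size (encode_graph G).
  by rewrite /bit_size -sum1_size leq_sum.
apply: leq_trans h; rewrite /encode_graph /= size_allpairs -cardE card_ord.
by case: n => // k; rewrite ltnW // ltnS leq_pmulr.
Qed.

End Encoding.

Lemma program_ok : com_ok StabilizerProgram.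
Proof. by []. Qed.

Lemma program_correct n (G : sgraph 'I_n) : factor_critical G ->
  exists c : {set 'I_n} -> rat,
    out (exec StabilizerProgram (initial_store n (behead (encode_graph G)))) =
      encode_weights G c /\
    forall R : realType, min_frac_additive_stabilizer G (fun e => ratr (c e) : R).
Proof.
move=> crit; have crit' z := factor_critical_involution z crit.
rewrite /StabilizerProgram 4!exec_seq.
set s0 := initial_store _ _; set s1 := exec ReadGraph s0; set s2 := exec _ s1.
set s3 := exec BestCover s2; set s4 := exec NearPerfect s3.
have en1 : env G s1 by apply: ReadGraph_sim.
have en2 : env G s2 by apply: env_frame en1.
have b2 : cells s2 nB 0 = (n + n).+1.
  have [sE _ _] := en1; clearbody s1; by rewrite /s2 exec_store /= updE /= sE addn1.
have [en3 best] := BestCover_sim en2 b2; rewrite -/s3 in en3 best.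
have en4 : env G s4 by apply: env_frame en3.
have out4 : out s4 = [::] by rewrite !out_silent.
(* The empty graph is vacuously factor-critical but has no vertex to serve as a root. *)
case: (posnP n) => [n0|n0].
  have noV (v : 'I_n) : False by case: v => v; rewrite n0.
  have noE : edges G = set0.
    by apply/setP => e; rewrite in_set0; apply/negbTE/edgesP => -[u]; case: (noV u).
  exists (stabilizer id (fun=> 0)); split.
    by rewrite (@PrintStabilizer_sim n G _ id (fun=> 0)) // out4 encode_stabilizer.
  move=> R; split; last first.
    by move=> c' _; rewrite noE !big_set0.
  split; first by move=> e; rewrite noE inE.
  apply: (@stable_of_tight R _ G _ (fun=> 0%R) set0); first exact: matching0.
    by split=> u; case: (noV u).
  by rewrite big_set0 big1.
have [x [_ zE yE xmin]] := best n0.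
have [_ [_ tbE] _ _] : holds_state G s4 (all_near_perfect G (Ordinal n0)).
  exact: NearPerfect_sim.
have [evT crit''] := @all_near_perfect_correct _ G (Ordinal n0) crit'.
set st := all_near_perfect G (Ordinal n0) in tbE evT crit''.
have [matT fixT] := crit'' x.
have xE : x \in even (found st).
  by rewrite evT inE.
have rE4 : cells s4 aROW (cells s4 nZ 0) = x * n.
  have -> : cells s4 nZ 0 = x by rewrite /s4 exec_frame.
  by case: en4.
exists (stabilizer (tab (found st) x) (double_cover G x)); split.
  rewrite (@PrintStabilizer_sim n G _ (tab (found st) x) (double_cover G x)) //.
  - rewrite out4 encode_stabilizer //.
      exact: double_cover_edge.
    exact: double_cover_le.
  - by move=> v; rewrite rE4 tbE.
  - by move=> v; rewrite /s4 exec_frame.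
by move=> R; apply: stabilizer_optimal => // x'; apply: xmin; rewrite mem_enum.
Qed.

Local Open Scope ring_scope.

Theorem theorem3 :
  exists (P : program) (p : {poly nat}),
    forall (n : nat) (G : sgraph 'I_n), factor_critical G ->
    exists (c : {set 'I_n} -> rat) (t : nat),
      [/\ (t <= p.[bit_size (encode_graph G)])%N,
          computes_within P t (encode_graph G) (encode_weights G c)
        & forall R : realType,
            min_frac_additive_stabilizer G (fun e => ratr (c e) : R)].
Proof.
exists (machine_code StabilizerProgram), (1%:P + cost_poly StabilizerProgram).
move=> n G crit; have [c [outE optE]] := program_correct crit.
have [t le_t comp] :=
  machine_code_correct n (behead (encode_graph G)) program_ok.
exists c, t; split; last exact: optE.
- by apply: leq_trans le_t _; apply: horner_nat_le; apply: size_bound.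
- by rewrite outE in comp.
Qed.
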